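(* There exists a positive constant $\varpi$ depending only on $f$, given by $\varpi=\dfrac{\rho_1}{\|f'\|_\infty}$, such that the following holds. Let $g:\mathbb{R}\to\mathbb{R}$ be a bounded function such that there exists $\kappa>0$ with $|g(x)|\le e^{\kappa x}$ for all $x\in\mathbb{R}$, and such that $g>-\varpi$. Then there exists a function $u_\infty=u_\infty(t,x)$ defined for $t\in\mathbb{R}$, $x\in\mathbb{R}$, solution of $$\partial_t u-\partial_{xx}u=f(u)\,(1+g(x)),\qquad t\in\mathbb{R},\ x\in\mathbb{R},$$ which satisfies $$\|u_\infty(t,\cdot)-\varphi(\cdot-ct)\|_{L^\infty(\mathbb{R})}\longrightarrow 0\quad\text{as } t\to-\infty.$$
   Context: Nonlinearity: $f\in C^3([0,1])$, and there is $\theta\in(0,1)$ with $f(0)=f(\theta)=f(1)=0$, $f'(0)<0$, $f'(1)<0$, $f<0$ on $(0,\theta)$, $f>0$ on $(\theta,1)$, and $\int_0^1 f(s)\,ds>0$. $\|f'\|_\infty$ is the sup norm on $[0,1]$. Since $f$ is defined on $[0,1]$, solutions are understood to take values in $[0,1]$. Travelling wave: $(c,\varphi)\in\mathbb{R}\times C^5(\mathbb{R})$ is the unique pair with $\varphi''+c\varphi'+f(\varphi)=0$ on $\mathbb{R}$, $\varphi(-\infty)=1$, $\varphi(+\infty)=0$, $\varphi(0)=\theta$. (The condition $\int_0^1 f>0$ gives $c>0$.) Spectral gap: let $\mathfrak{X}=BUC_0(\mathbb{R})$ be the Banach space of bounded uniformly continuous functions tending to $0$ at $\pm\infty$, and let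 $\mathcal{L}v=v''+cv'+f'(\varphi)v$ with its natural domain in $\mathfrak{X}$. It is known that $0$ is the first eigenvalue of $\mathcal{L}$, is isolated in the spectrum, and has null space $\mathbb{R}\varphi'$. $\rho_1>0$ denotes the spectral gap between $0$ and the rest of the spectrum, i.e. the supremum of all $\rho>0$ such that every element of the spectrum of $\mathcal{L}$ other than $0$ has real part at most $-\rho$. *)

(* Defs.v *)
From HB Require Import structures.
From mathcomp Require Import all_boot all_order all_algebra.
From mathcomp Require Import all_classical all_reals all_analysis.
From mathcomp.real_closed Require Import complex.

Set Implicit Arguments.
Unset Strict Implicit.
Unset Printing Implicit Defensive.

Import Order.TTheory GRing.Theory Num.Theory.
Import numFieldNormedType.Exports.

Local Open Scope ring_scope.
Local Open Scope classical_set_scope.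

(* In [ring_scope] these notations are those of formal derivatives of polynomials. *)
Local Notation "f ^` ()" := (derive1 f) : ring_scope.
Local Notation "f ^` ( n )" := (derive1n n f) : ring_scope.

(* Calculus relative to a set [A]: at an end point of [A = `[0, 1]] the limit is
   the one-sided one, so values taken outside [A] play no role. *)
Definition derivable_within (R : realType) (A : set R) (f : R -> R) (x : R) : Prop :=
  cvg ((f y - f x) / (y - x) @[y --> within A x^']).

Definition derive_within (R : realType) (A : set R) (f : R -> R) (x : R) : R :=
  lim ((f y - f x) / (y - x) @[y --> within A x^']).

Definition Ck_within (R : realType) (A : set R) (k : nat) (f : R -> R) : Prop :=
  (forall j : nat, (j < k)%N -> forall x : R, A x ->
     derivable_within A (iter j (derive_within A) f) x) /\
  {within A, continuous (iter k (derive_within A) f)}.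

Definition Ck (R : realType) (k : nat) (f : R -> R) : Prop :=
  (forall j : nat, (j < k)%N -> forall x : R, derivable (f^`(j)) x 1) /\
  continuous (f^`(k)).

(* A function on [0, 1] is represented by an arbitrary [f : R -> R] of which only
   the restriction to [0, 1] is ever used; [f'] is the derivative on [0, 1]. *)
Definition f' (R : realType) (f : R -> R) : R -> R := derive_within `[0, 1] f.

Definition f'_supnorm (R : realType) (f : R -> R) : R :=
  sup [set `|f' f s| | s in `[0, 1]].

Definition bistable (R : realType) (f : R -> R) (theta : R) : Prop :=
  [/\ 0 < theta < 1,
      Ck_within `[0, 1] 3 f,
      [/\ f 0 = 0, f theta = 0 & f 1 = 0],
      f' f 0 < 0 /\ f' f 1 < 0 &
      [/\ forall s : R, 0 < s < theta -> f s < 0,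
          forall s : R, theta < s < 1 -> 0 < f s &
          0 < (\int[lebesgue_measure]_(s in `[0, 1]) f s)%R]].

Definition travelling_wave (R : realType) (f : R -> R) (theta c : R)
    (phi : R -> R) : Prop :=
  [/\ Ck 5 phi,
      forall x : R, 0 <= phi x <= 1,
      forall x : R, phi^`(2) x + c * phi^`() x + f (phi x) = 0,
      phi x @[x --> -oo] --> (1 : R) /\ phi x @[x --> +oo] --> (0 : R) &
      phi 0 = theta].

Definition BUC0 (R : realType) (v : R -> R) : Prop :=
  [/\ exists M : R, forall x : R, `|v x| <= M,
      unif_continuous v,
      v x @[x --> -oo] --> (0 : R) &
      v x @[x --> +oo] --> (0 : R)].

Definition domL (R : realType) (v : R -> R) : Prop :=
  [/\ BUC0 v,
      forall x : R, derivable v x 1,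
      BUC0 (v^`()),
      forall x : R, derivable (v^`()) x 1 &
      BUC0 (v^`(2))].

Definition opL (R : realType) (f : R -> R) (c : R) (phi v : R -> R) : R -> R :=
  fun x : R => v^`(2) x + c * v^`() x + f' f (phi x) * v x.

(* The spectrum is that of the complexification of the (real) operator [opL];
   complex-valued functions are handled through their real and imaginary parts. *)
Definition BUC0C (R : realType) (v : R -> R[i]) : Prop :=
  BUC0 (fun x : R => complex.Re (v x)) /\ BUC0 (fun x : R => complex.Im (v x)).

Definition domLC (R : realType) (v : R -> R[i]) : Prop :=
  domL (fun x : R => complex.Re (v x)) /\ domL (fun x : R => complex.Im (v x)).

Definition opLC (R : realType) (f : R -> R) (c : R) (phi : R -> R)
    (v : R -> R[i]) : R -> R[i] :=
  fun x : R => Complex (opL f c phi (fun y : R => complex.Re (v y)) x)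
                       (opL f c phi (fun y : R => complex.Im (v y)) x).

(* [lam - L] is a bijection from the domain onto the space, and its inverse is
   bounded for the sup norm. *)
Definition resolvent_set (R : realType) (f : R -> R) (c : R) (phi : R -> R)
    : set R[i] :=
  [set lam : R[i] |
    (forall w : R -> R[i], BUC0C w ->
       exists! v : R -> R[i], domLC v /\
         forall x : R, lam * v x - opLC f c phi v x = w x) /\
    (exists K : R, forall (v : R -> R[i]) (M : R), domLC v ->
       (forall x : R, Normc.normc (lam * v x - opLC f c phi v x) <= M) ->
       forall x : R, Normc.normc (v x) <= K * M)].

Definition spectrum (R : realType) (f : R -> R) (c : R) (phi : R -> R)
    : set R[i] := ~` resolvent_set f c phi.

(* [sup] is 0 on the empty set and on unbounded sets, so [0 < spectral_gap f c phi]
   ensures that it is a genuine supremum. *)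
Definition spectral_gap (R : realType) (f : R -> R) (c : R) (phi : R -> R) : R :=
  sup [set rho : R | 0 < rho /\
    forall lam : R[i], spectrum f c phi lam -> lam != 0 ->
      complex.Re lam <= - rho].

(* [measurable_fun] refers to Borel sets; this is Lebesgue measurability. *)
Definition lebesgue_measurable (R : realType) (g : R -> R) : Prop :=
  exists h : R -> R, measurable_fun setT h /\
    {ae (@lebesgue_measure R), forall x : R, g x = h x}.

(* Since [g] need not be continuous, [u_xx] cannot be expected to exist for every
   [x]: solutions are strong solutions. They are C^1 in [t] and in [x], [u_x] is
   locally Lipschitz in [x] (i.e. [u t] is locally W^{2,oo}), and the equation
   holds for every [t] and almost every [x]. Integrating it in [x] shows that it
   holds classically at every point of continuity of [g]. *)
Definition strong_solution (R : realType) (f g : R -> R) (u : R -> R -> R)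
    : Prop :=
  [/\ (forall t x : R, 0 <= u t x <= 1) /\
        continuous (fun p : R * R => u p.1 p.2),
      (forall t x : R, derivable (fun s : R => u s x) t 1) /\
        continuous (fun p : R * R => (fun s : R => u s p.2)^`() p.1),
      (forall t x : R, derivable (u t) x 1) /\
        continuous (fun p : R * R => (u p.1)^`() p.2),
      forall t a b : R, [lipschitz ((u t)^`() x) | x in `[a, b]] &
      forall t : R, {ae (@lebesgue_measure R), forall x : R,
        derivable ((u t)^`()) x 1 /\
        (fun s : R => u s x)^`() t - (u t)^`(2) x = f (u t x) * (1 + g x)}].

(* Main.v *)
Require Import Defs.
From HB Require Import structures.
From mathcomp Require Import all_boot all_order all_algebra.
From mathcomp Require Import all_classical all_reals all_analysis.
From mathcomp.real_closed Require Import complex.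
From mathcomp Require Import archimedean measurable_realfun charge ring lra.

Set Implicit Arguments.
Unset Strict Implicit.
Unset Printing Implicit Defensive.

Import Order.TTheory GRing.Theory Num.Theory.
Import numFieldNormedType.Exports.

Local Open Scope ring_scope.
Local Open Scope classical_set_scope.

(** The proof is a comparison argument for the entire problem, started at [t = -oo].

    Sign of [1 + g]. The derivative [f' 0] belongs to the spectrum of the linearized
    operator: far ahead of the front the operator is close to one with constant
    coefficients and zeroth order term [f' 0], and very wide bumps placed there are
    approximate eigenfunctions ([spectrum_f'0]). Hence the spectral gap is at most
    [- f' 0], so [varpi <= 1] and [1 + g >= 0].

    Barriers. As [t -> -oo] the front sits near [c t], and [c > 0], so it is far to the
    left, where [g] is exponentially small; where [g] is not small, the wave is
    exponentially close to [0]. Thus [g f (phi)] is of order [exp (r t)] uniformly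
    in space ([perturbation_small]), and
    [phi (x - c t -+ drift t) +- ampl t], with [drift] and [ampl] multiples of
    [exp (r t)], are a super- and a subsolution for [t <= start]
    ([profile_defect]); after that time the constants [1] and [0] take over. The facts
    needed about the wave, namely [c > 0], strict monotonicity and exponential decay
    at the front, follow from the energy identity.

    Existence. For large [K] the equation is equivalent to [K u = avg (K u + (1 + g) f (u))],
    where [avg] averages over heat paths run backwards and killed at rate [K]
    ([heat_representation]). Since [1 + g >= 0] is bounded, the right-hand side is
    monotone in [u] on all of space-time, and the iterates started from the
    subsolution increase to a fixed point below the supersolution
    ([monotone_fixed_point]). No initial-value problem is solved: the average over the whole
    past plays that role.

    Regularity ([fixed_point_regularity]). Heat averages of bounded functions are almost
    Lipschitz in time ([avg_modulus]); a fixed point is therefore Lipschitz in time,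
    then, by the same estimate for its difference quotients, C^1 in time. Its second
    differences in space are those of the double primitive of the bounded function
    [u_t - (1 + g) f (u)] ([heat_second_difference]), so that [u t] is that double
    primitive up to an affine function: it is C^1 with Lipschitz slope, and the
    equation holds wherever the primitive is differentiable, that is almost everywhere. *)

(** * Differential calculus on the line *)

Section calculus.
Context {R : realType}.
Implicit Types (g : R -> R).

(** Differentiability without filters: the form in which derivatives are built and
    used below, since most of them come from explicit uniform error bounds. *)
Lemma is_derive_eps (f : R -> R) (x l : R) :
  (forall e : R, 0 < e -> exists2 d : R, 0 < d & forall h : R, `|h| < d ->
     `|f (x + h) - f x - l * h| <= e * `|h|) -> is_derive x 1 f l.
Proof.
move=> H.
have cv : h^-1 *: (f (h *: (1 : R) + x) - f x) @[h --> 0^'] --> l.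
  apply/cvgrPdist_le => e e0; have [d d0 Hd] := H _ e0.
  near=> h; have h0 : h != 0 by near: h; exact: nbhs_dnbhs_neq.
  have hd : `|h| < d by near: h; apply: dnbhs0_lt.
  have := Hd _ hd; rewrite [h *: 1]mulr1 (addrC h) => H2.
  rewrite -(ler_pM2l (_ : 0 < `|h|)) ?normr_gt0// -normrM mulrBr.
    rewrite [h^-1 *: _]/(h^-1 * _) mulVKf// distrC [h * l]mulrC [X in _ <= X]mulrC; exact: H2.
by split; [apply/cvg_ex; exists l|apply/cvg_lim].
Unshelve. all: by end_near. Qed.

Lemma is_derive_epsP (f : R -> R) (x l : R) : is_derive x 1 f l ->
  forall e : R, 0 < e -> exists2 d : R, 0 < d & forall h : R, `|h| < d ->
     `|f (x + h) - f x - l * h| <= e * `|h|.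
Proof.
move=> [df <-] e e0.
have := df => /cvgrPdist_le /(_ e e0).
move=> /nbhs_ballP[d /= d0 Hd]; exists d => // h hd.
have [->|h0] := eqVneq h 0; first by rewrite addr0 subrr mulr0 subr0 !normr0 mulr0.
have := Hd h; rewrite /ball/= sub0r normrN => /(_ hd h0).
rewrite [h *: 1]mulr1 (addrC h) -(ler_pM2l (_ : 0 < `|h|)) ?normr_gt0// -normrM mulrBr.
by rewrite [h^-1 *: _]/(h^-1 * _) mulVKf// distrC [h * _]mulrC [X in _ <= X]mulrC.
Qed.

Lemma is_derive_cont g g' : (forall x : R, is_derive x (1 : R) g (g' x)) -> continuous g.
Proof.
by move=> dg x; apply: differentiable_continuous; apply/derivable1_diffP; exact: ex_derive.
Qed.

Lemma mvt g g' (a b : R) : (forall x : R, is_derive x (1 : R) g (g' x)) -> a <= b ->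
  exists2 z, a <= z <= b & g b - g a = g' z * (b - a).
Proof.
move=> dg ab; have [z] := MVT_segment ab (fun y _ => dg y) (continuous_subspaceT (is_derive_cont dg)).
by rewrite in_itv/= => zab E; exists z.
Qed.

Lemma derive_le0 g g' (a b : R) : (forall x : R, is_derive x (1 : R) g (g' x)) -> a <= b ->
  (forall z, a <= z <= b -> g' z <= 0) -> g b <= g a.
Proof.
move=> dg ab H; have [z zab E] := mvt dg ab.
by rewrite -subr_le0 E mulr_le0_ge0 ?subr_ge0// H.
Qed.

Lemma derive_ge0 g g' (a b : R) : (forall x : R, is_derive x (1 : R) g (g' x)) -> a <= b ->
  (forall z, a <= z <= b -> 0 <= g' z) -> g a <= g b.
Proof.
move=> dg ab H; have [z zab E] := mvt dg ab.
by rewrite -subr_ge0 E mulr_ge0 ?subr_ge0// H.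
Qed.

Lemma global_min_derive0 g g' (m r : R) : (forall x : R, is_derive x (1 : R) g (g' x)) -> 0 < r ->
  (forall y, `|y - m| < r -> g m <= g y) -> g' m = 0.
Proof.
move=> dg r0 H.
have mI : m \in `]m - r, m + r[%R by rewrite in_itv/= ltrBlDr !ltrDl r0.
have I : m - r <= m + r by lra.
have dgd (t : R) : t \in `]m - r, m + r[%R -> derivable g t 1 by move=> _; exact: ex_derive.
have := @derive1_at_min R g (m - r) (m + r) m I dgd mI.
move=> D; have {D} D : is_derive m 1 g 0.
  apply: D => t; rewrite in_itv/= => /andP[h1 h2]; apply: H; rewrite ltr_norml; apply/andP; split; lra.
by rewrite -(@derive_val _ _ _ _ _ _ _ D) (@derive_val _ _ _ _ _ _ _ (dg m)).
Qed.

Lemma is_derive_scale (a : R) g (x l : R) : is_derive x (1 : R) g l ->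
  is_derive x (1 : R) (fun x => a * g x) (a * l).
Proof.
by move=> dg; apply: is_derive_eq (is_deriveM (is_derive_cst a x 1) dg) _; rewrite scaler0 addr0.
Qed.

Lemma is_derive_lin (a x : R) : is_derive x (1 : R) (fun x => a * x) a.
Proof. by apply: is_derive_eq (is_derive_scale a (is_derive_id x 1)) _; exact: mulr1. Qed.

Lemma lipschitz_continuous g (C : R) : (forall v v' : R, `|g v' - g v| <= C * `|v' - v|) ->
  continuous g.
Proof.
move=> gL v.
have C0 : 0 <= C by have := gL 0 1; rewrite subr0 normr1 mulr1; apply: le_trans.
have C1 : 0 < C + 1 by rewrite ltr_wpDl.
apply/cvgrPdist_le => e e0; near=> w.
rewrite distrC (le_trans (gL _ _))// (@le_trans _ _ ((C + 1) * `|w - v|))//.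
  by apply: ler_wpM2r => //; rewrite lerDl.
rewrite mulrC -ler_pdivlMr// distrC; near: w.
by apply: cvgr_dist_le; [exact: cvg_id|exact: divr_gt0].
Unshelve. all: by end_near. Qed.

Lemma continuous2_comp (T : topologicalType) (G : R -> R -> R) (al be : T -> R) :
  continuous (fun p : R * R => G p.1 p.2) -> continuous al -> continuous be ->
  continuous (fun x => G (al x) (be x)).
Proof.
move=> cG cal cbe x.
apply: (@continuous_comp _ _ _ (fun x => (al x, be x)) (fun p : R * R => G p.1 p.2)); last exact: cG.
exact: (cvg_pair (cal x) (cbe x)).
Qed.

Lemma continuous_translate g (a : R) : continuous g -> continuous (fun x => g (x + a)).
Proof.
move=> cg x; apply: (@continuous_comp _ _ _ (fun x : R => x + a) g); last exact: cg.
by apply: cvgD; [exact: cvg_id|exact: cvg_cst].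
Qed.

Lemma reflect_derive (g : R -> R) (a s l : R) : is_derive (a - s) (1 : R) g l ->
  is_derive s (1 : R) (fun s => g (a - s)) (- l).
Proof.
move=> dg; apply: is_derive_eps => r r0; have [d d0 D] := is_derive_epsP dg r0.
exists d => // u ud; have := D (- u); rewrite normrN => /(_ ud).
by rewrite mulrN mulNr opprK opprD addrA.
Qed.

Lemma translate_derive (g : R -> R) (a s l : R) : is_derive (s + a) (1 : R) g l ->
  is_derive s (1 : R) (fun s => g (s + a)) l.
Proof.
move=> dg; apply: is_derive_eps => r r0; have [d d0 D] := is_derive_epsP dg r0.
by exists d => // u ud; have := D u ud; rewrite [s + a + u]addrAC.
Qed.

Lemma derive_bound_lip (h h' : R -> R) C x y : (forall x : R, is_derive x (1 : R) h (h' x)) ->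
  (forall x, `|h' x| <= C) -> `|h x - h y| <= C * `|x - y|.
Proof.
move=> dh hC; wlog yx : x y / y <= x.
  by move=> W; have [|/ltW] := leP y x => H; [|rewrite distrC (distrC x)]; exact: W.
by have [z _ ->] := mvt dh yx; rewrite normrM; apply: ler_wpM2r.
Qed.

End calculus.

(** * Integrals, primitives and difference quotients *)
Section integration.
Context {R : realType}.
Local Notation mu := (@lebesgue_measure R).

Lemma bounded_integrable d (T : measurableType d)
    (P : probability T R) (f : T -> R) (C : R) :
  measurable_fun setT f -> (forall x, `|f x| <= C) ->
  P.-integrable setT (EFin \o f).
Proof.
move=> mf fC; apply: measurable_bounded_integrable => //.
  by rewrite [X in (X < _)%E](probability_setT P) ltry.
exists C; split; first exact: num_real.
by move=> M CM x _ /=; rewrite (le_trans (fC x))// ltW.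
Qed.

Lemma normr_Rintegral_le d (T : measurableType d)
    (P : probability T R) (f : T -> R) (C : R) :
  measurable_fun setT f -> (forall x, `|f x| <= C) ->
  `|\int[P]_x f x| <= C.
Proof.
move=> mf fC; have fi := bounded_integrable P mf fC.
apply: (le_trans (le_normr_Rintegral _ fi)) => //.
have -> : C = \int[P]_x (cst C x).
  by rewrite Rintegral_cst//= [X in fine X](probability_setT P) mulr1.
apply: le_Rintegral => //.
  by apply: (@bounded_integrable _ _ _ _ C) => //; [exact: measurableT_comp|
    move=> x; rewrite normr_id].
by apply: (@bounded_integrable _ _ _ _ `|C|).
Qed.

Lemma dominated_Rintegral d (T : measurableType d) (P : {measure set T -> \bar R})
    (D : set T) (f_ : nat -> T -> R) (f g : T -> R) :
  measurable D ->
  (forall n, measurable_fun D (f_ n)) -> measurable_fun D f ->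
  (forall x, D x -> f_ n x @[n --> \oo] --> f x) ->
  P.-integrable D (EFin \o g) -> (forall n x, D x -> `|f_ n x| <= g x) ->
  \int[P]_(x in D) f_ n x @[n --> \oo] --> \int[P]_(x in D) f x.
Proof.
move=> mD mf_ mf fcv ig fg.
have [] := @dominated_convergence _ _ _ P D mD (fun n => EFin \o f_ n)
  (EFin \o f) (EFin \o g) _ _ _ ig.
- by move=> n; exact/measurable_EFinP.
- exact/measurable_EFinP.
- by apply: aeW => x Dx; apply: cvg_EFin; [exact: nearW|exact: fcv].
- by apply: aeW => x n Dx; rewrite lee_fin; exact: fg.
move=> fi _ cv.
apply: fine_cvg; rewrite fineK; first exact: cv.
exact: integrable_fin_num.
Qed.

(** A density is a version of the Radon-Nikodym derivative. *)
Lemma integral_density (nu : probability (measurableTypeR R) R) (p : R -> R) (f : R -> R) :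
  (forall x, 0 <= p x) -> measurable_fun setT p ->
  mu.-integrable setT (EFin \o p) ->
  (forall A, measurable A -> nu A = (\int[mu]_(x in A) (p x)%:E)%E) ->
  nu.-integrable setT (EFin \o f) ->
  mu.-integrable setT (EFin \o (fun x => f x * p x)) /\
  \int[nu]_x f x = \int[mu]_x (f x * p x).
Proof.
move=> p0 mp ip nuE fi.
have dom : nu `<< mu.
  apply/null_content_dominatesP => A mA A0; rewrite nuE//.
  by apply: null_set_integral => //; exact/measurable_EFinP/measurable_funTS.
have RN : ae_eq mu setT (Radon_Nikodym (charge_of_finite_measure nu) mu) (EFin \o p).
  apply: integral_ae_eq => //.
  - exact: Radon_Nikodym_integrable.
  - exact/measurable_EFinP.
  - by move=> E _ mE; rewrite -Radon_Nikodym_integral//= nuE.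
have mf : measurable_fun setT f.
  by move/integrableP : fi => [/measurable_EFinP].
have gp (g : R -> R) : nu.-integrable setT (EFin \o g) ->
    (\int[mu]_x (g x * p x)%:E = \int[nu]_x (g x)%:E)%E.
  move=> gi; have mg : measurable_fun setT g.
    by move/integrableP : gi => [/measurable_EFinP].
  rewrite -(Radon_Nikodym_change_of_variables dom)//=.
  apply: ae_eq_integral => //.
  - by apply/measurable_EFinP; exact: measurable_funM.
  - apply: emeasurable_funM; first exact/measurable_EFinP.
    by apply: (measurable_int mu); exact: Radon_Nikodym_integrable.
  - by apply: filterS RN => x /= h _; rewrite h// EFinM.
split; last by rewrite /Rintegral gp.
apply/integrableP; split; first by apply/measurable_EFinP; exact: measurable_funM.
have := gp (fun x => `|f x|).
have -> : (\int[mu]_x `|(EFin \o (fun x => (f x * p x)%R)) x| =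
    \int[mu]_x (`|f x| * p x)%:E)%E.
  by apply: eq_integral => x _ /=; rewrite normrM (ger0_norm (p0 x)).
move=> ->; last by have /integrable_norm := fi.
by move/integrableP : fi => [_].
Qed.

(** The push-forward of Lebesgue measure under an affine map, rescaled, agrees with
    Lebesgue measure on half-open intervals, hence everywhere. *)
Lemma ge0_lebesgue_affine (a b : R) (f : R -> \bar R) : a != 0 ->
  measurable_fun setT f -> (forall x, 0 <= f x)%E ->
  (\int[mu]_x f x = `|a|%:E * \int[mu]_x f (a * x + b)%R)%E.
Proof.
move=> a0 mf f0.
pose phi (x : measurableTypeR R) : measurableTypeR R := a * x + b.
have mphi : measurable_fun setT phi.
  by apply: measurable_funD => //; exact: measurable_funM.
have := ge0_integral_pushforward mphi mu measurableT mf (fun x _ => f0 x).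
set nu := (X in (integral X _ _)%E = _ -> _).
rewrite preimage_setT => /= <-.
rewrite -(@ge0_integral_mscale _ _ _ nu setT measurableT (`|a|)%:nng f)//.
apply: eq_measure_integral => A mA _.
apply: lebesgue_measure_unique => // X [[c d] /= _ <-].
rewrite /mscale/= /pushforward lebesgue_measure_itv/=.
rewrite (_ : phi @^-1` _ = if 0 < a then `](c - b) / a, (d - b) / a]%classic
  else `[(d - b) / a, (c - b) / a[%classic); last first.
  apply/seteqP; split => x.
  - rewrite /phi /= in_itv/=; case: ifPn => [ap|ap]; rewrite /= in_itv/=.
      by rewrite ltr_pdivrMr// ler_pdivlMr// ltrBlDr lerBrDr mulrC.
    have an : a < 0 by rewrite lt_neqAle a0 leNgt.
    by rewrite ltr_ndivlMr// ler_ndivrMr// ltrBlDr lerBrDr mulrC andbC.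
  - rewrite /phi /= in_itv/=; case: ifPn => [ap|ap]; rewrite /= in_itv/=.
      by rewrite ltr_pdivrMr// ler_pdivlMr// ltrBlDr lerBrDr mulrC.
    have an : a < 0 by rewrite lt_neqAle a0 leNgt.
    by rewrite ltr_ndivlMr// ler_ndivrMr// ltrBlDr lerBrDr mulrC andbC.
have [ap|ap] := boolP (0 < a); rewrite [X in (_ * X)%E]lebesgue_measure_itv/= !lte_fin.
  rewrite gtr0_norm// ltr_pM2r ?invr_gt0// ltrD2r; case: ifPn => cd; last by rewrite mule0.
  by rewrite -!EFinB -EFinM; congr EFin; field.
have an : a < 0 by rewrite lt_neqAle a0 leNgt.
rewrite ltr0_norm// ltr_nM2r ?invr_lt0// ltrD2r; case: ifPn => cd; last by rewrite mule0.
by rewrite -!EFinB -EFinM; congr EFin; field.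
Qed.

Lemma lebesgue_affine (a b : R) (f : R -> R) : a != 0 ->
  mu.-integrable setT (EFin \o f) ->
  mu.-integrable setT (EFin \o (fun x => f (a * x + b))) /\
  \int[mu]_x f (a * x + b) = `|a|^-1 * \int[mu]_x f x.
Proof.
move=> a0 fi.
have mf : measurable_fun setT f by move/integrableP : fi => [/measurable_EFinP].
have mphi : measurable_fun setT (fun x : R => a * x + b).
  by apply: measurable_funD => //; exact: measurable_funM.
have na0 : `|a| != 0 by rewrite normr_eq0.
have E (g : R -> \bar R) : measurable_fun setT g -> (forall x, 0 <= g x)%E ->
    (\int[mu]_x g (a * x + b)%R = `|a|^-1%:E * \int[mu]_x g x)%E.
  move=> mg g0; rewrite (ge0_lebesgue_affine b a0 mg g0) muleA -EFinM mulVf//.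
  by rewrite mul1e.
split.
  apply/integrableP; split; first exact/measurable_EFinP/measurableT_comp.
  rewrite (E (fun x => `|(f x)%:E|%E))//; last by apply/measurable_EFinP; exact: measurableT_comp.
  by rewrite lte_mul_pinfty// ?lee_fin ?invr_ge0//; move/integrableP : fi => [].
rewrite /Rintegral integralE.
have := E ((EFin \o f)^\+)%E; rewrite /= => E1.
have -> : (fun x => ((f (a * x + b))%:E)) ^\+%E = fun x => (EFin \o f)^\+%E (a * x + b).
  exact: (funepos_comp (EFin \o f) (fun x => a * x + b)).
have -> : (fun x => ((f (a * x + b))%:E)) ^\-%E = fun x => (EFin \o f)^\-%E (a * x + b).
  exact: (funeneg_comp (EFin \o f) (fun x => a * x + b)).
have mfE : measurable_fun setT (EFin \o f) by exact/measurable_EFinP.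
rewrite !E//; [|exact: measurable_funeneg|exact: measurable_funepos].
have fp := integral_funepos_lt_pinfty measurableT fi; have fn := integral_funeneg_lt_pinfty measurableT fi.
rewrite -muleBr//; last first.
  by rewrite fin_num_adde_defr// ge0_fin_numE// integral_ge0.
by rewrite -integralE fineM//; exact: integrable_fin_num.
Qed.

Definition loc_bounded (h : R -> R) : Prop :=
  measurable_fun setT h /\ forall N : R, exists C : R, forall y : R, `|y| <= N -> `|h y| <= C.

(** The primitive vanishing at [0], as one integral over the line: the weight is [1]
    on (0, x] for [x >= 0] and [-1] on (x, 0] for [x < 0]. *)
Definition prim (h : R -> R) (x : R) : R :=
  \int[mu]_y (h y * ((y <= x)%R%:R - (y <= 0)%R%:R)).

Lemma loc_bounded_itv (h : R -> R) (a b : R) : loc_bounded h ->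
  mu.-integrable `[a, b] (EFin \o h).
Proof.
move=> [mh bh]; apply: measurable_bounded_integrable => //.
- by rewrite [X in (X < _)%E]lebesgue_measure_itv/=; case: ifP => _; rewrite -?EFinB ltry.
- exact: measurable_funTS.
have [C hC] := bh (`|a| + `|b|).
exists C; split; first exact: num_real.
move=> M CM x /=; rewrite in_itv/= => /andP[ax xb]; rewrite (le_trans _ (ltW CM))// hC//.
rewrite ler_norml; apply/andP; split.
  by have := ler_norm (- a); rewrite normrN; have := normr_ge0 b; lra.
by have := ler_norm b; have := normr_ge0 a; lra.
Qed.

Lemma prim_integrable h x : loc_bounded h ->
  mu.-integrable setT (EFin \o (fun y => h y * ((y <= x)%R%:R - (y <= 0)%R%:R))).
Proof.
move=> lh; have [mh _] := lh.
have mi (z : R) : measurable_fun setT (fun y : R => (y <= z)%R%:R : R).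
  rewrite (_ : (fun _ => _) = \1_`]-oo, z]); first exact: measurable_indic.
  by apply/funext => y; rewrite indicE mem_setE in_itv.
have := loc_bounded_itv (- `|x|) `|x| lh.
move=> /(integrable_mkcond _ _).1 ih.
apply: (le_integrable _ _ _ (ih _)) => //.
  apply/measurable_EFinP; apply: measurable_funM => //.
  by apply: measurable_funB; exact: mi.
move=> y _; rewrite /= patchE mem_setE in_itv/=; case: ifPn => [_|].
  rewrite lee_fin normrM ler_piMr//.
  by case: (y <= x); case: (y <= 0); rewrite /= ?subrr ?subr0 ?sub0r ?normrN ?normr0 ?normr1.
rewrite negb_and -!ltNge => /orP[h1|h1].
  have yx : (y <= x)%R by have := lerNnormlW (lexx `|x|); apply: le_trans; exact: ltW.
  have y0 : (y <= 0)%R by rewrite (le_trans (ltW h1))// oppr_le0.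
  by rewrite yx y0 subrr mulr0 normr0 lee_fin.
have yx : (y <= x)%R = false by apply/negbTE; rewrite -ltNge (le_lt_trans (ler_norm x)).
have y0 : (y <= 0)%R = false by apply/negbTE; rewrite -ltNge (le_lt_trans (normr_ge0 x)).
by rewrite yx y0 subrr mulr0 normr0 lee_fin.
Qed.

Lemma prim_sub h a b : loc_bounded h -> a <= b ->
  prim h b - prim h a = \int[mu]_(y in `[a, b]) h y.
Proof.
move=> lh ab; rewrite /prim -RintegralB//; [|exact: prim_integrable..].
rewrite -Rintegral_itv_obnd_cbnd; last first.
  apply: integrableS (loc_bounded_itv a b lh) => //.
  by apply: subset_itvr; rewrite bnd_simp.
rewrite [RHS]Rintegral_mkcond; apply: eq_Rintegral => y _.
rewrite patchE mem_setE in_itv/=.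
rewrite -mulrBr opprB addrA subrK ltNge.
have [ya|ay] /= := leP y a; have [yb|yb] /= := leP y b; rewrite ?subrr ?subr0 ?mulr0 ?mulr1//.
by have := lt_le_trans yb (le_trans ya ab); rewrite ltxx.
Qed.

Lemma prim_near h (a b c e : R) : loc_bounded h -> a <= b ->
  (forall y : R, a <= y <= b -> `|h y - c| <= e) ->
  `|prim h b - prim h a - c * (b - a)| <= e * (b - a).
Proof.
move=> lh ab he; rewrite prim_sub//.
have mab : fine (mu `[a, b]) = b - a.
  rewrite [X in fine X]lebesgue_measure_itv/= lte_fin; case: ltgtP ab => // -> _.
  by rewrite subrr.
have ic d : mu.-integrable `[a, b] (EFin \o cst d).
  by apply: loc_bounded_itv; split => // N; exists `|d|.
have -> : c * (b - a) = \int[mu]_(y in `[a, b]) c by rewrite Rintegral_cst// mab.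
have -> : e * (b - a) = \int[mu]_(y in `[a, b]) e by rewrite Rintegral_cst// mab.
have ih := loc_bounded_itv a b lh.
have ihc : mu.-integrable `[a, b] (EFin \o (fun y => h y - c)).
  by have := integrableB _ ih (ic c); exact.
rewrite -RintegralB//; last exact: ic.
apply: (le_trans (le_normr_Rintegral _ _)) => //.
apply: le_Rintegral => //; [exact: integrable_norm|exact: ic].
Qed.

Lemma prim_is_derive h (x : R) : loc_bounded h -> {for x, continuous h} ->
  is_derive x 1 (prim h) (h x).
Proof.
move=> lh ch; apply: is_derive_eps => e e0.
move/cvgrPdist_le : ch => /(_ e e0) /nbhs_ballP[d /= d0 Hd].
exists d => // k kd.
have Hy y : `|y - x| <= `|k| -> `|h y - h x| <= e.
  by move=> yk; rewrite distrC; apply: Hd; rewrite /ball/= distrC (le_lt_trans yk).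
have [k0|k0] := leP 0 k.
  have := @prim_near h x (x + k) (h x) e lh.
  rewrite [x + k - x]addrC addKr [`|k|]ger0_norm//; apply; first by rewrite lerDl.
  move=> y /andP[xy yk]; apply: Hy; rewrite ger0_norm ?subr_ge0// lerBlDl.
  by rewrite (le_trans yk)// lerD2l ler_norm.
have := @prim_near h (x + k) x (h x) e lh.
rewrite (_ : x - (x + k) = - k) ?opprD ?addrA ?subrr ?add0r// [`|k|]ltr0_norm//.
rewrite [X in _ -> `|X| <= _](_ : _ = - (prim h x - prim h (x + k) - h x * - k)); last by ring.
rewrite normrN; apply; first by rewrite gerDl ltW.
move=> y /andP[xy yk]; apply: Hy; rewrite ler0_norm ?subr_le0// ltr0_norm//.
by rewrite lerNr opprK lerBrDl.
Qed.

Lemma prim_lipschitz h (a b C : R) : loc_bounded h ->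
  (forall y : R, `|y| <= Num.max `|a| `|b| -> `|h y| <= C) ->
  `|prim h b - prim h a| <= C * `|b - a|.
Proof.
move=> lh; wlog ab : a b / a <= b.
  move=> W; have [ab|/ltW ba] := leP a b; first exact: W.
  by move=> H; rewrite distrC (distrC b); apply: W => //; rewrite maxC.
move=> H; have := @prim_near h a b 0 C lh ab; rewrite mul0r subr0 (@ger0_norm _ (b - a)) ?subr_ge0//; apply.
move=> y /andP[ay yb]; rewrite subr0 H// le_max.
have [y0|y0] := leP 0 y.
  by rewrite [`|y|]ger0_norm// [`|b|]ger0_norm ?yb ?orbT// (le_trans y0).
rewrite [`|y|]ltr0_norm// [`|a|]ltr0_norm ?(le_lt_trans ay)//.
by rewrite lerN2 ay.
Qed.

Lemma prim_cont h : loc_bounded h -> continuous (prim h).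
Proof.
move=> lh x; have [C hC] := lh.2 (`|x| + 1).
have C0 : 0 <= C by apply: le_trans (hC 0 _) => //; rewrite normr0 addr_ge0.
have C1 : 0 < C + 1 by rewrite ltr_wpDl.
apply/cvgrPdist_le => e e0; near=> y.
have xy1 : `|x - y| <= 1 by near: y; apply: cvgr_dist_le => //; exact: cvg_id.
apply: (@le_trans _ _ (C * `|x - y|)).
  apply: prim_lipschitz => // z zm; apply: hC.
  move: zm; rewrite le_max => /orP[|] zm; apply: le_trans zm _.
    rewrite -(subrK x y) (le_trans (ler_normD _ _))// addrC lerD2l distrC//.
  by rewrite lerDl.
rewrite (@le_trans _ _ ((C + 1) * `|x - y|))// ?ler_wpM2r// ?lerDl//.
rewrite -ler_pdivlMl//; near: y; apply: cvgr_dist_le; first exact: cvg_id.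
by rewrite mulr_gt0// invr_gt0.
Unshelve. all: by end_near. Qed.

Lemma cont_loc_bounded (h : R -> R) : continuous h -> loc_bounded h.
Proof.
move=> ch; split; first exact: continuous_measurable_fun.
move=> N; have [N0|N0] := leP 0 N; last first.
  by exists 0 => y /(le_trans (normr_ge0 y)); rewrite leNgt N0.
have cn : {within `[- N, N], continuous (fun y => `|h y|)}.
  apply: continuous_subspaceT => y; apply: continuous_comp; first exact: ch.
  exact: norm_continuous.
have [c _ hc] := EVT_max (ge0_cp N0).2 cn.
exists `|h c| => y yN; apply: hc; rewrite in_itv/=.
by rewrite -ler_norml.
Qed.

Lemma prim0 h : prim h 0 = 0.
Proof.
rewrite /prim [LHS](_ : _ = \int[mu]_y (cst 0 y)); last first.
  by apply: eq_Rintegral => y _; rewrite subrr mulr0.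
by rewrite Rintegral_cst// mul0r.
Qed.

Lemma prim_ae h : loc_bounded h ->
  {ae mu, forall x, derivable (prim h) x 1 /\ (prim h)^`()%classic x = h x}.
Proof.
move=> lh.
have loc : locally_integrable [set: R] h.
  split; [exact: lh.1|exact: openT|move=> K _ cK].
  have [N [_ KN]] := compact_bounded cK.
  have KI : K `<=` `[- (N + 1), N + 1].
    by move=> y Ky; rewrite /= in_itv/= -ler_norml; apply: KN Ky; rewrite ltrDl.
  have /integrableP[mhI] := loc_bounded_itv (- (N + 1)) (N + 1) lh.
  apply: le_lt_trans; apply: ge0_subset_integral => //.
  - exact: compact_measurable.
  - by apply/measurable_EFinP/measurable_funTS; apply: measurableT_comp => //; exact: lh.1.
have A (n : nat) : {ae mu, forall x : R, - n%:R < x -> derivable (prim h) x 1 /\ (prim h)^`()%classic x = h x}.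
  have := @FTC1 R h (BLeft (- n%:R)) (fun y => loc_bounded_itv _ _ lh) loc.
  apply: filterS; first exact: (ae_filter_ringOfSetsType mu).
  move=> x /= Hx nx; have [] := Hx; first by rewrite lte_fin.
  set F := (fun _ => _) => dF F'.
  have E : \forall y \near x, F y = prim h y - prim h (- n%:R).
    near=> y; rewrite /F prim_sub//; apply: ltW; near: y; exact: lt_nbhsr.
  have E2 : \forall y \near x, prim h y = F y + prim h (- n%:R).
    by apply: filterS E => y ->; rewrite subrK.
  have D : is_derive x 1 F (h x).
    by split; [exact: dF|rewrite -derive1E; exact: F'].
  have : is_derive x 1 (fun y => F y + prim h (- n%:R)) (h x + 0) by exact: is_deriveD.
  rewrite addr0 => D2.
  have D3 : is_derive x 1 (prim h) (h x).
    by apply: near_eq_is_derive D2 => //; apply: filterS E2.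
  by split; [exact: ex_derive|rewrite derive1E; exact: derive_val].
have : {ae mu, forall x (n : nat), - n%:R < x -> derivable (prim h) x 1 /\ (prim h)^`()%classic x = h x}.
  exact/ae_foralln.
apply: filterS; first exact: (ae_filter_ringOfSetsType mu).
move=> x H; apply: (H (Num.truncn `|x|).+1).
by rewrite ltrNl (le_lt_trans (ler_norm _))// normrN truncnS_gt.
Unshelve. all: by end_near.
Qed.

Lemma prim_shift h (x e : R) : loc_bounded h -> 0 <= e ->
  prim h (x + e) - prim h x = \int[mu]_(v in `[0, e]) h (x + v).
Proof.
move=> lh e0; rewrite prim_sub ?lerDl//.
rewrite Rintegral_mkcond [RHS]Rintegral_mkcond.
have /integrable_mkcond := loc_bounded_itv x (x + e) lh.
rewrite restrict_EFin => /(_ (measurable_itv _)) ih.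
have [_] := @lebesgue_affine 1 x (h \_ `[x, x + e]) (oner_neq0 _) ih.
rewrite normr1 invr1 mul1r => <-.
apply: eq_Rintegral => y _; rewrite !patchE !mem_setE !in_itv/= mul1r addrC.
by rewrite lerDl lerD2l.
Qed.

Lemma loc_bounded_shift h (a x : R) : loc_bounded h -> loc_bounded (fun y => h (a * y + x)).
Proof.
move=> [mh bh]; split.
  by apply: measurableT_comp => //; apply: measurable_funD => //; exact: measurable_funM.
move=> N; have [C hC] := bh (`|a| * N + `|x|); exists C => y yN; apply: hC.
by rewrite (le_trans (ler_normD _ _))// lerD2r normrM ler_wpM2l.
Qed.

(** A locally bounded midpoint-affine function is affine: averaging the functional
    equation over a unit interval expresses [w] through its primitive, which gives
    continuity, then differentiability with constant derivative. *)
Lemma jensen_affine (w : R -> R) : loc_bounded w ->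
  (forall x e : R, 0 < e -> w (x + e) + w (x - e) = 2 * w x) ->
  exists A B, forall x, w x = A * x + B.
Proof.
move=> lw J.
have J2 x y : w x + w y = 2 * w ((x + y) / 2).
  wlog xy : x y / y <= x.
    by move=> W; have [|/ltW] := leP y x => /W //; rewrite addrC [x + y]addrC.
  move: xy; rewrite le_eqVlt => /orP[/eqP->|xy].
    by rewrite (_ : (x + x) / 2 = x) ?mulr_natl ?mulr2n//; field.
  have := J ((x + y) / 2) ((x - y) / 2); rewrite divr_gt0 ?subr_gt0// => /(_ isT) <-.
  by congr (w _ + w _); field.
have add x v : w (x + v) = w x + (w v - w 0).
  have := J2 (x + v) 0; rewrite addr0 -J2; lra.
have E x : w x = prim w (x + 1) - prim w x - \int[mu]_(v in `[0, 1]) (w v - w 0).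
  have lc (c : R) : mu.-integrable `[0, 1] (EFin \o cst c).
    by apply: loc_bounded_itv; split => // N; exists `|c|.
  have i1 : mu.-integrable `[0, 1] (EFin \o (fun v => w v - w 0)).
    by have := integrableB _ (loc_bounded_itv 0 1 lw) (lc (w 0)); exact.
  rewrite prim_shift//.
  have -> : \int[mu]_(v in `[0, 1]) w (x + v) = \int[mu]_(v in `[0, 1]) (w x + (w v - w 0)).
    by apply: eq_Rintegral => v _; exact: add.
  rewrite RintegralD//; last exact: lc.
  rewrite Rintegral_cst// [X in fine X]lebesgue_measure_itv/= lte01 oppr0 adde0 mulr1.
  by rewrite addrK.
have cw : continuous w.
  move=> x; rewrite (_ : w = fun x => prim w (x + 1) - prim w x - \int[mu]_(v in `[0, 1]) (w v - w 0)); last exact/funext.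
  apply: cvgB; last exact: cvg_cst.
  apply: cvgB; last exact: prim_cont.
  by apply: continuous_translate; exact: prim_cont.
have dw x : is_derive x (1 : R) w (w 1 - w 0).
  have d1 : is_derive x (1 : R) (fun x => prim w (x + 1)) (w (x + 1)).
    by apply: translate_derive; apply: prim_is_derive => //; exact: cw.
  have d2 := prim_is_derive lw (@cw x).
  have := is_deriveB (is_deriveB d1 d2) (is_derive_cst (\int[mu]_(v in `[0, 1]) (w v - w 0)) x 1).
  rewrite (_ : _ - _ - cst _ = w); last by apply/esym/funext => y; rewrite [LHS]E.
  by rewrite (_ : w (x + 1) - w x - 0 = w 1 - w 0)//; rewrite add; ring.
exists (w 1 - w 0), (w 0) => x.
have [x0|x0|->] := ltgtP x 0; last by rewrite mulr0 add0r.
- have [c _] := MVT x0 (fun y _ => dw y) (continuous_subspaceT cw).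
  by move=> H; lra.
- have [c _] := MVT x0 (fun y _ => dw y) (continuous_subspaceT cw).
  by rewrite subr0 => /eqP; rewrite subr_eq => /eqP ->.
Qed.

Definition dq (U : R -> R) (d t : R) := (U (t + d) - U t) / d.

(** A long difference quotient is an average of short ones. *)
Lemma dq_iter (U : R -> R) (d e dd t : R) (n : nat) : 0 < dd -> 0 <= e ->
  (forall s : R, t <= s <= t + d -> `|dq U dd s - dq U dd t| <= e) ->
  n%:R * dd <= d ->
  `|U (t + n%:R * dd) - U t - n%:R * dd * dq U dd t| <= n%:R * dd * e.
Proof.
move=> dd0 e0 H; elim: n => [_|n IH nd].
  by rewrite !mul0r addr0 subrr subr0 normr0.
have nd' : n%:R * dd <= d by rewrite (le_trans _ nd)// -natr1 mulrDl lerDl mul1r ltW.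
have := IH nd'; have /H : t <= t + n%:R * dd <= t + d.
  by rewrite lerDl (mulr_ge0 _ (ltW dd0))//= lerD2l.
set s := t + n%:R * dd => H1 H2.
have Es : U (t + n.+1%:R * dd) - U s = dd * dq U dd s.
  rewrite [RHS]mulrC /dq divfK ?gt_eqF//; congr (U _ - _).
  by rewrite /s -[n.+1%:R]natr1 mulrDl mul1r addrA.
have -> : U (t + n.+1%:R * dd) - U t - n.+1%:R * dd * dq U dd t =
   (U s - U t - n%:R * dd * dq U dd t) + dd * (dq U dd s - dq U dd t).
  rewrite mulrBr -Es -[n.+1%:R]natr1; ring.
rewrite (le_trans (ler_normD _ _))// -[n.+1%:R]natr1 !mulrDl mul1r lerD//.
by rewrite normrM gtr0_norm// ler_wpM2l// ltW.
Qed.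

Lemma dq_cauchy1 (U : R -> R) (L d e t dd : R) : 0 <= L ->
  (forall s s' : R, `|U s - U s'| <= L * `|s - s'|) ->
  0 < d -> 0 < dd -> dd <= d ->
  (forall s : R, t <= s <= t + d -> `|dq U dd s - dq U dd t| <= e) ->
  `|dq U d t - dq U dd t| <= e + 2 * L * (dd / d).
Proof.
move=> L0 lU d0 dd0 ddd H.
have e0 : 0 <= e.
  by apply: le_trans (H t _); rewrite ?subrr ?normr0 ?lexx ?lerDl//= ltW.
pose n := Num.truncn (d / dd).
have dd_ge0 : 0 <= d / dd by rewrite divr_ge0// ltW.
have /andP[] := truncn_itv dd_ge0; rewrite -/n ler_pdivlMr// ltr_pdivrMr// -natr1 mulrDl mul1r => n1 n2.
have I := dq_iter dd0 e0 H n1.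
have I2 := lU (t + d) (t + n%:R * dd).
have I3 : `|dq U dd t| <= L.
  rewrite normrM normfV (gtr0_norm dd0) ler_pdivrMr// (le_trans (lU _ _))//.
  by rewrite addrAC subrr add0r gtr0_norm.
have dE : U (t + d) - U t = d * dq U d t by rewrite [RHS]mulrC /dq divfK ?gt_eqF.
have I2' : `|t + d - (t + n%:R * dd)| <= dd.
  rewrite (_ : _ - _ = d - n%:R * dd); last by ring.
  by rewrite ger0_norm ?subr_ge0// lerBlDl ltW.
have I3' : `|(d - n%:R * dd) * dq U dd t| <= dd * L.
  rewrite normrM ler_pM// ger0_norm ?subr_ge0// lerBlDl ltW//.
have E : d * (dq U d t - dq U dd t) = (U (t + d) - U (t + n%:R * dd)) +
    (U (t + n%:R * dd) - U t - n%:R * dd * dq U dd t) - (d - n%:R * dd) * dq U dd t.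
  by rewrite mulrBr -dE; ring.
rewrite -(ler_pM2l d0) -{1}(gtr0_norm d0) -normrM E.
have -> : d * (e + 2 * L * (dd / d)) = L * dd + d * e + dd * L by field; exact: lt0r_neq0.
rewrite (le_trans (ler_normB _ _))// lerD// (le_trans (ler_normD _ _))// lerD//.
  by rewrite (le_trans I2)// ler_wpM2l.
by rewrite (le_trans I)// ler_wpM2r.
Qed.

(** Equicontinuity in [t] of the difference quotients, uniformly in the step, forces
    them to converge: two steps are compared with a common much smaller one. *)
Lemma dq_cauchy (U : R -> R) (L d e t : R) : 0 <= L ->
  (forall s s' : R, `|U s - U s'| <= L * `|s - s'|) ->
  (forall dd s : R, 0 < dd -> t <= s <= t + d -> `|dq U dd s - dq U dd t| <= e) ->
  forall d1 d2 : R, 0 < d1 <= d -> 0 < d2 <= d -> `|dq U d1 t - dq U d2 t| <= 2 * e.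
Proof.
move=> L0 lU H d1 d2 /andP[d10 d1d] /andP[d20 d2d].
apply/ler_addgt0Pl => eta eta0.
pose dd := Num.min (Num.min d1 d2) (eta * Num.min d1 d2 / (4 * L + 1)).
have m0 : 0 < Num.min d1 d2 by rewrite lt_min d10.
have L1 : 0 < 4 * L + 1 by rewrite ltr_wpDl// mulr_ge0.
have dd0 : 0 < dd by rewrite lt_min m0/= divr_gt0// mulr_gt0.
have K di : 0 < di -> di <= d -> Num.min d1 d2 <= di -> `|dq U di t - dq U dd t| <= e + eta / 2.
  move=> di0 did mdi; have ddi : dd <= di by rewrite ge_min mdi.
  apply: le_trans (dq_cauchy1 L0 lU di0 dd0 ddi _) _.
    by move=> s /andP[ts sd]; apply: H => //; rewrite ts/= (le_trans sd)// lerD2l.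
  rewrite lerD2l.
  have : dd / di <= eta / (4 * L + 1).
    rewrite ler_pdivrMr// (@le_trans _ _ (eta * Num.min d1 d2 / (4 * L + 1)))//.
      by rewrite ge_min lexx orbT.
    by rewrite mulrAC ler_pM2l// divr_gt0.
  have L2 : 0 <= 2 * L by rewrite mulr_ge0.
  move=> /(ler_wpM2l L2) /le_trans; apply.
  rewrite mulrA ler_pdivrMr//; nra.
have := K _ d10 d1d; have := K _ d20 d2d; rewrite !ge_min !lexx/= orbT => /(_ isT) A /(_ isT) B.
have -> : dq U d1 t - dq U d2 t = (dq U d1 t - dq U dd t) - (dq U d2 t - dq U dd t) by ring.
rewrite (le_trans (ler_normB _ _))//; lra.
Qed.

(** The chain rule along a path [s |-> (s, b s)] asks only for continuity of the
    partial derivative in [s]; in the other variable differentiability suffices. *)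
Lemma is_derive_path (W Ws Wy : R -> R -> R) (b : R -> R) (s b' : R) :
  (forall s y : R, is_derive s (1 : R) (W^~ y) (Ws s y)) ->
  is_derive (b s) (1 : R) (W s) (Wy s (b s)) ->
  continuous (fun p : R * R => Ws p.1 p.2) ->
  is_derive s (1 : R) b b' ->
  is_derive s (1 : R) (fun s => W s (b s)) (Ws s (b s) + Wy s (b s) * b').
Proof.
move=> dWs dWy cWs db.
have d2 : is_derive s (1 : R) (fun v => W s (b v)) (Wy s (b s) * b').
  by have := is_derive1_comp; apply.
apply: is_derive_eps => e e0.
have e20 : 0 < e / 2 by rewrite divr_gt0.
have [d1 d10 H1] := is_derive_epsP d2 e20.
have cb : {for s, continuous b}.
  by apply: differentiable_continuous; apply/derivable1_diffP; exact: ex_derive.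
have /cvgrPdist_le /(_ _ e20) := cWs (s, b s).
move=> [/= [A B] [/= /nbhs_ballP[da /= da0 HA] /nbhs_ballP[db0 /= db00 HB]] HAB].
move/cvgrPdist_lt : cb => /(_ _ db00) /nbhs_ballP[dc /= dc0 HC].
exists (Num.min d1 (Num.min da dc)); first by rewrite !lt_min d10 da0 dc0.
move=> h; rewrite !lt_min => /and3P[h1 ha hc].
have sh : ball s dc (s + h) by rewrite /ball/= opprD addrA subrr add0r normrN.
have [xi xih E] : exists2 xi, `|xi - s| <= `|h| &
   W (s + h) (b (s + h)) - W s (b (s + h)) = Ws xi (b (s + h)) * h.
  have cW y : continuous (W^~ y).
    by move=> x; apply: differentiable_continuous; apply/derivable1_diffP; exact: ex_derive.
  have [h0|h0] := leP 0 h.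
    have sh0 : s <= s + h by rewrite lerDl.
    have [c] := MVT_segment sh0 (fun y _ => dWs y (b (s + h))) (continuous_subspaceT (cW _)).
    rewrite in_itv/= => /andP[sc ch] E; exists c.
      by rewrite !ger0_norm ?subr_ge0// lerBlDl.
    by rewrite E addrAC subrr add0r.
  have sh0 : s + h <= s by rewrite gerDl ltW.
  have [c] := MVT_segment sh0 (fun y _ => dWs y (b (s + h))) (continuous_subspaceT (cW _)).
  rewrite in_itv/= => /andP[sc ch] E; exists c.
    by rewrite (ltr0_norm h0) ler0_norm ?subr_le0// opprB lerBlDl -lerBlDr opprK.
  by rewrite -opprB E opprD addrA subrr add0r mulrN opprK.
have K : `|Ws s (b s) - Ws xi (b (s + h))| <= e / 2.
  apply: (HAB (xi, b (s + h))); split => /=.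
    by apply: HA; rewrite /ball/= distrC (le_lt_trans xih).
  by apply: HB; exact: HC.
have := H1 _ h1.
have -> : W (s + h) (b (s + h)) - W s (b s) - (Ws s (b s) + Wy s (b s) * b') * h =
  (W s (b (s + h)) - W s (b s) - Wy s (b s) * b' * h) - (Ws s (b s) - Ws xi (b (s + h))) * h.
  by rewrite mulrBl -E; ring.
move=> K2; have -> : e * `|h| = e / 2 * `|h| + e / 2 * `|h| by field.
rewrite (le_trans (ler_normB _ _))// lerD//.
by rewrite normrM ler_wpM2r.
Qed.

Lemma prim_ftc (g g' : R -> R) (a b : R) : (forall x : R, is_derive x (1 : R) g (g' x)) ->
  continuous g' -> a <= b -> prim g' b - prim g' a = g b - g a.
Proof.
move=> dg cg' ab; have lg' := cont_loc_bounded cg'.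
have dd (x : R) : is_derive x (1 : R) (fun x => prim g' x - g x) 0.
  have d1 : is_derive x (1 : R) (prim g') (g' x) by apply: prim_is_derive => //; exact: cg'.
  by apply: is_derive_eq (is_deriveB d1 (dg x)) _; rewrite subrr.
have [z _] := mvt dd ab; rewrite mul0r; lra.
Qed.

End integration.

(** * The Gaussian law and integration by parts *)

Section gauss.
Context {R : realType}.
Local Notation mu := (@lebesgue_measure R).
Local Notation mR := (measurableTypeR R).
Implicit Types (r s x y z C : R).

Definition gam : probability mR R := normal_prob (0 : R) 1.
Definition nphi : R -> R := normal_pdf 0 1.

Lemma nphiE x : nphi x = normal_peak 1 * expR (- (x ^+ 2) / 2).
Proof. by rewrite /nphi normal_pdfE ?oner_neq0// /normal_fun subr0 expr1n. Qed.

Lemma nphi_ge0 x : 0 <= nphi x. Proof. exact: normal_pdf_ge0. Qed.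

Lemma nphi_meas : measurable_fun setT nphi. Proof. exact: measurable_normal_pdf. Qed.

Lemma nphi_int : mu.-integrable setT (EFin \o nphi).
Proof. exact: integrable_normal_pdf. Qed.

Lemma nphi_int1 : \int[mu]_x nphi x = 1.
Proof. by rewrite /Rintegral integral_normal_pdf. Qed.

Lemma gam_density (f : R -> R) : gam.-integrable setT (EFin \o f) ->
  mu.-integrable setT (EFin \o (fun x => f x * nphi x)) /\
  \int[gam]_x f x = \int[mu]_x (f x * nphi x).
Proof.
move=> fi; apply: integral_density => //; [exact: nphi_ge0|exact: nphi_meas|exact: nphi_int].
Qed.

Lemma nphi_scale r x (k : R -> R) C : 0 < r -> measurable_fun setT k ->
  (forall y, `|k y| <= C) ->
  r ^+ 2 / 2 * \int[gam]_z k (x - r * z) =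
  \int[mu]_y (k (x - y) * (r / 2 * nphi (y / r))).
Proof.
move=> r0 mk kC.
have mk' : measurable_fun setT (fun z => k (x - r * z)).
  by apply: measurableT_comp => //; apply: measurable_funB => //; exact: measurable_funM.
have [i1 ->] := gam_density (bounded_integrable gam mk' (fun z => kC _)).
have [] := @lebesgue_affine _ r^-1 0 (fun z => k (x - r * z) * nphi z) _ i1.
  by rewrite invr_neq0// gt_eqF.
move=> i2; rewrite normfV invrK gtr0_norm// => E.
have -> : r ^+ 2 / 2 * \int[mu]_x0 (k (x - r * x0) * nphi x0) =
  r / 2 * (r * \int[mu]_x0 (k (x - r * x0) * nphi x0)) by ring.
rewrite -E -(@RintegralZl _ _ _ mu setT _ (r / 2) measurableT i2).
apply: eq_Rintegral => y _.
rewrite addr0 mulVKf ?gt_eqF// [y / r]mulrC; ring.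
Qed.

(** Up to a constant, [r^2 / 2] times the Gaussian density of standard deviation [r]
    is [r * exp (- (y / r)^2 / 2)], which increases with [r]. *)
Lemma nphi_scale_mono r r' y : 0 < r -> r <= r' ->
  r / 2 * nphi (y / r) <= r' / 2 * nphi (y / r').
Proof.
move=> r0 rr'; have r'0 := lt_le_trans r0 rr'.
apply: ler_pM; rewrite ?nphi_ge0 ?ler_pM2r//; first by rewrite divr_ge0// ltW.
rewrite !nphiE ler_wpM2l ?normal_peak_ge0// ler_expR ler_pM2r// lerN2.
rewrite !exprMn ler_wpM2l ?sqr_ge0// !exprVn lef_pV2 ?posrE ?exprn_gt0//.
by rewrite ler_pXn2r// nnegrE ltW.
Qed.

Lemma nphi_scale_int r : 0 < r ->
  mu.-integrable setT (EFin \o (fun y => r / 2 * nphi (y / r))) /\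
  \int[mu]_y (r / 2 * nphi (y / r)) = r ^+ 2 / 2.
Proof.
move=> r0; have [] := @lebesgue_affine _ r^-1 0 nphi _ nphi_int.
  by rewrite invr_neq0// gt_eqF.
rewrite normfV invrK gtr0_norm// nphi_int1 mulr1 => i1 E.
have i2 : mu.-integrable setT (EFin \o (fun y => nphi (y / r))).
  by apply: eq_integrable i1 => // y _; rewrite /= addr0 mulrC.
split; first by have := integrableZl measurableT (r / 2) i2; exact.
rewrite RintegralZl// (_ : \int[mu]_x nphi (x / r) = r); first by ring.
by rewrite -[RHS]E; apply: eq_Rintegral => y _; rewrite addr0 mulrC.
Qed.

(** With [s = r^2 / 2] this is the estimate [|s' P_s' k - s P_s k| <= C (s' - s)] for
    the heat semigroup and merely bounded [k]. The kernels [s p_s] are ordered, so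
    the integral of the absolute difference is the difference of the integrals. *)
Lemma heat_time_lipschitz r r' x (k : R -> R) C : 0 <= r -> r <= r' ->
  measurable_fun setT k -> (forall y, `|k y| <= C) ->
  `|r' ^+ 2 / 2 * \int[gam]_z k (x - r' * z) - r ^+ 2 / 2 * \int[gam]_z k (x - r * z)|
  <= C * (r' ^+ 2 / 2 - r ^+ 2 / 2).
Proof.
move=> r0 rr' mk kC.
have C0 : 0 <= C by apply: le_trans (kC 0).
move: r0; rewrite le_eqVlt => /orP[/eqP r0|r0].
  rewrite -r0 expr0n/= !mul0r !subr0 normrM ger0_norm ?divr_ge0 ?sqr_ge0// mulrC.
  rewrite ler_wpM2r ?divr_ge0 ?sqr_ge0//; apply: normr_Rintegral_le => //.
  by apply: measurableT_comp => //; apply: measurable_funB => //; exact: measurable_funM.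
have r'0 := lt_le_trans r0 rr'.
rewrite (nphi_scale x r'0 mk kC) (nphi_scale x r0 mk kC).
have [i1 e1] := nphi_scale_int r0; have [i2 e2] := nphi_scale_int r'0.
have ki s : 0 < s -> mu.-integrable setT (EFin \o (fun y => k (x - y) * (s / 2 * nphi (y / s)))).
  move=> s0; have [i _] := nphi_scale_int s0.
  have iC : mu.-integrable setT (EFin \o (fun y => C * (s / 2 * nphi (y / s)))).
    by have := integrableZl measurableT C i; exact.
  apply: (le_integrable _ _ _ iC) => //.
    apply/measurable_EFinP; apply: measurable_funM.
      by apply: measurableT_comp => //; exact: measurable_funB.
    by move/integrableP : i => [/measurable_EFinP].
  move=> y _; rewrite /= lee_fin [X in X <= _]normrM [X in _ <= X]normrM ler_wpM2r//.
  by rewrite (le_trans (kC _))// ler_norm.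
rewrite -e1 -e2 -!RintegralB//; [|exact: ki..].
rewrite -RintegralZl//; last by have := integrableB measurableT i2 i1; exact.
have ib := integrableB measurableT (ki _ r'0) (ki _ r0).
apply: (le_trans (le_normr_Rintegral _ _)) => //.
apply: le_Rintegral => //.
- exact: integrable_norm.
- by have := integrableZl measurableT C (integrableB measurableT i2 i1); exact.
move=> y _; rewrite -mulrBr normrM ler_pM// ger0_norm// subr_ge0.
exact: nphi_scale_mono.
Qed.

Lemma is_derive_nphi x : is_derive x (1 : R) nphi (- x * nphi x).
Proof.
have E : nphi = fun x => normal_peak 1 * expR (- (x ^+ 2) / 2).
  by apply/funext => y; exact: nphiE.
by rewrite E; apply: is_derive_eq; rewrite /GRing.scale/=; field.
Qed.

Lemma nphi_cont : continuous nphi.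
Proof. by apply: continuous_normal_pdf; rewrite oner_neq0. Qed.

Lemma nphi_cvg0 : nphi x @[x --> +oo] --> (0 : R).
Proof.
have E : nphi = fun x => normal_peak 1 * expR (- (x ^+ 2) / 2).
  by apply/funext => y; exact: nphiE.
apply: (@squeeze_cvgr _ _ _ _ (cst 0) (fun x => normal_peak 1 * expR (- x))); last 2 first.
- exact: cvg_cst.
- rewrite -(mulr0 (normal_peak 1)); apply: cvgM; first exact: cvg_cst.
  exact: cvgr_expR.
near=> x; rewrite nphi_ge0/= nphiE ler_wpM2l ?normal_peak_ge0// ler_expR.
have x2 : 2 <= x by near: x; exact: nbhs_pinfty_ge.
by nra.
Unshelve. all: by end_near. Qed.

Lemma nphi_tail v : 0 <= v ->
  (\int[mu]_(z in `[v, +oo[) (z * nphi z)%:E = (nphi v)%:E)%E.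
Proof.
move=> v0; rewrite (@ge0_continuous_FTC2y _ _ (fun z => - nphi z) _ 0).
- by rewrite sub0e EFinN oppeK.
- by move=> x vx; rewrite mulr_ge0 ?nphi_ge0// (le_trans v0).
- apply: continuous_subspaceT => x; apply: cvgM; [exact: cvg_id|exact: nphi_cont].
- by rewrite -oppr0; apply: cvgN; exact: nphi_cvg0.
- by move=> x _; apply: ex_derive; apply: is_deriveN; exact: is_derive_nphi.
- by apply: cvg_at_right_filter; apply: cvgN; exact: nphi_cont.
- move=> x _; rewrite derive1E.
  have := is_deriveN (is_derive_nphi x) => H; rewrite (@derive_val _ _ _ _ _ _ _ H).
  by rewrite mulNr opprK.
Qed.

(** The kernel of [prim]: [prim p z] integrates [p] against [signed_step z]. *)
Definition signed_step (z v : R) : R := (v <= z)%R%:R - (v <= 0)%R%:R.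

Lemma signed_step_meas : measurable_fun setT (fun p : mR * mR => signed_step p.1 p.2).
Proof.
have E (b : bool) : b%:R = (if b then 1 else 0) :> R by case: b.
apply: measurable_funB.
  under eq_fun do rewrite E; apply: measurable_fun_ifT => //.
  by apply: measurable_fun_ler; [exact: measurable_snd|exact: measurable_fst].
under eq_fun do rewrite E; apply: measurable_fun_ifT => //.
by apply: measurable_fun_ler; [exact: measurable_snd|exact: measurable_cst].
Qed.

Lemma signed_step_ge0 z v : 0 <= z * signed_step z v.
Proof.
rewrite /signed_step; have [vz|zv] := leP v z; have [v0|v0] := leP v 0; rewrite /= ?subrr ?mulr0// ?subr0 ?mulr1.
  by rewrite (le_trans (ltW v0)).
by rewrite sub0r mulrN1 oppr_ge0 (le_trans (ltW zv)).
Qed.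

Lemma signed_step_meas2 v : measurable_fun setT (fun z : mR => signed_step z v).
Proof. exact: (measurableT_comp signed_step_meas (measurable_pair2 v)). Qed.

Lemma signed_step_nphi v : (\int[mu]_z (z * signed_step z v * nphi z)%:E = (nphi v)%:E)%E.
Proof.
have mf : measurable_fun setT (fun z : R => (z * signed_step z v * nphi z)%:E).
  apply/measurable_EFinP; apply: measurable_funM; last exact: nphi_meas.
  by apply: measurable_funM => //; exact: signed_step_meas2.
have f0 z : (0 <= (z * signed_step z v * nphi z)%:E)%E.
  by rewrite lee_fin mulr_ge0 ?signed_step_ge0 ?nphi_ge0.
have [v0|v0] := leP v 0; last first.
  rewrite -(nphi_tail (ltW v0)) [RHS]integral_mkcond; apply: eq_integral => z _.
  rewrite patchE mem_setE in_itv/= andbT /signed_step [(v <= 0)%R]leNgt v0 subr0.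
  by case: ifPn => _; rewrite ?mulr1// mulr0 mul0r.
have -> : nphi v = nphi (- v) by rewrite !nphiE sqrrN.
have v0' : 0 <= - v by rewrite oppr_ge0.
rewrite (@ge0_lebesgue_affine _ (-1) 0 _ _ mf f0) ?oppr_eq0 ?oner_neq0//.
rewrite normrN normr1 mul1e -(nphi_tail v0') -integral_itv_obnd_cbnd; last first.
  by apply/measurable_EFinP/measurable_funTS/measurable_funM => //; exact: nphi_meas.
rewrite [RHS]integral_mkcond; apply: eq_integral => z _.
rewrite patchE mem_setE in_itv/= andbT addr0 mulN1r /signed_step v0 ltNge lerNr.
have -> : nphi (- z) = nphi z by rewrite !nphiE sqrrN.
case: (z <= - v)%R => /=; first by rewrite subrr mulr0 mul0r.
by rewrite sub0r mulrNN mulr1.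
Qed.

Lemma prim_signed_step (p : R -> R) z : prim p z = \int[mu]_v (p v * signed_step z v).
Proof. by []. Qed.

Let F (p : R -> R) (q : mR * mR) : \bar R :=
  (p q.2 * (q.1 * signed_step q.1 q.2 * nphi q.1))%:E.

Let F_int (p : R -> R) C : measurable_fun setT p -> (forall x, `|p x| <= C) ->
  (mu \x mu)%E.-integrable setT (F p).
Proof.
move=> mp pC; have mF : measurable_fun setT (F p).
  apply/measurable_EFinP; apply: measurable_funM.
    by apply: measurableT_comp => //; exact: measurable_snd.
  apply: measurable_funM.
    by apply: measurable_funM; [exact: measurable_fst|exact: signed_step_meas].
  exact: (measurableT_comp nphi_meas measurable_fst).
apply/integrable21ltyP => //.
apply: (@le_lt_trans _ _ (\int[mu]_v (C * nphi v)%:E)%E); last first.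
  by have := integrableZl measurableT C nphi_int => /integrable_lty; exact.
have E v : (\int[mu]_z `|F p (z, v)| = (`|p v| * nphi v)%:E)%E.
  rewrite EFinM -signed_step_nphi -ge0_integralZl//.
  - by apply: eq_integral => z _; rewrite /F/= -EFinM normrM [X in _ * X]ger0_norm// mulr_ge0 ?signed_step_ge0 ?nphi_ge0.
  - apply/measurable_EFinP; apply: measurable_funM; last exact: nphi_meas.
    by apply: measurable_funM => //; exact: signed_step_meas2.
  - by move=> z _; rewrite lee_fin mulr_ge0 ?signed_step_ge0 ?nphi_ge0.
under eq_integral do rewrite E.
apply: ge0_le_integral => //.
- by move=> v _; rewrite lee_fin mulr_ge0// nphi_ge0.
- apply/measurable_EFinP; apply: measurable_funM; last exact: nphi_meas.
  exact: measurableT_comp.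
- by apply/measurable_EFinP; apply: measurable_funM => //; exact: nphi_meas.
- by move=> v _; rewrite lee_fin ler_wpM2r ?nphi_ge0.
Qed.

(** Gaussian integration by parts for a primitive, by Fubini: for fixed [v] the
    integral in [z] of [z * signed_step z v * nphi z] is [nphi v]. *)
Lemma stein_prim (p : R -> R) C : measurable_fun setT p -> (forall x, `|p x| <= C) ->
  mu.-integrable setT (EFin \o (fun z => z * nphi z * prim p z)) /\
  \int[mu]_z (z * nphi z * prim p z) = \int[mu]_v (p v * nphi v).
Proof.
move=> mp pC; have iF := F_int mp pC.
have lp : loc_bounded p by split => // N; exists C.
have EF z : fubini_F mu (F p) z = (z * nphi z * prim p z)%:E.
  rewrite /fubini_F prim_signed_step /F/=.
  have ip : mu.-integrable setT (EFin \o (fun v => p v * signed_step z v)) by exact: prim_integrable.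
  transitivity (\int[mu]_v ((z * nphi z)%:E * (p v * signed_step z v)%:E))%E.
    by apply: eq_integral => v _; rewrite -EFinM; congr EFin; ring.
  by rewrite integralZl// [RHS]EFinM fineK//; exact: integrable_fin_num.
have EG v : fubini_G mu (F p) v = (p v * nphi v)%:E.
  rewrite /fubini_G /F/= EFinM -(signed_step_nphi v).
  under eq_integral do rewrite EFinM.
  rewrite integralZl//; apply/integrableP; split.
    apply/measurable_EFinP; apply: measurable_funM; last exact: nphi_meas.
    by apply: measurable_funM => //; exact: signed_step_meas2.
  have -> : (\int[mu]_z `|(z * signed_step z v * nphi z)%:E| = \int[mu]_z (z * signed_step z v * nphi z)%:E)%E; last first.
    by rewrite signed_step_nphi ltry.
  by apply: eq_integral => z _; rewrite gee0_abs// lee_fin mulr_ge0 ?signed_step_ge0 ?nphi_ge0.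
split.
  by have := integrable_fubini_F iF; apply: eq_integrable => // z _; rewrite EF.
rewrite /Rintegral; congr fine.
have := integral21_prod_meas1 iF; rewrite -(integral12_prod_meas1 iF) => E.
transitivity (\int[mu]_z fubini_F mu (F p) z)%E; first by apply: eq_integral => z _; rewrite EF.
by rewrite -E; apply: eq_integral => z _; rewrite EG.
Qed.

Lemma prim1 z : prim (cst 1) z = z.
Proof.
have l1 : loc_bounded (cst (1 : R)) by split => // N; exists 1 => y _; rewrite normr1.
have H (a b : R) : a <= b -> prim (cst 1) b - prim (cst 1) a = b - a.
  move=> ab; have := @prim_near R (cst 1) a b 1 0 l1 ab.
  rewrite mul0r mul1r normr_le0 subr_eq0 => /(_ _)/eqP; apply.
  by move=> y _; rewrite subrr normr0.
have [z0|/ltW z0] := leP 0 z.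
  by have := H _ _ z0; rewrite prim0 !subr0.
by have := H _ _ z0; rewrite prim0 !sub0r => /oppr_inj.
Qed.

(** [stein_prim] with [p = 1] gives a finite second moment, hence a first moment,
    which vanishes by symmetry. *)
Lemma nphi_moments : mu.-integrable setT (EFin \o (fun z => z * nphi z)) /\
  \int[mu]_z (z * nphi z) = 0.
Proof.
have [|i2 _] := @stein_prim (cst 1) 1 (measurable_cst _); first by move=> x; rewrite normr1.
have mz : measurable_fun setT (fun z => z * nphi z).
  by apply: measurable_funM => //; exact: nphi_meas.
have i1 : mu.-integrable setT (EFin \o (fun z => z * nphi z)).
  have i3 := integrableD measurableT nphi_int i2.
  apply: le_integrable i3 => //; first exact/measurable_EFinP.
  move=> z _ /=; rewrite prim1 lee_fin.
  have -> : nphi z + z * nphi z * z = (1 + z ^+ 2) * nphi z by rewrite expr2; ring.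
  rewrite !normrM (ger0_norm (nphi_ge0 z)) ler_wpM2r ?nphi_ge0//.
  rewrite [leRHS]ger0_norm ?addr_ge0 ?sqr_ge0// -(@real_normK _ z) ?num_real//.
  by have := sqr_ge0 (`|z| - 1); have := normr_ge0 z; nra.
split => //.
have [|_] := @lebesgue_affine R (-1) 0 (fun z => z * nphi z) _ i1; first by rewrite oppr_eq0 oner_neq0.
rewrite normrN normr1 invr1 mul1r.
have -> : \int[mu]_x ((-1 * x + 0) * nphi (-1 * x + 0)) = \int[mu]_x (-1 * (x * nphi x)).
  by apply: eq_Rintegral => z _; rewrite addr0 !mulN1r mulNr; congr (- (_ * _)); rewrite !nphiE sqrrN.
rewrite RintegralZl// mulN1r => H; lra.
Qed.

(** Stein's identity for a function that is only the integral of a bounded one. *)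
Lemma stein (psi p : R -> R) C : measurable_fun setT p -> (forall x, `|p x| <= C) ->
  (forall a b, a <= b -> psi b - psi a = \int[mu]_(v in `[a, b]) p v) ->
  mu.-integrable setT (EFin \o (fun z => z * psi z * nphi z)) /\
  \int[mu]_z (z * psi z * nphi z) = \int[mu]_v (p v * nphi v).
Proof.
move=> mp pC H; have lp : loc_bounded p by split => // N; exists C.
have E z : psi z = psi 0 + prim p z.
  have [z0|/ltW z0] := leP 0 z.
    by have := H _ _ z0; rewrite -prim_sub// prim0; lra.
  by have := H _ _ z0; rewrite -prim_sub// prim0; lra.
have [i1 e1] := nphi_moments; have [i2 e2] := stein_prim mp pC.
have i1' : mu.-integrable setT (EFin \o (fun z => psi 0 * (z * nphi z))).
  by have := integrableZl measurableT (psi 0) i1; exact.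
have G : (fun z => z * psi z * nphi z) = (fun z => psi 0 * (z * nphi z) + z * nphi z * prim p z).
  by apply/funext => z; rewrite E; ring.
rewrite G; split; first by have := integrableD measurableT i1' i2; exact.
by rewrite RintegralD// RintegralZl// e1 mulr0 add0r.
Qed.

End gauss.

Section scaling.
Context {R : realType}.
Local Notation mu := (@lebesgue_measure R).
Local Notation mR := (measurableTypeR R).

Lemma itv_scale (p : R -> R) (r a b : R) : 0 < r -> loc_bounded p ->
  \int[mu]_(z in `[a, b]) p (r * z) = r^-1 * \int[mu]_(v in `[r * a, r * b]) p v.
Proof.
move=> r0 lp; rewrite Rintegral_mkcond [in RHS]Rintegral_mkcond.
have /integrable_mkcond := loc_bounded_itv (r * a) (r * b) lp.
rewrite restrict_EFin => /(_ (measurable_itv _)) ih.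
have [|_] := @lebesgue_affine R r 0 (p \_ `[r * a, r * b]) _ ih; first by rewrite gt_eqF.
rewrite gtr0_norm// => <-.
apply: eq_Rintegral => y _; rewrite !patchE !mem_setE !in_itv/= addr0.
by rewrite !ler_pM2l.
Qed.
End scaling.

Lemma measurable_invr (R : realType) : measurable_fun setT (@GRing.inv R).
Proof.
have -> : [set: R] = [set 0] `|` ~` [set 0] by rewrite setUv.
apply/measurable_funU => //; first exact: measurableC.
split; first exact: measurable_fun_set1.
apply: open_continuous_measurable_fun.
  by apply: closed_openC; exact: closed_eq.
move=> x; rewrite inE => /eqP x0; exact: inv_continuous.
Qed.

(** * Heat paths killed at an exponential time *)
Section killed.
Context {R : realType} (K : R) (K0 : 0 < K).
Local Notation mu := (@lebesgue_measure R).
Local Notation mR := (measurableTypeR R).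
Implicit Types (r s t x y z C : R).

Definition killing : probability mR R.
Proof. refine (exponential_prob K : probability _ _). exact K0. Defined.

(** The law of the pair formed by the killing time and the normalized endpoint of a
    Brownian path. Averages over it are the resolvent of the heat operator. *)
Definition walk : probability (mR * mR)%type R :=
  (killing \x gam)%E.

(** The truncation at [0] makes [life] nonnegative everywhere, not just almost
    surely. The variance [2 * life] is that of the kernel of [d/dt - d^2/dx^2]. *)
Definition life (w : mR * mR) : R := Num.max 0 w.1.
Definition Y (w : mR * mR) : R := Num.sqrt (2 * life w) * w.2.

Lemma life_ge0 w : 0 <= life w. Proof. by rewrite /life le_max lexx. Qed.

Lemma life_meas : measurable_fun setT life.
Proof. by apply: measurable_maxr => //; exact: measurable_fst. Qed.

Lemma sqrt2_cont : continuous (fun s : R => Num.sqrt (2 * s)).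
Proof.
move=> s; apply: (@continuous_comp _ _ _ (fun s : R => 2 * s) (@Num.sqrt R)); last exact: sqrt_continuous.
by apply: cvgM; [exact: cvg_cst|exact: cvg_id].
Qed.

Lemma sqrt2_meas : measurable_fun setT (fun s : R => Num.sqrt (2 * s)).
Proof. by apply: continuous_measurable_fun; exact: sqrt2_cont. Qed.

Lemma Y_meas : measurable_fun setT Y.
Proof.
apply: measurable_funM; last exact: measurable_snd.
by apply: (measurableT_comp sqrt2_meas); exact: life_meas.
Qed.

Let epd s := K * expR (- K * s).

Lemma killing_density (f : R -> R) C : measurable_fun setT f -> (forall x, `|f x| <= C) ->
  mu.-integrable `]0, +oo[ (EFin \o (fun s => f s * epd s)) /\
  \int[killing]_s f s = \int[mu]_(s in `]0, +oo[) (f s * epd s).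
Proof.
move=> mf fC.
have [] := @integral_density R killing (exponential_pdf K) f.
- by move=> x; apply: exponential_pdf_ge0; exact: ltW.
- exact: measurable_exponential_pdf.
- exact: integrable_exponential_pdf.
- by [].
- exact: (bounded_integrable killing mf fC).
move=> i1 ->.
have E : (fun x => f x * exponential_pdf K x) = (fun s => f s * epd s) \_ `[0, +oo[.
  apply/funext => x; rewrite /exponential_pdf /epd !patchE.
  by case: ifPn => // _; rewrite mulr0.
have i2 : mu.-integrable `[0, +oo[ (EFin \o (fun s => f s * epd s)).
  by apply/integrable_mkcond => //; rewrite restrict_EFin -E.
have i3 : mu.-integrable `]0, +oo[ (EFin \o (fun s => f s * epd s)).
  by apply: integrableS i2 => //; apply: subset_itvr; rewrite bnd_simp.
by split => //; rewrite Rintegral_itv_obnd_cbnd// [RHS]Rintegral_mkcond -E.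
Qed.

(** Fubini for [walk]: integrate the endpoint first, then the killing time. *)
Lemma walk_iter (h : mR * mR -> R) C :
  measurable_fun setT h -> (forall w, `|h w| <= C) ->
  let A s := \int[gam]_z h (s, z) in
  [/\ measurable_fun setT A, forall s, `|A s| <= C,
  mu.-integrable `]0, +oo[ (EFin \o (fun s => A s * epd s)) &
  \int[walk]_w h w = \int[mu]_(s in `]0, +oo[) (A s * epd s)].
Proof.
move=> mh hC A.
have ih : walk.-integrable setT (EFin \o h) := bounded_integrable walk mh hC.
have mhs s : measurable_fun setT (fun z => h (s, z)) by exact: (measurableT_comp mh (measurable_pair1 s)).
have AE s : (A s)%:E = fubini_F gam (EFin \o h) s.
  rewrite /fubini_F /A /Rintegral fineK//; apply: integrable_fin_num => //.
  exact: (bounded_integrable gam (mhs s) (fun z => hC _)).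
have mA : measurable_fun setT A.
  apply/measurable_EFinP; rewrite (_ : EFin \o A = fubini_F gam (EFin \o h)).
    exact: measurable_fubini_F ih.
  by apply/funext => s; rewrite -AE.
have AC s : `|A s| <= C by exact: (normr_Rintegral_le gam (mhs s) (fun z => hC _)).
have [i e] := killing_density mA AC.
split => //; rewrite -e /Rintegral; congr fine.
rewrite -(integral12_prod_meas1 ih); apply: eq_integral => s _; exact/esym/AE.
Qed.

(** The resolvent formula [avg (K W - W_s - W_yy) = K W (0, 0)]. Along the path
    [s |-> (s, sqrt (2 s) z)] the derivative of [exp (- K s) W] produces the terms in
    [K W] and [W_s] and a term [z W_y / sqrt (2 s)], which Stein's identity turns
    into [W_yy] after averaging over [z]. Integrating over [s] in (0, oo) leaves the
    boundary value at [0]. The second derivative is required only in integrated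
    form, because it is applied to functions that are C^1 with Lipschitz slope. *)
Section representation.
Variables (W Ws Wy Wyy : R -> R -> R) (C : R).
Hypothesis dWs : forall s y, is_derive s (1 : R) (W^~ y) (Ws s y).
Hypothesis dWy : forall s y, is_derive y (1 : R) (W s) (Wy s y).
Hypothesis cW : continuous (fun p : R * R => W p.1 p.2).
Hypothesis cWs : continuous (fun p : R * R => Ws p.1 p.2).
Hypothesis cWy : continuous (fun p : R * R => Wy p.1 p.2).
Let uncurry (G : R -> R -> R) (p : mR * mR) := G p.1 p.2.
Hypothesis mW : measurable_fun setT (uncurry W).
Hypothesis mWs : measurable_fun setT (uncurry Ws).
Hypothesis mWy : measurable_fun setT (uncurry Wy).
Hypothesis mWyy : measurable_fun setT (uncurry Wyy).
Hypothesis IWyy : forall s a b, 0 <= s -> a <= b ->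
  Wy s b - Wy s a = \int[mu]_(v in `[a, b]) Wyy s v.
Hypothesis bW : forall s y, 0 <= s -> `|W s y| <= C.
Hypothesis bWs : forall s y, 0 <= s -> `|Ws s y| <= C.
Hypothesis bWy : forall s y, 0 <= s -> `|Wy s y| <= C.
Hypothesis bWyy : forall s y, 0 <= s -> `|Wyy s y| <= C.

Let E s z := expR (- K * s) * W s (Num.sqrt (2 * s) * z).
Let D s z := expR (- K * s) * (- K * W s (Num.sqrt (2 * s) * z)
  + Ws s (Num.sqrt (2 * s) * z) + Wy s (Num.sqrt (2 * s) * z) * (z / Num.sqrt (2 * s))).

Let C0 : 0 <= C.
Proof. by apply: le_trans (bW 0 (lexx 0)). Qed.

Let dsqrt s z : 0 < s -> is_derive s (1 : R) (fun s => Num.sqrt (2 * s) * z) (z / Num.sqrt (2 * s)).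
Proof.
move=> s0; have s20 : 0 < 2 * s by rewrite mulr_gt0.
have d1 : is_derive s (1 : R) (fun s : R => 2 * s) 2.
  by apply: is_derive_eq; rewrite /GRing.scale/= mulr1.
have d2 := is_derive1_comp (is_derive1_sqrt s20) d1.
have d3 : is_derive s (1 : R) (fun s : R => Num.sqrt (2 * s)) ((2 * Num.sqrt (2 * s))^-1 * 2) := d2.
have d4 : is_derive s (1 : R) (fun s => Num.sqrt (2 * s) * z) (z * ((2 * Num.sqrt (2 * s))^-1 * 2)).
  by rewrite (_ : (fun _ => _) = (fun s => z *: (Num.sqrt (2 * s) : R)));
    [exact: is_deriveZ|apply/funext => y; rewrite /GRing.scale/= mulrC].
apply: is_derive_eq d4 _.
by field; rewrite gt_eqF// sqrtr_gt0.
Qed.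

Let dE s z : 0 < s -> is_derive s (1 : R) (E^~ z) (D s z).
Proof.
move=> s0; rewrite /E /D.
have d1 := @is_derive_path R W Ws Wy (fun s => Num.sqrt (2 * s) * z) s _ dWs (dWy s _) cWs (dsqrt z s0).
have d2 : is_derive s (1 : R) (fun s => expR (- K * s)) (- K * expR (- K * s)).
  by apply: is_derive_eq; rewrite /GRing.scale/=; ring.
have := is_deriveM d2 d1; rewrite /GRing.scale/= => d3.
by apply: is_derive_eq d3 _; ring.
Qed.

Let path_cont (G : R -> R -> R) s z : continuous (fun p : R * R => G p.1 p.2) ->
  {for s, continuous (fun s => G s (Num.sqrt (2 * s) * z))}.
Proof.
move=> cG; apply: (continuous2_comp cG); first by move=> r; exact: cvg_id.
by move=> r; apply: cvgM; [exact: sqrt2_cont|exact: cvg_cst].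
Qed.

Let cexp s : {for s, continuous (fun s => expR (- K * s))}.
Proof.
apply: (@continuous_comp _ _ _ (fun s : R => - K * s) expR); last exact: continuous_expR.
by apply: cvgM; [exact: cvg_cst|exact: cvg_id].
Qed.

Let FTC z a b : 0 < a -> a < b ->
  mu.-integrable `[a, b] (EFin \o D^~ z) /\ \int[mu]_(s in `[a, b]) D s z = E b z - E a z.
Proof.
move=> a0 ab.
have cD : {within `[a, b], continuous D^~ z}.
  apply/subspace_continuousP => s /=; rewrite in_itv/= => /andP[as_ sb].
  have s0 : 0 < s := lt_le_trans a0 as_.
  apply: cvg_within_filter; apply: cvgM; first exact: cexp.
  apply: cvgD; first apply: cvgD.
  - by apply: cvgM; [exact: cvg_cst|exact: path_cont].
  - exact: path_cont.
  - apply: cvgM; first exact: path_cont.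
    apply: cvgM; first exact: cvg_cst.
    apply: cvgV; first by rewrite gt_eqF// sqrtr_gt0 mulr_gt0.
    exact: sqrt2_cont.
have cE (s : R) : 0 < s -> {for s, continuous (E^~ z)}.
  by move=> s0; apply: differentiable_continuous; apply/derivable1_diffP; apply: ex_derive; exact: dE.
split; first by apply: continuous_compact_integrable => //; exact: segment_compact.
rewrite /Rintegral (@continuous_FTC2 _ _ (E^~ z))//.
- split.
  + move=> s; rewrite in_itv/= => /andP[as_ _]; apply: ex_derive; apply: dE; exact: lt_trans as_.
  + by apply: cvg_at_right_filter; exact: cE.
  + by apply: cvg_at_left_filter; apply: cE; exact: lt_trans ab.
- move=> s; rewrite in_itv/= => /andP[as_ _]; rewrite derive1E; apply: derive_val.
  by apply: dE; exact: lt_trans as_.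
Qed.

(** Integrability of the derivative on [a, b]: the path leaves [0] with infinite
    speed, so the bound degenerates as [a] tends to [0]. *)
Let nD a s z : 0 < a -> a <= s -> `|D s z| <= C * (K + 1) + C / Num.sqrt (2 * a) * `|z|.
Proof.
move=> a0 as_; have s0 := lt_le_trans a0 as_; have sge := ltW s0.
rewrite /D normrM ger0_norm ?expR_ge0//.
have e1 : expR (- K * s) <= 1 by rewrite -[leRHS]expR0 ler_expR mulNr oppr_le0 mulr_ge0// ltW.
apply: (@le_trans _ _ (1 * (C * (K + 1) + C / Num.sqrt (2 * a) * `|z|))); last by rewrite mul1r.
apply: ler_pM => //.
rewrite (le_trans (ler_normD _ _))// lerD//.
  rewrite (le_trans (ler_normD _ _))// mulrDr mulr1 lerD ?bWs//.
  by rewrite normrM normrN (gtr0_norm K0) mulrC ler_wpM2r ?bW// ltW.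
rewrite normrM normrM -mulrA ler_pM//; first exact: bWy.
rewrite mulrC ler_wpM2r// normfV lef_pV2 ?posrE ?normr_gt0 ?gt_eqF ?sqrtr_gt0 ?mulr_gt0//.
by rewrite ger0_norm ?sqrtr_ge0//; apply: ler_wsqrtr; rewrite ler_pM2l.
Qed.

Let mpath (G : R -> R -> R) : measurable_fun setT (uncurry G) ->
  measurable_fun setT (fun p : mR * mR =>
    G p.1 (Num.sqrt (2 * p.1) * p.2)).
Proof.
move=> mG.
suff mg : measurable_fun setT (fun p : mR * mR =>
    (p.1, Num.sqrt (2 * p.1) * p.2) : mR * mR).
  exact: (measurableT_comp mG mg).
apply: measurable_fun_pair; first exact: measurable_fst.
apply: measurable_funM; last exact: measurable_snd.
exact: (measurableT_comp sqrt2_meas measurable_fst).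
Qed.

Let mexp : measurable_fun setT (fun p : mR * mR => expR (- K * p.1)).
Proof.
apply: (measurableT_comp (f := fun x : R => expR (- K * x))); last exact: measurable_fst.
apply: continuous_measurable_fun; exact: cexp.
Qed.

Let mD : measurable_fun setT (uncurry D).
Proof.
apply: measurable_funM; first exact: mexp.
apply: measurable_funD; first apply: measurable_funD.
- by apply: measurable_funM => //; exact: mpath.
- exact: mpath.
apply: measurable_funM; first exact: mpath.
apply: measurable_funM; first exact: measurable_snd.
apply: (measurableT_comp (f := fun x : R => (Num.sqrt (2 * x))^-1)); last exact: measurable_fst.
exact: (measurableT_comp (@measurable_invr R) sqrt2_meas).
Qed.

Let A s := \int[gam]_z (K * W s (Num.sqrt (2 * s) * z) - Ws s (Num.sqrt (2 * s) * z)
  - Wyy s (Num.sqrt (2 * s) * z)).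

Let sec (G : R -> R -> R) s : measurable_fun setT (uncurry G) -> measurable_fun setT (G s).
Proof. by move=> mG; exact: (measurableT_comp mG (measurable_pair1 s)). Qed.

Let bnphi (k : R -> R) : measurable_fun setT k -> (exists B, forall z, `|k z| <= B) ->
  mu.-integrable setT (EFin \o (fun z => k z * nphi z)) /\
  \int[gam]_z k z = \int[mu]_z (k z * nphi z).
Proof. move=> mk [B kB]; apply: gam_density; exact: (bounded_integrable gam mk kB). Qed.

Let inner s : 0 < s -> mu.-integrable setT (EFin \o (fun z => D s z * nphi z)) /\
  \int[mu]_z (D s z * nphi z) = - (expR (- K * s) * A s).
Proof.
move=> s0; have sge := ltW s0; set r := Num.sqrt (2 * s).
have r0 : 0 < r by rewrite sqrtr_gt0 mulr_gt0.
have msc (G : R -> R -> R) : measurable_fun setT (uncurry G) -> measurable_fun setT (fun z => G s (r * z)).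
  move=> mG; apply: (measurableT_comp (sec s mG)); exact: measurable_funM.
have [] := @stein R (fun z => Wy s (r * z) / r) (fun z => Wyy s (r * z)) C.
- exact: msc.
- by move=> z; exact: bWyy.
- move=> a b ab; rewrite itv_scale//; last first.
    by split; [exact: sec|move=> N; exists C => y _; exact: bWyy].
  by rewrite -IWyy ?ler_pM2l// -mulrBl mulrC.
move=> i1 e1.
have [i2 e2] : mu.-integrable setT (EFin \o (fun z => (- K * W s (r * z) + Ws s (r * z)) * nphi z)) /\
    \int[gam]_z (- K * W s (r * z) + Ws s (r * z)) = \int[mu]_z ((- K * W s (r * z) + Ws s (r * z)) * nphi z).
  apply: bnphi.
    by apply: measurable_funD; [apply: measurable_funM => //; exact: msc|exact: msc].
  exists (K * C + C) => z; rewrite (le_trans (ler_normD _ _))// lerD ?bWs//.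
  by rewrite normrM normrN (gtr0_norm K0) ler_wpM2l ?bW// ltW.
have [i3 e3] : mu.-integrable setT (EFin \o (fun z => Wyy s (r * z) * nphi z)) /\
    \int[gam]_z (Wyy s (r * z)) = \int[mu]_z (Wyy s (r * z) * nphi z).
  by apply: bnphi; [exact: msc|exists C => z; exact: bWyy].
have i12 : mu.-integrable setT (EFin \o (fun z => (- K * W s (r * z) + Ws s (r * z)) * nphi z + z * (Wy s (r * z) / r) * nphi z)).
  by have := integrableD measurableT i2 i1; exact.
have DE z : D s z * nphi z = expR (- K * s) * ((- K * W s (r * z) + Ws s (r * z)) * nphi z + z * (Wy s (r * z) / r) * nphi z).
  by rewrite /D -/r; ring.
split.
  have := integrableZl measurableT (expR (- K * s)) i12.
  by apply: eq_integrable => // z _; rewrite /= DE.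
transitivity (\int[mu]_z (expR (- K * s) * ((- K * W s (r * z) + Ws s (r * z)) * nphi z + z * (Wy s (r * z) / r) * nphi z))).
  by apply: eq_Rintegral => z _; rewrite DE.
rewrite RintegralZl// RintegralD// e1 -mulrN; congr (_ * _).
rewrite -e2 -e3 /A -/r -RintegralD//; last 2 first.
- apply: (@bounded_integrable _ _ _ gam _ (K * C + C)).
    by apply: measurable_funD; [apply: measurable_funM => //; exact: msc|exact: msc].
  move=> z; rewrite (le_trans (ler_normD _ _))// lerD ?bWs//.
  by rewrite normrM normrN (gtr0_norm K0) ler_wpM2l ?bW// ltW.
- by apply: (@bounded_integrable _ _ _ gam _ C); [exact: msc|move=> z; exact: bWyy].
have ib : gam.-integrable setT (EFin \o (fun z => K * W s (r * z) - Ws s (r * z) - Wyy s (r * z))).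
  apply: (@bounded_integrable _ _ _ gam _ (K * C + C + C)).
    by apply: measurable_funB; [apply: measurable_funB; [apply: measurable_funM => //; exact: msc|exact: msc]|exact: msc].
  move=> z; rewrite (le_trans (ler_normB _ _))// lerD ?bWyy//.
  rewrite (le_trans (ler_normB _ _))// lerD ?bWs//.
  by rewrite normrM (gtr0_norm K0) ler_wpM2l ?bW// ltW.
rewrite -[RHS]mulN1r -RintegralZl//; apply: eq_Rintegral => z _; ring.
Qed.

(** Exchange of the two integrations on a time window bounded away from [0]. *)
Let outer a b : 0 < a -> a < b ->
  \int[mu]_z ((E b z - E a z) * nphi z) = \int[mu]_(s in `[a, b]) - (expR (- K * s) * A s).
Proof.
move=> a0 ab.
pose I (s : R) := a <= s <= b.
pose G (p : mR * mR) : \bar R :=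
  (if I p.1 then D p.1 p.2 * nphi p.2 else 0)%:E.
have mG : measurable_fun setT G.
  apply/measurable_EFinP; apply: measurable_fun_ifT.
  - apply: measurable_and.
      by apply: measurable_fun_ler; [exact: measurable_cst|exact: measurable_fst].
    by apply: measurable_fun_ler; [exact: measurable_fst|exact: measurable_cst].
  - apply: measurable_funM; first exact: mD.
    exact: (measurableT_comp nphi_meas measurable_snd).
  - exact: measurable_cst.
pose c1 := C * (K + 1); pose c2 := C / Num.sqrt (2 * a).
have c10 : 0 <= c1 by rewrite mulr_ge0// addr_ge0// ltW.
have c20 : 0 <= c2 by rewrite divr_ge0// sqrtr_ge0.
have ic : mu.-integrable setT (EFin \o (fun z => c1 * nphi z + c2 * `|z * nphi z|)).
  have [im _] := @nphi_moments R.
  have := integrableD measurableT (integrableZl measurableT c1 nphi_int)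
    (integrableZl measurableT c2 (integrable_norm im)).
  by [].
pose M := \int[mu]_z (c1 * nphi z + c2 * `|z * nphi z|).
have iG : (mu \x mu)%E.-integrable setT G.
  apply/integrable12ltyP => //.
  apply: (@le_lt_trans _ _ (\int[mu]_s (M * \1_`[a, b] s)%:E)%E); last first.
    have : mu.-integrable setT (EFin \o (fun s => M * \1_`[a, b] s)).
      have := integrableZl measurableT M (integrable_indic_itv a b true false); exact.
    by move/integrable_lty; exact.
  apply: ge0_le_integral => //.
  - by move=> s _; exact: integral_ge0.
  - have maG : measurable_fun setT (abse \o G) by exact: measurableT_comp.
    exact: (measurable_fun_fubini_tonelli_F (m2 := mu) (abse \o G) maG (fun=> abse_ge0 _)).
  - by apply/measurable_EFinP; apply: measurable_funM => //; exact: measurable_indic.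
  move=> s _; rewrite indicE mem_setE in_itv/=.
  rewrite /G/= -/(I s); case: (boolP (I s)) => [Is|_]; last first.
    by rewrite integral0_eq ?mulr0// => z _; rewrite normr0.
  rewrite mulr1 /M /Rintegral fineK; last exact: integrable_fin_num.
  apply: ge0_le_integral => //.
  - apply/measurable_EFinP; apply: measurableT_comp => //; apply: measurable_funM.
      exact: (sec s mD).
    exact: nphi_meas.
  - by move/integrableP : ic => [].
  move=> z _; rewrite lee_fin normrM [`|z * _|]normrM (ger0_norm (nphi_ge0 z)) mulrA -mulrDl.
  by rewrite ler_wpM2r ?nphi_ge0// nD//; move/andP : Is => [].
have EF s : fubini_F mu G s = (((fun s => - (expR (- K * s) * A s)) \_ `[a, b]) s)%:E.
  rewrite /fubini_F /G/= patchE mem_setE in_itv/= -/(I s); case: (boolP (I s)) => [Is|_]; last first.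
    by rewrite integral0_eq.
  have s0 : 0 < s by move/andP : Is => [as_ _]; exact: lt_le_trans as_.
  by have [is_ <-] := inner s0; rewrite fineK//; exact: integrable_fin_num.
have EG z : fubini_G mu G z = ((E b z - E a z) * nphi z)%:E.
  have [iz ez] := FTC z a0 ab.
  rewrite /fubini_G /G/= -ez -RintegralZr// /Rintegral fineK; last first.
    by apply: integrable_fin_num => //; have := @integrableZr _ _ _ mu `[a, b] (measurable_itv _) (nphi z) _ iz; exact.
  rewrite [RHS]integral_mkcond; apply: eq_integral => s _.
  by rewrite patchE mem_setE in_itv/= /I; case: ifP.
have := integral21_prod_meas1 iG; rewrite -(integral12_prod_meas1 iG) => H.
rewrite [RHS]Rintegral_mkcond /Rintegral; congr fine.
transitivity (\int[mu]_z fubini_G mu G z)%E; first by apply: eq_integral => z _; rewrite EG.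
by rewrite H; apply: eq_integral => s _; rewrite EF.
Qed.

Let mpathS (G : R -> R -> R) : measurable_fun setT (uncurry G) ->
  measurable_fun setT (fun w => G (life w) (Y w)).
Proof.
move=> mG.
suff mg : measurable_fun setT (fun p => (life p, Y p) : mR * mR).
  exact: (measurableT_comp mG mg).
by apply: measurable_fun_pair; [exact: life_meas|exact: Y_meas].
Qed.

Let h w := K * W (life w) (Y w) - Ws (life w) (Y w) - Wyy (life w) (Y w).

Let a_ (n : nat) : R := n.+2%:R^-1.
Let b_ (n : nat) : R := n.+2%:R.

Let a0 n : 0 < a_ n. Proof. by rewrite invr_gt0. Qed.
Let ab n : a_ n < b_ n.
Proof.
have n1 : 1 < n.+2%:R :> R by rewrite ltr1n.
by rewrite (lt_trans _ n1)// invf_lt1.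
Qed.

Let E_lim z : (E (b_ n) z - E (a_ n) z) @[n --> \oo] --> - W 0 0.
Proof.
rewrite -(sub0r (W 0 0)); apply: cvgB.
  apply/norm_cvg0P.
  apply: (@squeeze_cvgr _ _ _ _ (cst 0) (fun n => expR (- (K * b_ n)) * C)); last 2 first.
  - exact: cvg_cst.
  - rewrite -(mul0r C); apply: cvgM; last exact: cvg_cst.
    apply: (@cvg_comp _ _ _ (fun n => K * b_ n) (fun x : R => expR (- x)) \oo +oo); last exact: cvgr_expR.
    apply/cvgryPge => B; near=> n; rewrite -ler_pdivrMl//.
    rewrite (@le_trans _ _ n%:R)//; last by rewrite ler_nat -addn2 leq_addr.
    by near: n; exact: nbhs_infty_ger.
  near=> n; rewrite normr_ge0/= /E normrM ger0_norm ?expR_ge0// mulNr.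
  by rewrite ler_wpM2l ?expR_ge0// bW// ler0n.
have c0 : {for (0 : R), continuous (E^~ z)}.
  by apply: cvgM; [exact: cexp|exact: path_cont].
have -> : W 0 0 = E 0 z by rewrite /E !mulr0 sqrtr0 mul0r expR0 mul1r.
apply: (@cvg_comp _ _ _ a_ (E^~ z) \oo (nbhs 0)); last exact: c0.
have := @cvg_harmonic R; rewrite -(cvg_shiftn 1); apply: cvg_trans; apply: near_eq_cvg.
by near=> n; rewrite /a_/= addn1.
Unshelve. all: by end_near. Qed.

Lemma heat_representation : \int[walk]_w h w = K * W 0 0.
Proof.
have mh : measurable_fun setT h.
  apply: measurable_funB; last exact: mpathS.
  apply: measurable_funB; last exact: mpathS.
  by apply: measurable_funM => //; exact: mpathS.
have hC w : `|h w| <= K * C + C + C.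
  have S0 := life_ge0 w.
  rewrite (le_trans (ler_normB _ _))// lerD ?bWyy//.
  rewrite (le_trans (ler_normB _ _))// lerD ?bWs//.
  by rewrite normrM (gtr0_norm K0) ler_wpM2l ?bW// ltW.
have [mA AC iA ->] := walk_iter mh hC.
set A' := fun s => \int[gam]_z h (s, z).
have A'E s : 0 < s -> A' s = A s.
  by move=> s0; rewrite /A' /h /life/Y/life/= max_r// ltW.
have EE s y : 0 <= s -> `|E s y| <= C.
  move=> s0; rewrite /E normrM ger0_norm ?expR_ge0//.
  have e1 : expR (- K * s) <= 1 by rewrite -[leRHS]expR0 ler_expR mulNr oppr_le0 mulr_ge0// ltW.
  by rewrite -[leRHS]mul1r ler_pM ?bW// expR_ge0.
have mE s : measurable_fun setT (E s).
  apply: measurable_funM => //.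
  by apply: (measurableT_comp (sec s mW)); exact: measurable_funM.
have L1 : \int[mu]_z ((E (b_ n) z - E (a_ n) z) * nphi z) @[n --> \oo] --> \int[mu]_z (- W 0 0 * nphi z).
  apply: (@dominated_Rintegral _ _ _ mu setT _ _ (fun z => 2 * C * nphi z)) => //.
  - by move=> n; apply: measurable_funM; [exact: (measurable_funB (mE _) (mE _))|exact: nphi_meas].
  - by apply: measurable_funM => //; exact: nphi_meas.
  - by move=> z _; apply: cvgM; [exact: E_lim|exact: cvg_cst].
  - by have := integrableZl measurableT (2 * C) (@nphi_int R); exact.
  - move=> n z _; rewrite normrM (ger0_norm (nphi_ge0 z)) ler_wpM2r ?nphi_ge0//.
    rewrite (le_trans (ler_normB _ _))// mulr_natl mulr2n lerD ?EE// ltW//.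
have mAe : measurable_fun (`]0, +oo[%classic : set (mR)) (fun s => A' s * epd s).
  by move/integrableP : iA => [/measurable_EFinP].
have near_max (B : R) : \forall n \near \oo, B <= n.+2%:R.
  near=> n; rewrite (@le_trans _ _ n%:R)//; last by rewrite ler_nat -addn2 leq_addr.
  by near: n; exact: nbhs_infty_ger.
have L2 : \int[mu]_(s in `]0, +oo[) ((A' s * epd s) * \1_`[a_ n, b_ n] s) @[n --> \oo] -->
    \int[mu]_(s in `]0, +oo[) (A' s * epd s).
  apply: (@dominated_Rintegral _ _ _ mu `]0, +oo[ _ _ (fun s => `|A' s * epd s|)) => //.
  - move=> n; apply: measurable_funM; first exact: mAe.
    by apply: measurable_funTS; exact: measurable_indic.
  - rewrite /= => s; rewrite in_itv/= andbT => s0.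
    rewrite -[X in _ --> X]mulr1; apply: cvgM; first exact: cvg_cst.
    apply: cvg_near_cst; near=> n; rewrite indicE mem_setE in_itv/=.
    have n1 : Num.max s s^-1 <= n.+2%:R by near: n; exact: near_max.
    move: n1; rewrite ge_max => /andP[h1 h2]; rewrite h1 andbT.
    by rewrite /a_ -[s]invrK lef_pV2 ?posrE ?invr_gt0// h2.
  - exact: integrable_norm.
  - move=> n s _; rewrite normrM ler_piMr// indicE.
    by case: (_ \in _); rewrite ?normr1 ?normr0.
have L12 n : \int[mu]_(s in `]0, +oo[) ((A' s * epd s) * \1_`[a_ n, b_ n] s) =
  - K * \int[mu]_z ((E (b_ n) z - E (a_ n) z) * nphi z).
  have sub : `[a_ n, b_ n] `<=` `]0, +oo[.
    by apply: subset_itv; rewrite bnd_simp.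
  have iAn : mu.-integrable `[a_ n, b_ n] (EFin \o (fun s => A' s * epd s)).
    exact: integrableS iA.
  have eqA s : s \in `[a_ n, b_ n] -> A' s * epd s = - K * - (expR (- K * s) * A s).
    rewrite inE/= in_itv/= => /andP[as_ _].
    by rewrite A'E ?(lt_le_trans (a0 n))// /epd; ring.
  rewrite outer// -RintegralZl//; last first.
    have := @integrableZl _ _ _ mu `[a_ n, b_ n] (measurable_itv _) (- K^-1) _ iAn.
    apply: eq_integrable => // s sI /=; rewrite eqA// -EFinM; congr EFin.
    by field; rewrite gt_eqF.
  rewrite -[RHS](@eq_Rintegral _ _ _ mu _ _ (fun s => A' s * epd s)); last by move=> s sI; rewrite eqA.
  rewrite Rintegral_mkcond [RHS]Rintegral_mkcond; apply: eq_Rintegral => s _.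
  rewrite !patchE indicE; have [sI|sI] := boolP (s \in `[a_ n, b_ n]).
    rewrite mulr1 ifT// inE; apply: sub; by rewrite inE in sI.
  by rewrite mulr0; case: ifP.
have L3 : \int[mu]_(s in `]0, +oo[) ((A' s * epd s) * \1_`[a_ n, b_ n] s) @[n --> \oo] -->
    - K * \int[mu]_z (- W 0 0 * nphi z).
  rewrite (_ : (fun n => _) = (fun n => - K * \int[mu]_z ((E (b_ n) z - E (a_ n) z) * nphi z))); last exact/funext.
  by apply: cvgM; [exact: cvg_cst|exact: L1].
have -> : \int[mu]_(s in `]0, +oo[) (A' s * epd s) = - K * \int[mu]_z (- W 0 0 * nphi z).
  exact: (cvg_unique (@Rhausdorff R) L2 L3).
by rewrite RintegralZl ?nphi_int1 ?mulr1 ?mulrNN//; exact: nphi_int.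
Unshelve. all: by end_near. Qed.

End representation.
(** A Lipschitz cut-off of small killing times: averages of bounded functions over
    the remaining paths are Lipschitz in time, while the paths that are removed
    have mass at most [K * eta]. *)
Definition ramp (eta s : R) := Num.min (s / eta) 1.

Lemma ramp_meas eta : measurable_fun setT (ramp eta).
Proof. by apply: measurable_minr => //; exact: measurable_funM. Qed.

Lemma ramp_itv eta s : 0 < eta -> 0 <= s -> 0 <= ramp eta s <= 1.
Proof.
move=> e0 s0; rewrite /ramp le_min ler01 andbT ge_min lexx orbT andbT.
by rewrite divr_ge0// ltW.
Qed.

Lemma ramp_mass eta : 0 < eta -> \int[walk]_w (1 - ramp eta (life w)) <= K * eta.
Proof.
move=> e0.
have mh : measurable_fun setT (fun w => 1 - ramp eta (life w)).
  by apply: measurable_funB => //; apply: measurableT_comp; [exact: ramp_meas|exact: life_meas].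
have hC w : `|1 - ramp eta (life w)| <= 1.
  have /andP[r0 r1] := ramp_itv e0 (life_ge0 w).
  by rewrite ger0_norm ?subr_ge0// gerBl.
have [_ _ iA ->] := walk_iter mh hC.
have ii : mu.-integrable `]0, +oo[ (EFin \o (fun s => K * \1_`[0, eta] s)).
  apply: (@integrableS _ _ _ mu setT) => //.
  have := integrableZl measurableT K (integrable_indic_itv 0 eta true false); exact.
apply: (@le_trans _ _ (\int[mu]_(s in `]0, +oo[) (K * \1_`[0, eta] s))).
  apply: le_Rintegral => // s; rewrite /= in_itv/= andbT => s0.
  have -> : \int[gam]_z (1 - ramp eta (life (s, z))) = 1 - ramp eta s.
    rewrite (_ : (fun z => _) = cst (1 - ramp eta s)).
      by rewrite Rintegral_cst//= [X in fine X](probability_setT gam) mulr1.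
    by apply/funext => z; rewrite /life/= max_r// ltW.
  have /andP[r0 r1] := ramp_itv e0 (ltW s0).
  have e1 : expR (- K * s) <= 1 by rewrite -[leRHS]expR0 ler_expR mulNr oppr_le0 mulr_ge0// ltW.
  rewrite indicE mem_setE in_itv/= (ltW s0)/=; have [se|se] := leP s eta.
    rewrite mulr1 /epd mulrCA ler_piMr ?(ltW K0)//.
    by rewrite mulr_ile1 ?expR_ge0// ?subr_ge0// gerBl.
  have -> : ramp eta s = 1 by rewrite /ramp min_r// ler_pdivlMr// mul1r ltW.
  by rewrite subrr mul0r mulr0.
have -> : K * eta = \int[mu]_s (K * \1_`[0, eta] s).
  have i1 := integrable_indic_itv 0 eta true false.
  rewrite RintegralZl// /Rintegral integral_indic// setIT.
  by rewrite [X in fine X]lebesgue_measure_itv/= lte_fin e0 -EFinB subr0.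
rewrite Rintegral_mkcond; apply: le_Rintegral => //.
- by have /integrable_mkcond := ii; rewrite restrict_EFin; exact.
- have := integrableZl measurableT K (integrable_indic_itv 0 eta true false); exact.
move=> s _; rewrite patchE; case: ifP => // _.
by apply: mulr_ge0; [exact: ltW|rewrite indicE].
Qed.

(** Shifting time by [d] is the same as shifting the killing time, after which the
    three factors [1 / max s eta], [s P_s k] and [exp (- K s)] of the integrand are
    compared one by one. *)
Lemma ramp_time_lipschitz (k : mR * mR -> R) C eta d t x :
  0 < eta -> 0 <= d -> measurable_fun setT k -> (forall p, `|k p| <= C) ->
  `|\int[walk]_w (ramp eta (life w) * k (t + d - life w, x - Y w)) -
    \int[walk]_w (ramp eta (life w) * k (t - life w, x - Y w))| <= C * d * (2 / eta + K).
Proof.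
move=> e0 d0 mk kC.
have C0 : 0 <= C by apply: le_trans (kC point).
pose g s tau := \int[gam]_z k (tau, x - Num.sqrt (2 * s) * z).
have mks tau : measurable_fun setT (fun y => k (tau, y)) by exact: (measurableT_comp mk (measurable_pair1 tau)).
have mkr tau r : measurable_fun setT (fun z : R => k (tau, x - r * z)).
  by apply: (measurableT_comp (mks tau)); apply: measurable_funB => //; exact: measurable_funM.
have gC s tau : `|g s tau| <= C by exact: (normr_Rintegral_le gam (mkr tau _) (fun z => kC _)).
have gL s s' tau : 0 <= s -> s <= s' -> `|s' * g s' tau - s * g s tau| <= C * (s' - s).
  move=> s0 ss'; have s'0 := le_trans s0 ss'.
  have := @heat_time_lipschitz R (Num.sqrt (2 * s)) (Num.sqrt (2 * s')) x (fun y => k (tau, y)) C (sqrtr_ge0 _).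
  rewrite !sqr_sqrtr ?mulr_ge0// ![2 * _ / 2]mulrAC !divff// !mul1r; apply => //.
  by apply: ler_wsqrtr; rewrite ler_pM2l.
pose Phi t s := if 0 < s then epd s / Num.max s eta * (s * g s (t - s)) else 0.
have V t' : mu.-integrable setT (EFin \o Phi t') /\
   \int[walk]_w (ramp eta (life w) * k (t' - life w, x - Y w)) = \int[mu]_s Phi t' s.
  have mh : measurable_fun setT (fun w => ramp eta (life w) * k (t' - life w, x - Y w)).
    apply: measurable_funM.
      by apply: measurableT_comp; [exact: ramp_meas|exact: life_meas].
    suff mg : measurable_fun setT (fun w => (t' - life w, x - Y w) : mR * mR).
      exact: (measurableT_comp mk mg).
    apply: measurable_fun_pair; first by apply: measurable_funB => //; exact: life_meas.
    by apply: measurable_funB => //; exact: Y_meas.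
  have hC w : `|ramp eta (life w) * k (t' - life w, x - Y w)| <= 1 * C.
    have /andP[r0 r1] := ramp_itv e0 (life_ge0 w).
    by rewrite normrM ler_pM// ger0_norm.
  have [_ _ iA ->] := walk_iter mh hC.
  pose A (s : R) := \int[gam]_z (ramp eta (life (s, z)) * k (t' - life (s, z), x - Y (s, z))).
  rewrite -/(A _) in iA *.
  have EPhi : Phi t' = (fun s => A s * epd s) \_ `]0, +oo[.
    apply/funext => s; rewrite patchE mem_setE in_itv/= andbT /Phi; case: ifP => // s0.
    have -> : A s = ramp eta s * g s (t' - s).
      rewrite /A /life/Y/life/= max_r ?ltW// RintegralZl//.
      exact: (bounded_integrable gam (mkr _ _) (fun z => kC _)).
    have m0 : 0 < Num.max s eta by rewrite lt_max s0.
    have -> : ramp eta s = s / Num.max s eta.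
      rewrite /ramp; have [se|es] := leP s eta.
        by rewrite min_l// ler_pdivrMr// mul1r.
      by rewrite min_r ?divff ?gt_eqF// ler_pdivlMr// mul1r ltW.
    by field; rewrite gt_eqF.
  rewrite Rintegral_mkcond EPhi; split => //.
  by have /integrable_mkcond := iA; rewrite restrict_EFin; exact.
have [i1 ->] := V t; have [i2 ->] := V (t + d).
have [i3] := @lebesgue_affine R 1 d _ (oner_neq0 _) i2.
rewrite normr1 invr1 mul1r => <-.
rewrite -RintegralB//.
pose pdf := exponential_pdf K.
have ip : mu.-integrable setT (EFin \o pdf) by exact: integrable_exponential_pdf.
have Ip : \int[mu]_s pdf s = 1 by rewrite /Rintegral integral_exponential_pdf.
have [ipd] := @lebesgue_affine R 1 d _ (oner_neq0 _) ip.
rewrite normr1 invr1 mul1r Ip => Ipd.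
have pdf0 s : 0 <= pdf s by apply: exponential_pdf_ge0; exact: ltW.
have pdfE s : 0 < s -> pdf s = epd s by move=> s0; rewrite /pdf exponential_pdfE ?ltW.
have iU1 : mu.-integrable setT (EFin \o (fun s => C * d / eta * pdf (1 * s + d))).
  by have := integrableZl measurableT (C * d / eta) ipd; exact.
have iU2 : mu.-integrable setT (EFin \o (fun s => C * d * (1 / eta + K) * pdf s)).
  by have := integrableZl measurableT (C * d * (1 / eta + K)) ip; exact.
have -> : C * d * (2 / eta + K) = \int[mu]_s (C * d / eta * pdf (1 * s + d) + C * d * (1 / eta + K) * pdf s).
  by rewrite RintegralD// !RintegralZl// Ip Ipd; field; rewrite gt_eqF.
have iB := integrableB measurableT i3 i1.
apply: (le_trans (le_normr_Rintegral measurableT iB)).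
apply: le_Rintegral => //.
- exact: integrable_norm.
- by have := integrableD measurableT iU1 iU2; exact.
move=> s _; rewrite mul1r /Phi.
have eta0 : 0 < eta^-1 by rewrite invr_gt0.
have mx (u : R) : 0 < Num.max u eta by rewrite lt_max e0 orbT.
have mxe (u : R) : (Num.max u eta)^-1 <= eta^-1 by rewrite lef_pV2 ?posrE// le_max lexx orbT.
have [sd0|sd0] := ltP 0 (s + d); last first.
  have s0 : s <= 0 by rewrite (le_trans _ sd0)// lerDl.
  rewrite ltNge s0/= subr0 normr0 addr_ge0 ?mulr_ge0 ?addr_ge0 ?divr_ge0 ?pdf0// ltW//.
rewrite (_ : t + d - (s + d) = t - s); last by ring.
have epd0 u : 0 <= epd u by rewrite /epd mulr_ge0 ?expR_ge0// ltW.
have [s0|s0] := ltP 0 s; last first.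
  rewrite subr0 (@le_trans _ _ (C * d / eta * pdf (s + d)))//; last first.
    by rewrite lerDl ?mulr_ge0 ?addr_ge0 ?divr_ge0 ?pdf0// ltW.
  rewrite pdfE// normrM ger0_norm ?divr_ge0//; last exact: ltW.
  rewrite [X in _ <= X](_ : _ = eta^-1 * ((C * d) * epd (s + d))); last by ring.
  rewrite [X in X <= _](_ : _ = (Num.max (s + d) eta)^-1 * (`|(s + d) * g (s + d) (t - s)| * epd (s + d))); last by ring.
  apply: ler_pM; [by rewrite invr_ge0 ltW|by rewrite mulr_ge0|exact: mxe|].
  rewrite ler_wpM2r// normrM mulrC; apply: ler_pM => //.
  by rewrite gtr0_norm// gerDr.
set b' := (s + d) * g (s + d) (t - s); set b := s * g s (t - s).
have Lb : `|b' - b| <= C * d.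
  by have := @gL s (s + d) (t - s) (ltW s0); rewrite lerDl => /(_ d0); rewrite addrAC subrr add0r.
have nb : `|b| <= C * s by rewrite /b normrM mulrC (gtr0_norm s0) ler_wpM2r// ltW.
set c := (Num.max s eta)^-1; set c' := (Num.max (s + d) eta)^-1.
have c0 : 0 < c by rewrite invr_gt0.
have c'0 : 0 < c' by rewrite invr_gt0.
have sc : s * c <= 1 by rewrite ler_pdivrMr// mul1r le_max lexx.
have sc' : s * c' <= 1 by rewrite ler_pdivrMr// mul1r le_max lerDl d0.
have cc' : c - c' <= d * c * c'.
  have -> : c - c' = (Num.max (s + d) eta - Num.max s eta) * c * c'.
    by rewrite /c /c'; field; rewrite !gt_eqF.
  rewrite -!mulrA; apply: ler_wpM2r; first by rewrite mulr_ge0 ?(ltW c0) ?(ltW c'0).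
  rewrite lerBlDr ge_max; apply/andP; split.
    by rewrite addrC lerD2l le_max lexx.
  by rewrite (@le_trans _ _ (Num.max s eta)) ?lerDr// le_max lexx orbT.
have c'c : c' <= c.
  rewrite lef_pV2 ?posrE// ge_max !le_max lexx orbT andbT.
  by rewrite lerDl d0.
pose q := expR (- K * d).
have q1 : q <= 1 by rewrite -[leRHS]expR0 ler_expR mulNr oppr_le0 mulr_ge0// ltW.
have qK : 1 - q <= K * d by rewrite lerBlDl -lerBlDr -mulNr; exact: expR_ge1Dx.
have Eq : epd (s + d) = epd s * q by rewrite /epd /q mulrDr expRD mulrA.
(* telescoping: first the averaged factor changes, then the two weights *)
have -> : epd (s + d) * c' * b' - epd s * c * b =
    epd (s + d) * c' * (b' - b) - epd s * ((c - c') + c' * (1 - q)) * b.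
  by rewrite Eq; ring.
rewrite (le_trans (ler_normB _ _))// pdfE// pdfE// lerD//.
  rewrite normrM (@ger0_norm _ (epd (s + d) * c')); last by rewrite mulr_ge0// (ltW c'0).
  have -> : C * d / eta * epd (s + d) = epd (s + d) * eta^-1 * (C * d) by ring.
  apply: ler_pM => //; first by rewrite mulr_ge0// (ltW c'0).
  by apply: ler_wpM2l => //; exact: mxe.
have X0 : 0 <= c - c' + c' * (1 - q) by rewrite addr_ge0 ?subr_ge0// mulr_ge0 ?subr_ge0// ltW.
rewrite normrM ger0_norm ?mulr_ge0//.
have -> : C * d * (1 / eta + K) * epd s = epd s * (d * (1 / eta + K) * C) by ring.
rewrite [X in X <= _](_ : _ = epd s * ((c - c' + c' * (1 - q)) * `|b|)); last by ring.
apply: ler_wpM2l => //.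
rewrite (@le_trans _ _ ((c - c' + c' * (1 - q)) * (C * s)))//; first exact: ler_wpM2l.
rewrite [X in X <= _](_ : _ = ((c - c') * s + s * c' * (1 - q)) * C); last by ring.
apply: ler_wpM2r => //; rewrite [X in _ <= X]mulrDr; apply: lerD.
  rewrite (@le_trans _ _ (d * c * c' * s))//; first by apply: ler_wpM2r => //; exact: ltW.
  rewrite [X in X <= _](_ : _ = d * ((s * c) * c')); last by ring.
  apply: ler_wpM2l => //; apply: ler_pM; [| |exact: sc|exact: mxe].
  - by rewrite mulr_ge0 ?(ltW s0) ?(ltW c0).
  - exact: ltW.
rewrite (@le_trans _ _ (1 * (1 - q)))//; first by apply: ler_wpM2r => //; rewrite subr_ge0.
by rewrite mul1r [leRHS]mulrC.
exact: ltW.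
Qed.

End killed.

(** * Averages of bounded functions *)

Section averages.
Context {R : realType} d (T : measurableType d) (P : probability T R).
Implicit Types (f g : T -> R) (C e : R).

Lemma averageB f g C : measurable_fun setT f -> (forall x, `|f x| <= C) ->
  measurable_fun setT g -> (forall x, `|g x| <= C) ->
  \int[P]_x (f x - g x) = \int[P]_x f x - \int[P]_x g x.
Proof.
by move=> mf fC mg gC; rewrite RintegralB//; exact: bounded_integrable.
Qed.

Lemma averageD f g C : measurable_fun setT f -> (forall x, `|f x| <= C) ->
  measurable_fun setT g -> (forall x, `|g x| <= C) ->
  \int[P]_x (f x + g x) = \int[P]_x f x + \int[P]_x g x.
Proof.
by move=> mf fC mg gC; rewrite RintegralD//; exact: bounded_integrable.
Qed.

Lemma averageZ f C r : measurable_fun setT f -> (forall x, `|f x| <= C) ->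
  \int[P]_x (r * f x) = r * \int[P]_x f x.
Proof.
by move=> mf fC; rewrite RintegralZl//; exact: bounded_integrable.
Qed.

Lemma average_cst C : \int[P]_x C = C.
Proof. by rewrite Rintegral_cst//= [X in fine X](probability_setT P) mulr1. Qed.

Lemma average_le f g C : measurable_fun setT f -> (forall x, `|f x| <= C) ->
  measurable_fun setT g -> (forall x, `|g x| <= C) -> (forall x, f x <= g x) ->
  \int[P]_x f x <= \int[P]_x g x.
Proof.
by move=> mf fC mg gC fg; apply: le_Rintegral => //; exact: bounded_integrable.
Qed.

Lemma average_param_meas d1 (T1 : measurableType d1) (k : T1 * T -> R) C :
  measurable_fun setT k -> (forall p, `|k p| <= C) ->
  measurable_fun setT (fun x => \int[P]_w k (x, w)).
Proof.
move=> mk kC.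
have mkx x : measurable_fun setT (fun w => k (x, w)) by exact: (measurableT_comp mk (measurable_pair1 x)).
have E x : \int[P]_w k (x, w) = fine (\int[P]_w (k (x, w) + C)%:E)%E - C.
  rewrite -[fine _]/(\int[P]_w (k (x, w) + C)) (@averageD _ _ (Num.max C `|C|)) ?average_cst ?addrK//.
    by move=> w; rewrite le_max kC.
  by move=> w; rewrite le_max lexx orbT.
rewrite (_ : (fun x => _) = (fun x => fine (\int[P]_w (k (x, w) + C)%:E)%E - C)); last first.
  by apply/funext => x; exact: E.
apply: measurable_funB => //; apply: (measurableT_comp (f:= fine)); first exact: fine_measurable.
pose kC' := fun p : T1 * T => (k p + C)%:E.
apply: (measurable_fun_fubini_tonelli_F (m2 := P) kC').
  by apply/measurable_EFinP; exact: measurable_funD.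
by move=> p; rewrite lee_fin -lerBlDr sub0r; have := kC p; rewrite ler_norml => /andP[].
Qed.

End averages.

Lemma average_fubini (R : realType) d1 d2 (T1 : measurableType d1) (T2 : measurableType d2)
  (P1 : probability T1 R) (P2 : probability T2 R) (k : T1 * T2 -> R) (C : R) :
  measurable_fun setT k -> (forall p, `|k p| <= C) ->
  \int[P1]_x \int[P2]_y k (x, y) = \int[P2]_y \int[P1]_x k (x, y).
Proof.
move=> mk kC.
have ik : (P1 \x P2)%E.-integrable setT (EFin \o k).
  exact: (bounded_integrable (P1 \x P2)%E mk kC).
have := Fubini ik.
have E1 x : (\int[P2]_y (k (x, y))%:E)%E = (\int[P2]_y k (x, y))%:E.
  rewrite /Rintegral fineK//; apply: integrable_fin_num => //.
  apply: (bounded_integrable P2 _ (fun y => kC (x, y))).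
  exact: (measurableT_comp mk (measurable_pair1 x)).
have E2 y : (\int[P1]_x (k (x, y))%:E)%E = (\int[P1]_x k (x, y))%:E.
  rewrite /Rintegral fineK//; apply: integrable_fin_num => //.
  apply: (bounded_integrable P1 _ (fun x => kC (x, y))).
  exact: (measurableT_comp mk (measurable_pair2 y)).
rewrite /= /Rintegral => H; congr fine.
transitivity (\int[P1]_x \int[P2]_y (k (x, y))%:E)%E; first by apply: eq_integral => x _; rewrite E1.
by rewrite H; apply: eq_integral => y _; rewrite E2.
Qed.

Section boxes.
Context {R : realType}.
Local Notation mu := (@lebesgue_measure R).
Local Notation mR := (measurableTypeR R).
Variables (e : R) (e0 : 0 < e).

(** Averaging over translates by a uniform variable of [0, e] smooths in space, and
    commutes with every other average over translates. *)
Definition unif : probability mR R := uniform_prob e0.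

Lemma unif_integrable (h : R -> R) x : loc_bounded h ->
  unif.-integrable setT (EFin \o (fun v => h (x + v))).
Proof.
move=> lh.
have [mhx bhx] := @loc_bounded_shift R h 1 x lh.
have hE : (fun v => h (x + v)) = (fun y => h (1 * y + x)).
  by apply/funext => v; rewrite mul1r addrC.
rewrite hE; apply/integrableP; split; first exact/measurable_EFinP.
rewrite [X in (X < _)%E](integral_uniform e0); last first.
- by move=> v; exact: abse_ge0.
- by apply: measurableT_comp => //; exact/measurable_EFinP.
rewrite lte_mul_pinfty ?lee_fin ?invr_ge0 ?subr0 ?(ltW e0)//.
have /integrableP[_] := loc_bounded_itv 0 e (conj mhx bhx).
by [].
Qed.

Lemma unifE (h : R -> R) : loc_bounded h ->
  forall x, e * \int[unif]_v h (x + v) = prim h (x + e) - prim h x.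
Proof.
move=> lh x.
have mhx : measurable_fun setT (fun v => h (x + v)).
  by apply: (measurableT_comp lh.1); exact: measurable_funD.
have [] := @integral_density R unif (uniform_pdf 0 e) (fun v => h (x + v)).
- by move=> v; exact: uniform_pdf_ge0.
- exact: measurable_uniform_pdf.
- exact: integrable_uniform_pdf.
- by [].
- exact: unif_integrable.
move=> i1 ->; rewrite prim_shift ?(ltW e0)// -RintegralZl//.
rewrite [RHS]Rintegral_mkcond; apply: eq_Rintegral => v _.
rewrite patchE mem_setE in_itv/= /uniform_pdf subr0; case: ifP => _; last by rewrite !mulr0.
by rewrite mulrCA mulfV ?mulr1// gt_eqF.
Qed.

Lemma itv_shift (h : R -> R) (a b c : R) : loc_bounded h ->
  \int[mu]_(v in `[a, b]) h (v + c) = \int[mu]_(v in `[a + c, b + c]) h v.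
Proof.
move=> lh; rewrite Rintegral_mkcond [in RHS]Rintegral_mkcond.
have /integrable_mkcond := loc_bounded_itv (a + c) (b + c) lh.
rewrite restrict_EFin => /(_ (measurable_itv _)) ih.
have [_] := @lebesgue_affine R 1 c (h \_ `[a + c, b + c]) (oner_neq0 _) ih.
rewrite normr1 invr1 mul1r => <-.
apply: eq_Rintegral => y _; rewrite !patchE !mem_setE !in_itv/= mul1r.
by rewrite !lerD2r.
Qed.

Lemma itv_reflect (h : R -> R) (a b c : R) : loc_bounded h ->
  \int[mu]_(v in `[a, b]) h (c - v) = \int[mu]_(v in `[c - b, c - a]) h v.
Proof.
move=> lh; rewrite Rintegral_mkcond [in RHS]Rintegral_mkcond.
have /integrable_mkcond := loc_bounded_itv (c - b) (c - a) lh.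
rewrite restrict_EFin => /(_ (measurable_itv _)) ih.
have [|_] := @lebesgue_affine R (-1) c (h \_ `[c - b, c - a]) _ ih; first by rewrite oppr_eq0 oner_neq0.
rewrite normrN normr1 invr1 mul1r => <-.
apply: eq_Rintegral => y _; rewrite !patchE !mem_setE !in_itv/= mulN1r [- y + c]addrC.
by rewrite !lerD2l !lerN2 andbC.
Qed.

End boxes.

Section translates.
Context {R : realType}.
Local Notation mR := (measurableTypeR R).
Implicit Types (k kt : R -> R -> R) (C e t x : R).

Definition bmeas k C := measurable_fun setT (fun p : mR * mR => k p.1 p.2) /\
  forall t x, `|k t x| <= C.

(** Differentiability in time with an error uniform in all variables: unlike plain
    differentiability, it passes through averages over translates. *)
Definition tdiff k kt := forall e, 0 < e -> exists2 d : R, 0 < d &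
  forall t x (u : R), `|u| < d -> `|k (t + u) x - k t x - kt t x * u| <= e * `|u|.

Definition tcont k := forall e, 0 < e -> exists2 d : R, 0 < d &
  forall t x (u : R), `|u| < d -> `|k (t + u) x - k t x| <= e.

Lemma tdiff_tcont k kt C : (forall t x, `|kt t x| <= C) -> tdiff k kt -> tcont k.
Proof.
move=> ktC kd e e0.
have C0 : 0 <= C by apply: le_trans (ktC 0 0).
have C1 : 0 < 1 + C by rewrite ltr_wpDr.
have [d d0 D] := kd 1 ltr01.
exists (Num.min d (e / (1 + C))); first by rewrite lt_min d0 divr_gt0.
move=> t x u; rewrite lt_min ltr_pdivlMr// => /andP[ud ue].
have -> : k (t + u) x - k t x = (k (t + u) x - k t x - kt t x * u) + kt t x * u by ring.
apply: (le_trans (ler_normD _ _)); apply: (le_trans (lerD (D t x u ud) (lexx _))).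
apply: le_trans (ltW ue); rewrite mulrDr mulr1 mul1r lerD2l normrM mulrC.
by apply: ler_wpM2l.
Qed.

Lemma tdiff_derive k kt t x : tdiff k kt -> is_derive t (1 : R) (k^~ x) (kt t x).
Proof.
move=> kd; apply: is_derive_eps => e e0; have [d d0 D] := kd e e0.
by exists d => // u ud; exact: D.
Qed.

Lemma joint_continuous k : tcont k -> (forall t, continuous (k t)) ->
  continuous (fun p : R * R => k p.1 p.2).
Proof.
move=> tk xk [t x]; apply/cvgrPdist_le => e e0.
have e20 : 0 < e / 2 by rewrite divr_gt0.
have [d d0 D] := tk _ e20.
have /cvgrPdist_le /(_ _ e20) /nbhs_ballP[r /= r0 H] := xk t x.
exists (ball t d, ball x r) => /=; first by split; exact: nbhsx_ballx.
move=> [s y] /= [ts xy].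
have -> : k t x - k s y = (k t x - k t y) - (k (t + (s - t)) y - k t y) by rewrite [t + _]addrC subrK; ring.
rewrite (splitr e) (le_trans (ler_normB _ _))// lerD//; first exact: H.
by apply: D; rewrite distrC.
Qed.

Lemma bmeasx k C t : bmeas k C -> measurable_fun setT (k t : mR -> R).
Proof. by move=> [mk _]; exact: (measurableT_comp mk (measurable_pair1 (t : mR))). Qed.

Lemma bmeas_locx k C t : bmeas k C -> loc_bounded (k t).
Proof. by move=> kC; split; [exact: bmeasx kC|move=> N; exists C => y _; exact: kC.2]. Qed.

Lemma joint_meas_comp (G : R -> R -> R) d (T : measurableType d) (al be : T -> R) :
  measurable_fun setT (fun p : mR * mR => G p.1 p.2) ->
  measurable_fun setT al -> measurable_fun setT be ->
  measurable_fun setT (fun w => G (al w) (be w)).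
Proof.
move=> mG mal mbe.
apply: (@measurableT_comp _ _ _ _ _ _ _ _ (fun w => (al w, be w) : mR * mR) mG).
exact: measurable_fun_pair.
Qed.

Lemma bmeas_comp k C d (T : measurableType d) (al be : T -> R) : bmeas k C ->
  measurable_fun setT al -> measurable_fun setT be -> measurable_fun setT (fun w => k (al w) (be w)).
Proof. by move=> kC; exact: joint_meas_comp kC.1. Qed.

Lemma bmeas_shift k C t x : bmeas k C -> bmeas (fun s y => k (t - s) (x - y)) C.
Proof.
move=> kC; split => [|s y]; last exact: kC.2.
apply: (bmeas_comp kC); apply: measurable_funB => //.
Qed.

Lemma bmeasB k1 k2 C1 C2 : bmeas k1 C1 -> bmeas k2 C2 -> bmeas (fun t x => k1 t x - k2 t x) (C1 + C2).
Proof.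
move=> [m1 b1] [m2 b2]; split; first exact: measurable_funB.
by move=> t x; rewrite (le_trans (ler_normB _ _))// lerD.
Qed.

Lemma bmeasD k1 k2 C1 C2 : bmeas k1 C1 -> bmeas k2 C2 -> bmeas (fun t x => k1 t x + k2 t x) (C1 + C2).
Proof.
move=> [m1 b1] [m2 b2]; split; first exact: measurable_funD.
by move=> t x; rewrite (le_trans (ler_normD _ _))// lerD.
Qed.

Lemma bmeasM k1 k2 C1 C2 : bmeas k1 C1 -> bmeas k2 C2 -> bmeas (fun t x => k1 t x * k2 t x) (C1 * C2).
Proof.
move=> [m1 b1] [m2 b2]; split; first exact: measurable_funM.
by move=> t x; rewrite normrM ler_pM.
Qed.

Lemma bmeas_cst r : bmeas (fun _ _ => r) `|r|.
Proof. by split. Qed.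

Lemma bmeas_tr k C u v : bmeas k C -> bmeas (fun t x => k (t + u) (x + v)) C.
Proof.
move=> kC; split => [|s y]; last exact: kC.2.
apply: (bmeas_comp kC); apply: measurable_funD => //.
Qed.

Lemma bmeas_le k C C' : bmeas k C -> C <= C' -> bmeas k C'.
Proof. by move=> [mk kC] CC; split => // t x; exact: le_trans CC. Qed.

(** Averages over random translates in time and space; heat paths and uniform boxes
    are both of this form. *)
Section tavg.
Context d (T : measurableType d) (P : probability T R) (a b : T -> R).
Hypotheses (ma : measurable_fun setT a) (mb : measurable_fun setT b).

Definition tavg k t x := \int[P]_w k (t - a w) (x - b w).

Lemma tavg_slice k C t x : bmeas k C -> measurable_fun setT (fun w => k (t - a w) (x - b w)).
Proof. by move=> kC; apply: (bmeas_comp kC); apply: measurable_funB. Qed.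

Lemma tavg_bmeas k C : bmeas k C -> bmeas (tavg k) C.
Proof.
move=> kC; split; last first.
  by move=> t x; apply: normr_Rintegral_le => //; [exact: tavg_slice kC|move=> w; exact: kC.2].
apply: (@average_param_meas R _ T P _ (mR * mR)%type
  (fun q => k (q.1.1 - a q.2) (q.1.2 - b q.2)) C); last by move=> q; exact: kC.2.
apply: (bmeas_comp kC); apply: measurable_funB.
- by apply: measurableT_comp; [exact: measurable_fst|exact: measurable_fst].
- by apply: measurableT_comp => //; exact: measurable_snd.
- by apply: measurableT_comp; [exact: measurable_snd|exact: measurable_fst].
- by apply: measurableT_comp => //; exact: measurable_snd.
Qed.

Lemma tavgB k1 k2 C1 C2 t x : bmeas k1 C1 -> bmeas k2 C2 ->
  tavg (fun t x => k1 t x - k2 t x) t x = tavg k1 t x - tavg k2 t x.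
Proof.
move=> b1 b2; apply: (@averageB _ _ _ _ _ _ (Num.max C1 C2)).
- exact: tavg_slice b1.
- by move=> w; rewrite le_max b1.2.
- exact: tavg_slice b2.
- by move=> w; rewrite le_max b2.2 orbT.
Qed.

Lemma tavgD k1 k2 C1 C2 t x : bmeas k1 C1 -> bmeas k2 C2 ->
  tavg (fun t x => k1 t x + k2 t x) t x = tavg k1 t x + tavg k2 t x.
Proof.
move=> b1 b2; apply: (@averageD _ _ _ _ _ _ (Num.max C1 C2)).
- exact: tavg_slice b1.
- by move=> w; rewrite le_max b1.2.
- exact: tavg_slice b2.
- by move=> w; rewrite le_max b2.2 orbT.
Qed.

Lemma tavgZ r k C t x : bmeas k C -> tavg (fun t x => r * k t x) t x = r * tavg k t x.
Proof. by move=> kC; apply: (@averageZ _ _ _ _ _ C r (tavg_slice t x kC)) => w; exact: kC.2. Qed.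

Lemma tavg_le k1 k2 C1 C2 t x : bmeas k1 C1 -> bmeas k2 C2 ->
  (forall w, k1 (t - a w) (x - b w) <= k2 (t - a w) (x - b w)) -> tavg k1 t x <= tavg k2 t x.
Proof.
move=> b1 b2 H; apply: (@average_le _ _ _ _ _ _ (Num.max C1 C2)) => //.
- exact: tavg_slice b1.
- by move=> w; rewrite le_max b1.2.
- exact: tavg_slice b2.
- by move=> w; rewrite le_max b2.2 orbT.
Qed.

Lemma tavg_shift u v k t x : tavg (fun t x => k (t + u) (x + v)) t x = tavg k (t + u) (x + v).
Proof. by apply: eq_Rintegral => w _; rewrite [t - _ + _]addrAC [x - _ + _]addrAC. Qed.

Lemma tavg_bound k C : bmeas k C -> forall e, (forall t x, `|k t x| <= e) -> forall t x, `|tavg k t x| <= e.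
Proof. by move=> kC e ke; apply: (tavg_bmeas (conj kC.1 ke)).2. Qed.

Lemma tavg_tcont k C : bmeas k C -> tcont k -> tcont (tavg k).
Proof.
move=> kC kc e e0; have [r r0 H] := kc e e0; exists r => // t x u ur.
have ks := bmeas_tr u 0 kC.
have := tavg_shift u 0 k t x; rewrite addr0 => <-.
rewrite -(tavgB _ _ ks kC); apply: (tavg_bound (bmeasB ks kC)) => s y.
by rewrite addr0; exact: H.
Qed.

Lemma tavg_tdiff k kt C Ct : bmeas k C -> bmeas kt Ct -> tdiff k kt -> tdiff (tavg k) (tavg kt).
Proof.
move=> kC ktC kd e e0; have [r r0 H] := kd e e0; exists r => // t x u ur.
have ks := bmeas_tr u 0 kC.
have := tavg_shift u 0 k t x; rewrite addr0 => <-.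
rewrite [tavg kt t x * u]mulrC -(tavgB _ _ ks kC) -(tavgZ u t x ktC).
have b1 := bmeasB ks kC; have b2 := bmeasM (bmeas_cst u) ktC.
rewrite -(tavgB _ _ b1 b2); apply: (tavg_bound (bmeasB b1 b2)) => s y.
by rewrite addr0 [u * _]mulrC; exact: H.
Qed.

End tavg.

Lemma tavgC d1 (T1 : measurableType d1) (P1 : probability T1 R) (a1 b1 : T1 -> R)
  d2 (T2 : measurableType d2) (P2 : probability T2 R) (a2 b2 : T2 -> R) k C t x :
  measurable_fun setT a1 -> measurable_fun setT b1 ->
  measurable_fun setT a2 -> measurable_fun setT b2 -> bmeas k C ->
  tavg P1 a1 b1 (tavg P2 a2 b2 k) t x = tavg P2 a2 b2 (tavg P1 a1 b1 k) t x.
Proof.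
move=> ma1 mb1 ma2 mb2 kC.
transitivity (\int[P2]_w2 \int[P1]_w1 (k (t - a1 w1 - a2 w2) (x - b1 w1 - b2 w2))).
  apply: (@average_fubini R _ _ _ _ P1 P2
    (fun q => k (t - a1 q.1 - a2 q.2) (x - b1 q.1 - b2 q.2)) C); last by move=> q; exact: kC.2.
  have m1 (h : T1 -> R) : measurable_fun setT h -> measurable_fun setT (fun q : T1 * T2 => h q.1).
    by move=> mh; apply: measurableT_comp => //; exact: measurable_fst.
  have m2 (h : T2 -> R) : measurable_fun setT h -> measurable_fun setT (fun q : T1 * T2 => h q.2).
    by move=> mh; apply: measurableT_comp => //; exact: measurable_snd.
  apply: (bmeas_comp kC); (apply: measurable_funB; [apply: measurable_funB => //; exact: m1|exact: m2]).
apply: eq_Rintegral => w2 _; apply: eq_Rintegral => w1 _.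
by rewrite [t - _ - _]addrAC [x - _ - _]addrAC.
Qed.

End translates.

(** * The second difference of a heat average *)

Section box_averages.
Context {R : realType}.
Local Notation mu := (@lebesgue_measure R).
Variables (e : R) (e0 : 0 < e).

Definition box : (R -> R -> R) -> R -> R -> R := tavg (unif e0) (cst 0) (fun v => - v).

Lemma box_meas : measurable_fun setT (cst 0 : measurableTypeR R -> R) /\
  measurable_fun setT (fun v : measurableTypeR R => - v).
Proof. by split => //; exact: measurable_funN. Qed.

Lemma box_bmeas k C : bmeas k C -> bmeas (box k) C.
Proof. by have [ma mb] := box_meas; exact: tavg_bmeas. Qed.

Lemma box_tdiff k kt C Ct : bmeas k C -> bmeas kt Ct -> tdiff k kt -> tdiff (box k) (box kt).
Proof. have [ma mb] := box_meas; move=> b1 b2 kd; exact (tavg_tdiff (unif e0) ma mb b1 b2 kd). Qed.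

Lemma box_tcont k C : bmeas k C -> tcont k -> tcont (box k).
Proof. have [ma mb] := box_meas; move=> b1 kc; exact (tavg_tcont (unif e0) ma mb b1 kc). Qed.

Lemma boxE (k : R -> R -> R) C t x : bmeas k C ->
  box k t x = (prim (k t) (x + e) - prim (k t) x) / e.
Proof.
move=> kC; rewrite -(unifE e0 (bmeas_locx t kC)) mulrAC mulfV ?gt_eqF// mul1r.
by apply: eq_Rintegral => v _; rewrite subr0 opprK.
Qed.

Lemma box_cont (k : R -> R -> R) C t : bmeas k C -> continuous (box k t).
Proof.
move=> kC; rewrite (_ : box k t = fun x => (prim (k t) (x + e) - prim (k t) x) / e); last first.
  by apply/funext => x; exact: (boxE _ _ kC).
have cp := prim_cont (bmeas_locx t kC).
move=> x; apply: cvgM; last exact: cvg_cst.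
apply: cvgB; last exact: cp.
exact: continuous_translate.
Qed.

Lemma box_derive (k : R -> R -> R) C t x : bmeas k C -> continuous (k t) ->
  is_derive x (1 : R) (box k t) ((k t (x + e) - k t x) / e).
Proof.
move=> kC ck; rewrite (_ : box k t = fun x => (prim (k t) (x + e) - prim (k t) x) / e); last first.
  by apply/funext => y; exact: (boxE _ _ kC).
have lk := bmeas_locx t kC.
have d1 (y : R) : is_derive y (1 : R) (prim (k t)) (k t y) by apply: prim_is_derive => //; exact: ck.
have d2 : is_derive x (1 : R) (fun x => prim (k t) (x + e)) (k t (x + e)).
  exact: translate_derive.
apply: is_derive_eq (is_deriveM (is_deriveB d2 (d1 x)) (is_derive_cst e^-1 x 1)) _.
by rewrite scaler0 add0r [LHS]mulrC.
Qed.

End box_averages.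

Section second_difference.
Context {R : realType} (K : R) (K0 : 0 < K).
Local Notation mu := (@lebesgue_measure R).
Local Notation mR := (measurableTypeR R).
Local Notation avg := (tavg (walk K0) (@life R) (@Y R)).

Variables (h ht : R -> R -> R) (C : R).
Hypotheses (hC : bmeas h C) (htC : bmeas ht C) (hd : tdiff h ht) (hc : tcont ht).

(** The heat average of a source that is rough in space solves
    [K U + U_t - U_xx = K h] in the sense of second differences: [h] is smoothed in
    space by two boxes, the resolvent formula is applied to the smoothed function,
    whose second derivative is an exact second difference, and the boxes are
    commuted with the average. *)
Lemma heat_second_difference (e : R) (e0 : 0 < e) (t x : R) :
  avg h t (x + e + e) - 2 * avg h t (x + e) + avg h t x =
  e ^+ 2 * box e0 (box e0 (fun s y => K * avg h s y + avg ht s y - K * h s y)) t x.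
Proof.
pose B := box e0; pose m := B (B h); pose mt := B (B ht).
pose D2 s y := (h s (y + e + e) - 2 * h s (y + e) + h s y) / e ^+ 2.
have [ma mb] := box_meas (R := R).
have C0 : 0 <= C by apply: le_trans (hC.2 0 0).
have BhC := box_bmeas e0 hC; have mC := box_bmeas e0 BhC.
have BhtC := box_bmeas e0 htC; have mtC := box_bmeas e0 BhtC.
have dBh : tdiff (B h) (B ht) by exact (box_tdiff e0 hC htC hd).
have dm : tdiff m mt by exact (box_tdiff e0 BhC BhtC dBh).
have cmt : tcont mt by exact (box_tcont e0 BhtC (box_tcont e0 htC hc)).
have cBh : tcont (B h) by apply: tdiff_tcont BhtC.2 dBh.
have cm : tcont m by apply: tdiff_tcont mtC.2 dm.
have hsh (a : R) : bmeas (fun s y => h s (y + a)) C.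
  by have := bmeas_tr 0 a hC; congr bmeas; apply/funext => s; apply/funext => y; rewrite addr0.
have Bsh (a : R) : bmeas (fun s y => B h s (y + a)) C.
  by have := bmeas_tr 0 a BhC; congr bmeas; apply/funext => s; apply/funext => y; rewrite addr0.
have hshh : bmeas (fun s y => h s (y + e + e)) C.
  have := bmeas_tr 0 (e + e) hC; congr bmeas; apply/funext => s; apply/funext => y.
  by rewrite addr0 addrA.
pose mx s y := (B h s (y + e) - B h s y) * e^-1.
have mxC : bmeas mx ((C + C) * `|e^-1|) by apply: bmeasM (bmeasB (Bsh e) BhC) (bmeas_cst _).
have D2C : bmeas D2 ((C + `|2| * C + C) * `|(e ^+ 2)^-1|).
  apply: bmeasM (bmeas_cst _); apply: bmeasD hC; apply: bmeasB => //.
  exact: bmeasM (bmeas_cst 2) (hsh e).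
have xcB s : continuous (B h s) by exact: box_cont hC.
pose M := Num.max C (Num.max ((C + C) * `|e^-1|) ((C + `|2| * C + C) * `|(e ^+ 2)^-1|)).
have CM : C <= M by rewrite le_max lexx.
have refl (G : R -> R -> R) : continuous (fun p : R * R => G p.1 p.2) ->
    continuous (fun p : R * R => G (t - p.1) (x - p.2)).
  by move=> cG; apply: (continuous2_comp cG) => q; apply: cvgB;
    [exact: cvg_cst|exact: cvg_fst|exact: cvg_cst|exact: cvg_snd].
have cmx : continuous (fun p : R * R => mx p.1 p.2).
  apply: joint_continuous => [r r0|s].
    have [d d0 D] := cBh (r * e / 2) (divr_gt0 (mulr_gt0 r0 e0) (ltr0Sn _ _)).
    exists d => // s y u ud; rewrite /mx -mulrBl normrM normfV (gtr0_norm e0) ler_pdivrMr//.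
    have -> : B h (s + u) (y + e) - B h (s + u) y - (B h s (y + e) - B h s y) =
      (B h (s + u) (y + e) - B h s (y + e)) - (B h (s + u) y - B h s y) by ring.
    rewrite (le_trans (ler_normB _ _))//.
    by have := D s (y + e) u ud; have := D s y u ud; lra.
  move=> y; apply: cvgM; last exact: cvg_cst.
  apply: cvgB; last exact: xcB.
  by apply: continuous_translate; exact: xcB.
have := @heat_representation R K K0 (fun s y => m (t - s) (x - y))
  (fun s y => - mt (t - s) (x - y)) (fun s y => - mx (t - s) (x - y))
  (fun s y => D2 (t - s) (x - y)) M.
rewrite !subr0 => H.
have {H} : \int[walk K0]_w (K * m (t - life w) (x - Y w) - - mt (t - life w) (x - Y w)
    - D2 (t - life w) (x - Y w)) = K * m t x.
  apply: H.
  - by move=> s y; apply: (@reflect_derive R (m^~ (x - y))); exact: tdiff_derive.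
  - by move=> s y; apply: (@reflect_derive R (m (t - s))); exact: (box_derive e0 _ BhC).
  - apply: (refl m); apply: joint_continuous => // s; exact: box_cont BhC.
  - move=> p; apply: cvgN; apply: (refl mt); apply: joint_continuous => // s; exact: box_cont BhtC.
  - by move=> p; apply: cvgN; exact: (refl mx).
  - exact: (bmeas_shift t x mC).1.
  - by apply: measurable_funN; exact: (bmeas_shift t x mtC).1.
  - by apply: measurable_funN; exact: (bmeas_shift t x mxC).1.
  - exact: (bmeas_shift t x D2C).1.
  - move=> s a b s0 ab.
    have lh := bmeas_locx (t - s) hC.
    have lD := bmeas_locx (t - s) D2C.
    rewrite (itv_reflect a b x lD).
    set p := x - b; set q := x - a; set k := h (t - s).
    have pq : p <= q by rewrite /p /q lerD2l lerN2.
    have sh (r : R) : mu.-integrable `[p, q] (EFin \o (fun v => k (v + r))) /\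
        \int[mu]_(v in `[p, q]) k (v + r) = prim k (q + r) - prim k (p + r).
      split; last by rewrite itv_shift// prim_sub ?lerD2r.
      have := loc_bounded_shift 1 r lh; set k' := (fun y : R => _) => lk'.
      rewrite (_ : (fun v => k (v + r)) = k'); first exact: loc_bounded_itv.
      by apply/funext => v; rewrite /k' mul1r.
    have [i2 e2] := sh (e + e); have [i1 e1] := sh e; have [i0' e0'] := sh 0.
    have i1' : mu.-integrable `[p, q] (EFin \o (fun v => 2 * k (v + e))).
      by have := @integrableZl _ _ _ mu `[p, q] (measurable_itv _) 2 _ i1; exact.
    have i21 : mu.-integrable `[p, q] (EFin \o (fun v => k (v + (e + e)) - 2 * k (v + e))).
      by have := @integrableB _ _ _ mu `[p, q] (measurable_itv _) _ _ i2 i1'; exact.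
    have i210 : mu.-integrable `[p, q] (EFin \o (fun v => k (v + (e + e)) - 2 * k (v + e) + k (v + 0))).
      by have := @integrableD _ _ _ mu `[p, q] (measurable_itv _) _ _ i21 i0'; exact.
    transitivity (\int[mu]_(v in `[p, q]) ((e ^+ 2)^-1 * (k (v + (e + e)) - 2 * k (v + e) + k (v + 0)))).
      rewrite RintegralZl// RintegralD// RintegralB// RintegralZl// e2 e1 e0'.
      rewrite /mx /B !(boxE e0 _ _ hC) -/k !addr0 !addrA; field; exact: lt0r_neq0.
    by apply: eq_Rintegral => v _; rewrite /D2 addr0 addrA mulrC.
  - by move=> s y _; rewrite (le_trans (mC.2 _ _)).
  - by move=> s y _; rewrite normrN (le_trans (mtC.2 _ _)).
  - by move=> s y _; rewrite normrN (le_trans (mxC.2 _ _))// !le_max lexx orbT.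
  - by move=> s y _; rewrite (le_trans (D2C.2 _ _))// !le_max lexx !orbT.
move=> H.
have KmC := bmeasM (bmeas_cst K) mC.
have {H} : K * avg m t x + avg mt t x - avg D2 t x = K * m t x.
  rewrite -H -(tavgZ _ life_meas Y_meas K t x mC) -(tavgD _ life_meas Y_meas _ _ KmC mtC).
  rewrite -(tavgB _ life_meas Y_meas _ _ (bmeasD KmC mtC) D2C).
  by apply: eq_Rintegral => w _; rewrite opprK.
(* commuting the average with the boxes leaves an identity about [avg h] alone *)
have swap k : bmeas k C -> avg (B k) = B (avg k).
  move=> kC; apply/funext => s; apply/funext => y.
  by apply: tavgC kC => //; [exact: life_meas|exact: Y_meas].
have lin k1 k2 k3 : bmeas k1 C -> bmeas k2 C -> bmeas k3 C ->
    B (fun s y => K * k1 s y + k2 s y - K * k3 s y) = fun s y => K * B k1 s y + B k2 s y - K * B k3 s y.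
  move=> b1 b2 b3; apply/funext => s; apply/funext => y.
  have b1' := bmeasM (bmeas_cst K) b1; have b3' := bmeasM (bmeas_cst K) b3.
  by rewrite /B/box (tavgB _ ma mb _ _ (bmeasD b1' b2) b3') (tavgD _ ma mb _ _ b1' b2) !(tavgZ _ ma mb _ _ _ b1, tavgZ _ ma mb _ _ _ b3).
have ahC := tavg_bmeas (walk K0) life_meas Y_meas hC.
have ahtC := tavg_bmeas (walk K0) life_meas Y_meas htC.
have BahC := box_bmeas e0 ahC; have BahtC := box_bmeas e0 ahtC.
rewrite -/B lin// lin//.
rewrite /m swap// swap// /mt swap// swap//.
have -> : avg D2 t x = (avg h t (x + e + e) - 2 * avg h t (x + e) + avg h t x) / e ^+ 2.
  have hs1 := bmeasM (bmeas_cst 2) (hsh e).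
  have hs2 := bmeasB hshh hs1.
  have hs3 := bmeasD hs2 hC.
  rewrite /D2 [LHS](_ : _ = avg (fun s y => (e ^+ 2)^-1 * (h s (y + e + e) - 2 * h s (y + e) + h s y)) t x); last first.
    by apply: eq_Rintegral => w _; rewrite mulrC.
  rewrite (tavgZ _ life_meas Y_meas _ _ _ hs3) (tavgD _ life_meas Y_meas _ _ hs2 hC).
  rewrite (tavgB _ life_meas Y_meas _ _ hshh hs1) (tavgZ _ life_meas Y_meas _ _ _ (hsh e)) mulrC.
  congr ((_ - 2 * _ + _) / _).
    have := tavg_shift (walk K0) (@life R) (@Y R) 0 (e + e) h t x; rewrite addr0 addrA => <-.
    by apply: eq_Rintegral => w _; rewrite addr0 addrA.
  have := tavg_shift (walk K0) (@life R) (@Y R) 0 e h t x; rewrite addr0 => <-.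
  by apply: eq_Rintegral => w _; rewrite addr0.
move=> H.
set X := avg h t (x + e + e) - _ + _ in H *.
rewrite (_ : X = e ^+ 2 * (X / e ^+ 2)); last by field; exact: lt0r_neq0.
congr (_ * _).
by rewrite -H opprB addrC subrK.
Qed.

End second_difference.

(** * Regularity of bounded fixed points *)
Section fixed_points.
Context {R : realType} (K : R) (K0 : 0 < K).
Local Notation mu := (@lebesgue_measure R).
Local Notation mR := (measurableTypeR R).
Local Notation avg := (tavg (walk K0) (@life R) (@Y R)).

(** Long-lived paths gain regularity in time; the short-lived ones keep the modulus
    [om] of the source but carry the small mass [K * eta]. *)
Lemma avg_modulus (k : R -> R -> R) (C om eta d t x : R) : bmeas k C -> 0 < eta -> 0 <= d ->
  (forall s y, `|k (s + d) y - k s y| <= om) ->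
  `|avg k (t + d) x - avg k t x| <= om * (K * eta) + C * d * (2 / eta + K).
Proof.
move=> kC eta0 d0 kom.
have C0 : 0 <= C by apply: le_trans (kC.2 0 0).
have om0 : 0 <= om by apply: le_trans (kom 0 0).
pose r w := ramp eta (@life R w).
have mr : measurable_fun setT r by apply: measurableT_comp; [exact: ramp_meas|exact: life_meas].
have r01 w : 0 <= r w <= 1 by apply: ramp_itv => //; exact: life_ge0.
have r1 w : `|r w| <= 1 by have /andP[a b] := r01 w; rewrite ger0_norm.
have r1' w : `|1 - r w| <= 1 by have /andP[a b] := r01 w; rewrite ger0_norm; lra.
have mk s : measurable_fun setT (fun w => k (s - life w) (x - Y w)).
  exact: (tavg_slice (@life_meas R) (@Y_meas R) s x kC).
have mrk s : measurable_fun setT (fun w => r w * k (s - life w) (x - Y w)) by exact: measurable_funM.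
have mrk' s : measurable_fun setT (fun w => (1 - r w) * k (s - life w) (x - Y w)).
  by apply: measurable_funM => //; exact: measurable_funB.
have brk s w : `|r w * k (s - life w) (x - Y w)| <= C.
  by rewrite normrM (le_trans (ler_pM _ _ (r1 w) (kC.2 _ _)))// mul1r.
have brk' s w : `|(1 - r w) * k (s - life w) (x - Y w)| <= C.
  by rewrite normrM (le_trans (ler_pM _ _ (r1' w) (kC.2 _ _)))// mul1r.
have split_ s : avg k s x = \int[walk K0]_w ((1 - r w) * k (s - life w) (x - Y w)) +
    \int[walk K0]_w (r w * k (s - life w) (x - Y w)).
  rewrite -(averageD _ (mrk' s) (brk' s) (mrk s) (brk s)).
  by apply: eq_Rintegral => w _; ring.
rewrite (split_ t) (split_ (t + d)).
set a1 := Rintegral _ _ _; set b1 := Rintegral _ _ _; set a2 := Rintegral _ _ _; set b2 := Rintegral _ _ _.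
have -> : a1 + b1 - (a2 + b2) = (a1 - a2) + (b1 - b2) by ring.
apply: (le_trans (ler_normD _ _)); apply: lerD; last first.
  exact: (@ramp_time_lipschitz R K K0 (fun p => k p.1 p.2) C eta d t x eta0 d0 kC.1 (fun p => kC.2 _ _)).
rewrite /a1 /a2 -(averageB _ (mrk' _) (brk' _) (mrk' _) (brk' _)).
have m1r : measurable_fun setT (fun w => 1 - r w) by exact: measurable_funB.
have i1 : (walk K0).-integrable setT (EFin \o (fun w => 1 - r w)) by exact: (bounded_integrable (walk K0) m1r r1').
have i2 : (walk K0).-integrable setT (EFin \o (fun w =>
    (1 - r w) * k (t + d - life w) (x - Y w) - (1 - r w) * k (t - life w) (x - Y w))).
  apply: (@bounded_integrable _ _ _ _ _ (C + C)); first exact: measurable_funB.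
  by move=> w; rewrite (le_trans (ler_normB _ _))// lerD.
apply: (le_trans (le_normr_Rintegral measurableT i2)).
apply: (@le_trans _ _ (\int[walk K0]_w (om * (1 - r w)))).
  apply: le_Rintegral => //.
  - exact: integrable_norm.
  - by have := integrableZl measurableT om i1; exact.
  move=> w _; rewrite -mulrBr normrM mulrC; have /andP[a b] := r01 w.
  apply: ler_pM => //; last by rewrite ger0_norm// subr_ge0.
  by rewrite addrAC; exact: kom.
rewrite RintegralZl//; apply: ler_wpM2l => //.
exact: ramp_mass.
Qed.

Variables (n n' ga : R -> R) (L M B G : R) (u : R -> R -> R).
Hypotheses (L0 : 0 <= L) (M0 : 0 <= M) (G0 : 0 <= G).
Hypothesis nB : forall v, `|n v| <= B.
Hypothesis nL : forall v v' : R, `|n v' - n v| <= L * `|v' - v|.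
Hypothesis n'L : forall v, `|n' v| <= L.
Hypothesis n'M : forall v v' : R, `|n' v' - n' v| <= M * `|v' - v|.
Hypothesis nT : forall v v' : R, 0 <= v <= 1 -> 0 <= v' <= 1 ->
  `|n v' - n v - n' v * (v' - v)| <= M * `|v' - v| ^+ 2.
Hypothesis mga : measurable_fun setT (ga : mR -> R).
Hypothesis gaG : forall x, `|ga x| <= G.
Hypothesis mu_ : measurable_fun setT (fun p : mR * mR => u p.1 p.2).
Hypothesis u01 : forall t x, 0 <= u t x <= 1.

Let h t x := K * u t x + ga x * n (u t x).
Hypothesis fix_u : forall t x, K * u t x = avg h t x.

Let u1 : bmeas u 1.
Proof. by split => // t x; have /andP[a b] := u01 t x; rewrite ger0_norm. Qed.

Let ga_meas : bmeas (fun _ x => ga x) G.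
Proof. by split => //; apply: measurableT_comp => //; exact: measurable_snd. Qed.

Let nu_meas : bmeas (fun t x => n (u t x)) B.
Proof. by split => //; apply: (@measurableT_comp _ _ _ _ _ _ n) => //; by apply: continuous_measurable_fun; exact: lipschitz_continuous nL. Qed.

Let n'u_meas : bmeas (fun t x => n' (u t x)) L.
Proof. by split => //; apply: (@measurableT_comp _ _ _ _ _ _ n') => //; by apply: continuous_measurable_fun; exact: lipschitz_continuous n'M. Qed.

Let Ch := K + G * B.
Let h_meas : bmeas h Ch.
Proof.
have := bmeasD (bmeasM (bmeas_cst K) u1) (bmeasM ga_meas nu_meas).
by rewrite mulr1 gtr0_norm.
Qed.

Let G1 := K + G * L.
Let G10 : 0 < G1. Proof. by rewrite ltr_wpDr// mulr_ge0. Qed.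

Let h_lip s s' y : `|h s' y - h s y| <= G1 * `|u s' y - u s y|.
Proof.
have -> : h s' y - h s y = K * (u s' y - u s y) + ga y * (n (u s' y) - n (u s y)) by rewrite /h; ring.
rewrite (le_trans (ler_normD _ _))// mulrDl lerD//.
  by rewrite normrM (gtr0_norm K0).
by rewrite normrM -mulrA; apply: ler_pM.
Qed.

Let Lam := 2 * (Ch / K * (4 * G1 + K)).

Let Ch0 : 0 <= Ch. Proof. by apply: le_trans (h_meas.2 0 0). Qed.
Let Lam0 : 0 <= Lam.
Proof.
apply: mulr_ge0 => //; apply: mulr_ge0; first by rewrite divr_ge0// ltW.
by apply: addr_ge0; [apply: mulr_ge0 => //; exact: ltW|exact: ltW].
Qed.

(** For a fixed point the modulus of the source is a multiple of that of [u]. With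
    [eta] chosen so that it enters with weight 1/2 it is absorbed in the left-hand
    side, where it is finite since [u] takes values in [0, 1]. *)
Lemma fixed_point_time_lipschitz (d t x : R) : 0 <= d -> `|u (t + d) x - u t x| <= Lam * d.
Proof.
move=> d0; pose A := [set r | exists t x, r = `|u (t + d) x - u t x|].
have A1 : ubound A 1.
  move=> _ [s [y ->]]; have /andP[a b] := u01 s y; have /andP[a' b'] := u01 (s + d) y.
  by rewrite ler_norml; apply/andP; split; lra.
have hA : has_sup A by split; [exists `|u (0 + d) 0 - u 0 0|, 0, 0|exists 1].
have uA s y : `|u (s + d) y - u s y| <= sup A by apply: ub_le_sup; [exists 1|exists s, y].
have eta0 : 0 < (2 * G1)^-1 by rewrite invr_gt0 mulr_gt0.
suff H : sup A <= sup A / 2 + Lam / 2 * d by apply: (le_trans (uA t x)); lra.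
apply: ge_sup; first by exists `|u (0 + d) 0 - u 0 0|, 0, 0.
move=> _ [s [y ->]].
have := @avg_modulus h Ch (G1 * sup A) (2 * G1)^-1 d s y h_meas eta0 d0.
rewrite -!fix_u -mulrBr normrM (gtr0_norm K0) => H.
rewrite -(ler_pM2l K0); apply: le_trans (H _) _.
  by move=> s' y'; apply: (le_trans (h_lip _ _ _)); apply: ler_wpM2l (uA _ _); exact: ltW.
by rewrite /Lam le_eqVlt; apply/orP; left; apply/eqP; field; rewrite !gt_eqF.
Qed.

Let u_lip s s' y : `|u s y - u s' y| <= Lam * `|s - s'|.
Proof.
wlog ss : s s' / s' <= s.
  by move=> W; have [|/ltW] := leP s' s => H; [|rewrite distrC (distrC s)]; exact: W.
rewrite (ger0_norm (_ : 0 <= s - s')) ?subr_ge0//.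
by have := @fixed_point_time_lipschitz (s - s') s' y; rewrite subr_ge0 [s' + _]addrC subrK; apply.
Qed.

Let D d t x := dq (u^~ x) d t.

Let D_bound (d t x : R) : 0 < d -> `|D d t x| <= Lam.
Proof.
move=> d0; rewrite /D/dq normrM normfV (gtr0_norm d0) ler_pdivrMr//.
exact: fixed_point_time_lipschitz (ltW d0).
Qed.

Let Dh_meas (d : R) : 0 < d -> bmeas (fun s y => (h (s + d) y - h s y) * d^-1) (G1 * Lam).
Proof.
move=> d0; split.
  have hs := bmeas_tr d 0 h_meas.
  have := (bmeasM (bmeasB hs h_meas) (bmeas_cst d^-1)).1.
  by under eq_fun => p do rewrite addr0.
move=> s y; rewrite normrM normfV (gtr0_norm d0) ler_pdivrMr// -mulrA.
apply: (le_trans (h_lip _ _ _)); apply: ler_wpM2l; first exact: ltW.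
exact: fixed_point_time_lipschitz (ltW d0).
Qed.

Let D_avg (d t x : R) : 0 < d -> K * D d t x = avg (fun s y => (h (s + d) y - h s y) * d^-1) t x.
Proof.
move=> d0; have hs := bmeas_tr d 0 h_meas.
have hs' : bmeas (fun s y => h (s + d) y) Ch.
  by move: hs; congr bmeas; apply/funext => s; apply/funext => y; rewrite addr0.
transitivity (d^-1 * (avg h (t + d) x - avg h t x)).
  by rewrite -!fix_u /D/dq; ring.
have E : avg h (t + d) x = avg (fun s y => h (s + d) y) t x.
  by apply: eq_Rintegral => w _; rewrite addrAC.
rewrite E -(tavgB _ (@life_meas R) (@Y_meas R) t x hs' h_meas).
rewrite -(tavgZ _ (@life_meas R) (@Y_meas R) d^-1 t x (bmeasB hs' h_meas)).
by apply: eq_Rintegral => w _; rewrite mulrC.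
Qed.

(** The difference quotients of [u] are averages of those of the source, which are
    bounded, so they are equicontinuous uniformly in the step. *)
Let D_equi (e : R) : 0 < e -> exists2 r : R, 0 < r & forall d v t x : R, 0 < d -> 0 <= v <= r ->
  `|D d (t + v) x - D d t x| <= e.
Proof.
move=> e0; pose C2 := G1 * Lam.
have C20 : 0 <= C2 by rewrite mulr_ge0// ltW.
have C21 : 0 < C2 + 1 by rewrite ltr_wpDl.
(* short-lived paths then account for half of the error *)
pose eta := e / (4 * (C2 + 1)).
have eta0 : 0 < eta by rewrite divr_gt0// mulr_gt0.
have q0 : 0 < 2 / eta + K by rewrite addr_gt0// divr_gt0.
exists (K * e / 2 / ((C2 + 1) * (2 / eta + K))).
  by rewrite divr_gt0 ?mulr_gt0// invr_gt0.
move=> d v t x d0 /andP[v0 vr].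
have := @avg_modulus _ C2 (2 * C2) eta v t x (Dh_meas d0) eta0 v0.
rewrite -!D_avg// -mulrBr normrM (gtr0_norm K0) => H.
rewrite -(ler_pM2l K0); apply: le_trans (H _) _.
  move=> s y; rewrite (le_trans (ler_normB _ _))//.
  rewrite (_ : 2 * C2 = C2 + C2); last by ring.
  by apply: lerD; [exact: (Dh_meas d0).2|exact: (Dh_meas d0).2].
have A1 : 2 * C2 * (K * eta) <= K * e / 2.
  have -> : K * e / 2 = 2 * (C2 + 1) * (K * eta) by rewrite /eta; field; exact: lt0r_neq0.
  apply: ler_wpM2r; first by rewrite mulr_ge0// ltW.
  by apply: ler_wpM2l => //; rewrite lerDl.
have A2 : C2 * v * (2 / eta + K) <= K * e / 2.
  rewrite ler_pdivlMr in vr; last exact: mulr_gt0.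
  apply: le_trans vr; rewrite -mulrA mulrCA; apply: ler_wpM2l => //.
  by apply: ler_wpM2r; [exact: ltW|rewrite lerDl].
have -> : K * e = K * e / 2 + K * e / 2 by field.
exact: lerD.
Qed.

Let D_cauchy (e : R) : 0 < e -> exists2 r : R, 0 < r & forall d1 d2 t x : R, 0 < d1 <= r -> 0 < d2 <= r ->
  `|D d1 t x - D d2 t x| <= e.
Proof.
move=> e0; have e20 : 0 < e / 2 by rewrite divr_gt0.
have [r r0 H] := D_equi e20; exists r => // d1 d2 t x h1 h2.
have -> : e = 2 * (e / 2) by field.
apply: (@dq_cauchy R (u^~ x) Lam r (e / 2) t Lam0 _ _ d1 d2 h1 h2).
  by move=> s s'; exact: u_lip.
move=> dd s dd0 /andP[ts sr].
have := H dd (s - t) t x dd0; rewrite [t + _]addrC subrK; apply.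
by rewrite subr_ge0 ts/= lerBlDl.
Qed.

Let dn (i : nat) : R := i.+1%:R^-1.
Let dn0 i : 0 < dn i. Proof. by rewrite invr_gt0. Qed.
Let dn_small (r : R) : 0 < r -> \forall i \near \oo, 0 < dn i <= r.
Proof.
move=> r0; near=> i; rewrite dn0/= /dn invf_ple ?posrE//.
rewrite (@le_trans _ _ i%:R)// ?ler_nat//; near: i; exact: nbhs_infty_ger.
Unshelve. all: by end_near. Qed.

Let ut t x := lim (D (dn i) t x @[i --> \oo]).

Let D_cvg t x : D (dn i) t x @[i --> \oo] --> ut t x.
Proof.
apply/cauchy_cvgP/cauchy_ballP => e e0.
have e20 : 0 < e / 2 by rewrite divr_gt0.
have [r r0 H] := D_cauchy e20.
have N := dn_small r0.
exists ([set y | exists2 i, 0 < dn i <= r & y = D (dn i) t x],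
        [set y | exists2 i, 0 < dn i <= r & y = D (dn i) t x]) => /=.
  by split; move: N; apply: filterS => i Ni /=; exists i.
move=> [_ _] /= [[i i1 ->] [j j1 ->]]; rewrite /ball/= (le_lt_trans (H _ _ t x i1 j1))//.
by rewrite ltr_pdivrMr// ltr_pMr// ltr1n.
Unshelve. all: by end_near. Qed.

Let D_unif (e : R) : 0 < e -> exists2 r : R, 0 < r & forall d t x : R, 0 < d <= r -> `|D d t x - ut t x| <= e.
Proof.
move=> e0; have [r r0 H] := D_cauchy e0; exists r => // d t x dr.
have cv : `|D d t x - D (dn i) t x| @[i --> \oo] --> `|D d t x - ut t x|.
  by apply: cvg_norm; apply: cvgB; [exact: cvg_cst|exact: D_cvg].
rewrite -(cvg_lim _ cv)//; apply: limr_le; first by apply/cvg_ex; eexists; exact: cv.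
by near=> i; apply: H => //; near: i; exact: dn_small.
Unshelve. all: by end_near. Qed.

Let ut_meas : bmeas ut Lam.
Proof.
split.
  apply: (@measurable_fun_cvg _ _ _ setT (fun i (p : mR * mR) => D (dn i) p.1 p.2)).
  - move=> i; have us := bmeas_tr (dn i) 0 u1.
    have := (bmeasM (bmeasB us u1) (bmeas_cst (dn i)^-1)).1.
    by under eq_fun => p do rewrite addr0.
  - by move=> p _; exact: D_cvg.
move=> t x; have cv : `|D (dn i) t x| @[i --> \oo] --> `|ut t x| by apply: cvg_norm; exact: D_cvg.
rewrite -(cvg_lim _ cv)//; apply: limr_le; first by apply/cvg_ex; eexists; exact: cv.
by near=> i; exact: D_bound.
Unshelve. all: by end_near. Qed.

Let ut_cont : tcont ut.
Proof.
move=> e e0; have [r r0 H] := D_equi e0.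
have P (v t x : R) : 0 <= v <= r -> `|ut (t + v) x - ut t x| <= e.
  move=> vr.
  have cv : `|D (dn i) (t + v) x - D (dn i) t x| @[i --> \oo] --> `|ut (t + v) x - ut t x|.
    by apply: cvg_norm; apply: cvgB; exact: D_cvg.
  rewrite -(cvg_lim _ cv)//; apply: limr_le; first by apply/cvg_ex; eexists; exact: cv.
  by near=> i; exact: H.
exists r => // t x v vr; have [v0|v0] := leP 0 v.
  by apply: P; rewrite v0/= ltW// (le_lt_trans _ vr)// ler_norm.
have := P (- v) (t + v) x; rewrite addrK distrC; apply.
by rewrite oppr_ge0 (ltW v0)/= -(ltr0_norm v0) ltW.
Unshelve. all: by end_near. Qed.

Let u_diff : tdiff u ut.
Proof.
move=> e e0; have e20 : 0 < e / 2 by rewrite divr_gt0.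
have [r r0 H] := D_unif e20; have [q q0 Q] := ut_cont e20.
have P (v t x : R) : 0 < v <= r -> `|u (t + v) x - u t x - ut t x * v| <= e / 2 * v.
  move=> /andP[v0 vr]; have := H v t x; rewrite v0 vr => /(_ isT) I.
  have -> : u (t + v) x - u t x - ut t x * v = (D v t x - ut t x) * v.
    by rewrite /D/dq; field; rewrite gt_eqF.
  by rewrite normrM (gtr0_norm v0); apply: ler_wpM2r => //; exact: ltW.
exists (Num.min r q); first by rewrite lt_min r0.
move=> t x v; rewrite lt_min => /andP[vr vq].
have [v0|v0|->] := ltgtP v 0; last by rewrite addr0 subrr mulr0 subr0 !normr0 mulr0.
  have vn := ltr0_norm v0.
  have := P (- v) (t + v) x; rewrite addrK oppr_gt0 v0 -vn (ltW vr) => /(_ isT) I.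
  have J := Q t x v vq.
  have -> : u (t + v) x - u t x - ut t x * v =
     - (u t x - u (t + v) x - ut (t + v) x * `|v|) + (ut (t + v) x - ut t x) * v.
    by rewrite vn; ring.
  apply: (le_trans (ler_normD _ _)); rewrite normrN.
  rewrite [X in _ <= X](_ : _ = e / 2 * `|v| + e / 2 * `|v|); last by field.
  by apply: lerD => //; rewrite normrM; exact: ler_wpM2r.
have vn := gtr0_norm v0; have := P v t x; rewrite v0 -vn (ltW vr) vn => /(_ isT) I.
apply: (le_trans I); rewrite vn; apply: ler_wpM2r; first exact: ltW.
by rewrite ler_pdivrMr// ler_peMr ?ler1n// ltW.
Qed.

Let ht t x := K * ut t x + ga x * (n' (u t x) * ut t x).

Let ht_meas : bmeas ht (G1 * Lam).
Proof.
have := bmeasD (bmeasM (bmeas_cst K) ut_meas) (bmeasM ga_meas (bmeasM n'u_meas ut_meas)).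
by rewrite (gtr0_norm K0) mulrA -mulrDl.
Qed.

(** The source is differentiable in time by the Taylor bound on [n]; its spatial
    roughness, which comes from [ga], does not interfere. *)
Let h_diff : tdiff h ht.
Proof.
move=> e e0; have e1 : 0 < e / (2 * G1) by rewrite divr_gt0// mulr_gt0.
have [r r0 H] := u_diff e1.
pose Q := G * (M * Lam ^+ 2); have Q0 : 0 <= Q by rewrite mulr_ge0// mulr_ge0// exprn_ge0.
have Q1 : 0 < Q + 1 by rewrite ltr_wpDl.
exists (Num.min r (e / 2 / (Q + 1))); first by rewrite lt_min r0 divr_gt0// divr_gt0.
move=> t x v; rewrite lt_min => /andP[vr]; rewrite ltr_pdivlMr// => ve.
have I := H t x v vr.
have J : `|n (u (t + v) x) - n (u t x) - n' (u t x) * (u (t + v) x - u t x)| <= M * Lam ^+ 2 * (`|v| * `|v|).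
  apply: (le_trans (nT (u01 _ _) (u01 _ _))); rewrite -mulrA; apply: ler_wpM2l => //.
  rewrite -expr2 -exprMn lerXn2r ?nnegrE ?(mulr_ge0 Lam0 (normr_ge0 _))//.
  by have := u_lip (t + v) t x; rewrite addrAC subrr add0r.
set E1 := u (t + v) x - u t x - ut t x * v in I; set E2 := n _ - _ - _ in J.
have -> : h (t + v) x - h t x - ht t x * v = (K + ga x * n' (u t x)) * E1 + ga x * E2.
  by rewrite /E1 /E2 /h /ht; ring.
have A1 : `|(K + ga x * n' (u t x)) * E1| <= e / 2 * `|v|.
  rewrite normrM.
  have -> : e / 2 * `|v| = G1 * (e / (2 * G1) * `|v|) by field; rewrite gt_eqF.
  apply: ler_pM => //; apply: (le_trans (ler_normD _ _)); rewrite (gtr0_norm K0) lerD2l normrM.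
  exact: ler_pM.
have A2 : `|ga x * E2| <= e / 2 * `|v|.
  rewrite normrM; apply: (le_trans (ler_pM _ _ (gaG x) J)) => //.
  rewrite [X in X <= _](_ : _ = Q * `|v| * `|v|); last by rewrite /Q; ring.
  apply: ler_wpM2r => //; apply: le_trans (ltW ve); rewrite mulrC; apply: ler_wpM2l => //.
  by rewrite lerDl.
apply: (le_trans (ler_normD _ _)).
rewrite [X in _ <= X](_ : _ = e / 2 * `|v| + e / 2 * `|v|); last by field.
exact: lerD.
Qed.

Let ht_cont : tcont ht.
Proof.
move=> e e0; have [r r0 H] := ut_cont (divr_gt0 e0 (mulr_gt0 (ltr0Sn R 1) G10)).
pose Q := G * (M * Lam * Lam); have Q0 : 0 <= Q by rewrite mulr_ge0// mulr_ge0// mulr_ge0.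
have Q1 : 0 < Q + 1 by rewrite ltr_wpDl.
exists (Num.min r (e / 2 / (Q + 1))); first by rewrite lt_min r0 divr_gt0// divr_gt0.
move=> t x v; rewrite lt_min => /andP[vr]; rewrite ltr_pdivlMr// => ve.
have I := H t x v vr.
have -> : ht (t + v) x - ht t x = (K + ga x * n' (u t x)) * (ut (t + v) x - ut t x) +
   ga x * ((n' (u (t + v) x) - n' (u t x)) * ut (t + v) x) by rewrite /ht; ring.
apply: (le_trans (ler_normD _ _)); rewrite (splitr e); apply: lerD.
  rewrite normrM (_ : e / 2 = G1 * (e / (2 * G1))); last by field; rewrite gt_eqF.
  apply: ler_pM => //; apply: (le_trans (ler_normD _ _)); rewrite (gtr0_norm K0) lerD2l normrM.
  exact: ler_pM.
apply: (@le_trans _ _ (Q * `|v|)).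
  rewrite !normrM (_ : Q * `|v| = G * ((M * (Lam * `|v|)) * Lam)); last by rewrite /Q; ring.
  apply: ler_pM => //.
  apply: ler_pM => //; last exact: ut_meas.2.
  apply: (le_trans (n'M _ _)); apply: ler_wpM2l => //.
  by have := u_lip (t + v) t x; rewrite addrAC subrr add0r.
by apply: le_trans (ltW ve); rewrite mulrC; apply: ler_wpM2l => //; rewrite lerDl.
Qed.

Let ut_avg t x : K * ut t x = avg ht t x.
Proof.
have d1 := tdiff_derive t x (tavg_tdiff (walk K0) (@life_meas R) (@Y_meas R) h_meas ht_meas h_diff).
have d2 : is_derive t (1 : R) (fun s => K * u s x) (K * ut t x).
  exact: is_derive_scale (tdiff_derive t x u_diff).
rewrite -(@derive_val _ _ _ _ _ _ _ d1) -(@derive_val _ _ _ _ _ _ _ d2); congr ('D_1 _ t).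
by apply/funext => s; exact: fix_u.
Qed.

Let p t x := ut t x - ga x * n (u t x).
Let p_meas : bmeas p (Lam + G * B).
Proof. by apply: bmeasB => //; apply: bmeasM ga_meas nu_meas. Qed.

Let u_D2 (t x e : R) (e0 : 0 < e) : u t (x + e + e) - 2 * u t (x + e) + u t x =
  e ^+ 2 * box e0 (box e0 p) t x.
Proof.
have hM : bmeas h (Num.max Ch (G1 * Lam)) by apply: bmeas_le h_meas _; rewrite le_max lexx.
have htM : bmeas ht (Num.max Ch (G1 * Lam)) by apply: bmeas_le ht_meas _; rewrite le_max lexx orbT.
have := heat_second_difference K0 hM htM h_diff ht_cont e0 t x.
rewrite -!fix_u.
rewrite (_ : (fun _ _ => _) = fun s y => K * p s y); last first.
  by apply/funext => s; apply/funext => y; rewrite -fix_u -ut_avg /p /h; ring.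
have [ma mb] := box_meas (R := R).
have -> : box e0 (fun s y => K * p s y) = fun s y => K * box e0 p s y.
  apply/funext => s; apply/funext => y; exact: (tavgZ (unif e0) ma mb K s y p_meas).
rewrite [box e0 (fun _ _ => _) t x](tavgZ (unif e0) ma mb K t x (box_bmeas e0 p_meas)) -/(box e0) => H.
apply: (mulfI (lt0r_neq0 K0)); rewrite [RHS]mulrCA -H; ring.
Qed.

Let PP t := prim (prim (p t)).
Let lp t : loc_bounded (p t). Proof. exact: bmeas_locx p_meas. Qed.
Let cpp t : continuous (prim (p t)). Proof. exact: prim_cont. Qed.
Let lpp t : loc_bounded (prim (p t)). Proof. exact: cont_loc_bounded. Qed.
Let cPP t : continuous (PP t). Proof. exact: prim_cont. Qed.

Let PP_D2 (t x e : R) (e0 : 0 < e) : PP t (x + e + e) - 2 * PP t (x + e) + PP t x =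
  e ^+ 2 * box e0 (box e0 p) t x.
Proof.
have E1 (y : R) : PP t (y + e) - PP t y = e * \int[unif e0]_v prim (p t) (y + v) by rewrite unifE.
have -> : PP t (x + e + e) - 2 * PP t (x + e) + PP t x =
  (PP t (x + e + e) - PP t (x + e)) - (PP t (x + e) - PP t x) by ring.
rewrite !E1 -mulrBr -RintegralB//; [|exact: unif_integrable|exact: unif_integrable].
rewrite expr2 -mulrA; congr (_ * _).
have [ma mb] := box_meas (R := R).
rewrite -(tavgZ (unif e0) ma mb e t x (box_bmeas e0 p_meas)).
apply: eq_Rintegral => v _.
rewrite subr0 opprK (boxE e0 _ _ p_meas) mulrCA mulfV ?gt_eqF// mulr1.
by rewrite [x + e + v]addrAC.
Qed.

Let u_loc t : loc_bounded (u t). Proof. exact: bmeas_locx u1. Qed.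

(** [u t] and the double primitive of [p t] have the same second differences, so
    they differ by an affine function; hence [u t] is as smooth as a double
    primitive of a bounded function. *)
Let u_repr t : exists A, exists B', forall x, u t x = PP t x + (A * x + B').
Proof.
have [||A [B' AB]] := @jensen_affine R (fun x => u t x - PP t x).
- split; first by apply: measurable_funB; [exact: (u_loc t).1|exact: (cont_loc_bounded (@cPP t)).1].
  move=> N; have [C hC] := (cont_loc_bounded (@cPP t)).2 N; exists (1 + C) => y yN.
  by rewrite (le_trans (ler_normB _ _))// lerD ?u1.2// hC.
- move=> x e e0; have := u_D2 t (x - e) e0; have := PP_D2 t (x - e) e0; rewrite !subrK => H1 H2.
  have : u t (x + e) - 2 * u t x + u t (x - e) = PP t (x + e) - 2 * PP t x + PP t (x - e) by rewrite H1 H2.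
  lra.
by exists A, B' => x; rewrite -AB addrC subrK.
Qed.

Lemma uniform_limit_continuous (k : R * R -> R) :
  (forall e : R, 0 < e -> exists2 k' : R * R -> R, continuous k' & forall q, `|k q - k' q| <= e) ->
  continuous k.
Proof.
move=> H q; apply/cvgrPdist_le => e e0.
have e30 : 0 < e / 3 by rewrite divr_gt0.
have [k' ck' kk'] := H _ e30.
have /cvgrPdist_le /(_ _ e30) := ck' q.
apply: filterS => q' kq.
have -> : k q - k q' = (k q - k' q) + (k' q - k' q') - (k q' - k' q') by ring.
apply: (le_trans (ler_normB _ _)).
have := ler_normD (k q - k' q) (k' q - k' q'); have := kk' q; have := kk' q'; lra.
Qed.

(** The slope is obtained for each [t] separately; its joint continuity follows as it
    is a uniform limit of spatial difference quotients. *)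
Theorem fixed_point_regularity : continuous (fun q : R * R => u q.1 q.2) /\
  exists vt vx : R -> R -> R,
  [/\ forall t x, is_derive t (1 : R) (u^~ x) (vt t x),
      forall t x, is_derive x (1 : R) (u t) (vx t x),
      continuous (fun q : R * R => vt q.1 q.2) /\ continuous (fun q : R * R => vx q.1 q.2),
      forall t x y, `|vx t x - vx t y| <= (Lam + G * B) * `|x - y| &
      forall t, {ae mu, forall x, derivable (vx t) x 1 /\
         vt t x - (vx t)^`()%classic x = ga x * n (u t x)}].
Proof.
have cu : continuous (fun q : R * R => u q.1 q.2).
  apply: joint_continuous; first exact: tdiff_tcont ut_meas.2 u_diff.
  move=> t; have [A [B' AB]] := u_repr t.
  rewrite (_ : u t = fun x => PP t x + (A * x + B')); last by apply/funext.
  move=> x; apply: cvgD; first exact: cPP.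
  by apply: cvgD; [apply: cvgM; [exact: cvg_cst|exact: cvg_id]|exact: cvg_cst].
split => //.
have /choice[A HA] : forall t, exists A, exists B', forall x, u t x = PP t x + (A * x + B').
  by move=> t; exact: u_repr.
pose vx t x := prim (p t) x + A t.
have cshift (a b : R) : continuous (fun q : R * R => u (q.1 + a) (q.2 + b)).
  by apply: (continuous2_comp cu) => q; apply: cvgD;
    [exact: cvg_fst|exact: cvg_cst|exact: cvg_snd|exact: cvg_cst].
have vx_lip t x y : `|vx t x - vx t y| <= (Lam + G * B) * `|x - y|.
  rewrite /vx opprD addrACA subrr addr0; apply: prim_lipschitz => // z _; exact: p_meas.2.
have dvx t x : is_derive x (1 : R) (u t) (vx t x).
  have [B' AB] := HA t.
  rewrite (_ : u t = fun x => PP t x + (A t * x + B')); last by apply/funext.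
  have d1 : is_derive x (1 : R) (PP t) (prim (p t) x) by apply: prim_is_derive => //; exact: cpp.
  apply: is_derive_eq (is_deriveD d1 (is_deriveD (is_derive_lin (A t) x) (is_derive_cst B' x 1))) _.
  by rewrite addr0.
exists ut, vx; split => //.
- by move=> t x; exact: tdiff_derive u_diff.
- split; apply: uniform_limit_continuous => e e0.
    have [r r0 H] := D_unif e0.
    exists (fun q => (u (q.1 + r) (q.2 + 0) - u (q.1 + 0) (q.2 + 0)) * r^-1); last first.
      move=> q; rewrite distrC !addr0; apply: (H r q.1 q.2); rewrite r0/=; exact: lexx.
    move=> q; apply: cvgM; last exact: cvg_cst.
    by apply: cvgB; exact: cshift.
  pose N := Lam + G * B.
  have N0 : 0 <= N by apply: le_trans (p_meas.2 0 0).
  have N1 : 0 < N + 1 by rewrite ltr_wpDl.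
  pose r := e / (N + 1); have r0 : 0 < r by rewrite divr_gt0.
  exists (fun q => (u (q.1 + 0) (q.2 + r) - u (q.1 + 0) (q.2 + 0)) * r^-1).
    move=> q; apply: cvgM; last exact: cvg_cst.
    by apply: cvgB; exact: cshift.
  move=> [t x] /=; rewrite !addr0.
  have xr : x <= x + r by rewrite lerDl ltW.
  have cut : continuous (u t).
    by move=> y; apply: differentiable_continuous; apply/derivable1_diffP; exact: ex_derive.
  have [z] := MVT_segment xr (fun y _ => dvx t y) (continuous_subspaceT cut).
  rewrite in_itv/= => /andP[xz zr] ->.
  rewrite [x + r - x]addrAC subrr add0r mulfK ?gt_eqF//.
  apply: (le_trans (vx_lip _ _ _)); rewrite ler0_norm ?subr_le0// opprB.
  apply: (@le_trans _ _ ((N + 1) * r)).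
    by apply: ler_pM; rewrite ?subr_ge0 ?lerBlDl// lerDl.
  by rewrite /r mulrC divfK// gt_eqF.
move=> t; apply: filterS (prim_ae (lp t)); first exact: (ae_filter_ringOfSetsType mu).
move=> x [d1 d2].
have dvxx : is_derive x (1 : R) (vx t) (p t x).
  have d3 : is_derive x (1 : R) (prim (p t)) (p t x).
    by apply: DeriveDef; [exact: d1|rewrite -derive1E; exact: d2].
  by apply: is_derive_eq (is_deriveD d3 (is_derive_cst (A t) x 1)) _; rewrite addr0.
split; first exact: ex_derive.
by rewrite derive1E (@derive_val _ _ _ _ _ _ _ dvxx) /p; ring.
Qed.

End fixed_points.

(** * The nonlinearity *)

Section one_sided_calculus.
Context {R : realType}.

Lemma derivable_within_eps (f : R -> R) (x : R) : derivable_within `[0, 1] f x ->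
  forall e, 0 < e -> exists2 d : R, 0 < d & forall y, 0 <= y <= 1 -> `|y - x| < d ->
    `|f y - f x - derive_within `[0, 1] f x * (y - x)| <= e * `|y - x|.
Proof.
move=> /cvgrPdist_le D e e0; have := D e e0; rewrite /= !near_withinE; move=> /nbhs_ballP[d /= d0 H]; exists d => // y y01 yx.
have [->|yx0] := eqVneq y x; first by rewrite !subrr mulr0 subr0 normr0 mulr0.
have := H y; rewrite /ball/= distrC => /(_ yx yx0); rewrite in_itv/= => /(_ y01).
rewrite -[lim _]/(derive_within `[0, 1] f x) => I.
have -> : f y - f x - derive_within `[0, 1] f x * (y - x) =
  - ((derive_within `[0, 1] f x - (f y - f x) / (y - x)) * (y - x)).
  by field; rewrite subr_eq0.
by rewrite normrN normrM; apply: ler_wpM2r.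
Qed.

Lemma derivable_within_cont (f : R -> R) :
  (forall x, `[0, 1]%classic x -> derivable_within `[0, 1] f x) ->
  {within `[0, 1], continuous f}.
Proof.
move=> D; apply/subspace_continuousP => x x01; apply/cvgrPdist_le => e e0.
have [d d0 H] := derivable_within_eps (D x x01) ltr01.
set l := derive_within _ f x in H.
have l1 : 0 < 1 + `|l| by rewrite ltr_wpDr.
rewrite near_withinE; apply/nbhs_ballP; exists (Num.min d (e / (1 + `|l|))) => /=.
  by rewrite lt_min d0 divr_gt0.
move=> y; rewrite /ball/= distrC lt_min => /andP[yd]; rewrite ltr_pdivlMr// => ye.
rewrite in_itv/= => y01; rewrite distrC.
have -> : f y - f x = (f y - f x - l * (y - x)) + l * (y - x) by ring.
apply: (le_trans (ler_normD _ _)); rewrite normrM.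
by have := H y y01 yd; lra.
Qed.

Lemma derivable_within_mvt (f : R -> R) (a b : R) :
  (forall x, `[0, 1]%classic x -> derivable_within `[0, 1] f x) ->
  0 <= a -> a <= b -> b <= 1 -> exists2 z, a <= z <= b & f b - f a = derive_within `[0, 1] f z * (b - a).
Proof.
move=> D a0 ab b1.
have dI (z : R) : z \in `]a, b[%R -> is_derive z (1 : R) f (derive_within `[0, 1] f z).
  rewrite in_itv/= => /andP[az zb]; apply: is_derive_eps => e e0.
  have z01 : `[0, 1]%classic z by rewrite /= in_itv/=; apply/andP; split; lra.
  have [d d0 H] := derivable_within_eps (D z z01) e0.
  exists (Num.min d (Num.min (z - a) (b - z))); first by rewrite !lt_min d0 !subr_gt0 az zb.
  move=> h; rewrite !lt_min => /and3P[hd h1 h2].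
  have := H (z + h); rewrite [z + h - z]addrAC subrr add0r; apply => //.
  have := ler_norm h; have := ler_norm (- h); rewrite normrN => h3 h4; apply/andP; split; lra.
have cf : {within `[a, b], continuous f}.
  apply: continuous_subspaceW (derivable_within_cont D) => y /=; rewrite !in_itv/= => /andP[h1 h2].
  by apply/andP; split; lra.
have [z] := MVT_segment ab dI cf.
by rewrite in_itv/= => zab E; exists z.
Qed.

Definition clamp (v : R) : R := Num.max 0 (Num.min v 1).

Lemma clamp01 v : 0 <= clamp v <= 1.
Proof. by rewrite /clamp le_max lexx/= ge_max ler01/= ge_min lexx orbT. Qed.

Lemma clamp_id v : 0 <= v <= 1 -> clamp v = v.
Proof. by move=> /andP[v0 v1]; rewrite /clamp min_l// max_r. Qed.

Lemma clamp_le v v' : v <= v' -> clamp v <= clamp v'.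
Proof.
move=> vv; rewrite /clamp ge_max le_max lexx/= le_max le_min !ge_min vv !lexx !orbT//=.
Qed.

Lemma clamp_lip v v' : `|clamp v' - clamp v| <= `|v' - v|.
Proof.
wlog vv : v v' / v <= v'.
  by move=> W; have [|/ltW] := leP v v' => H; [|rewrite distrC (distrC v')]; exact: W.
rewrite !ger0_norm ?subr_ge0 ?clamp_le// /clamp.
by case: (leP v 1) => h1; case: (leP v' 1) => h2; rewrite ?(max_r ler01)//;
  case: (leP 0 v) => h3; case: (leP 0 v') => h4; rewrite ?(max_r ler01)//; lra.
Qed.

Lemma clamp_lt0 v : v <= 0 -> clamp v = 0.
Proof. by move=> v0; rewrite /clamp max_l// ge_min v0. Qed.

Lemma clamp_gt1 v : 1 <= v -> clamp v = 1.
Proof. by move=> v1; rewrite /clamp min_r// max_r. Qed.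

(** Freezing the argument outside the unit interval gives a reaction term that is
    Lipschitz on the whole line, so that comparison functions may leave [0, 1]. *)
Definition nl (f : R -> R) v := f (clamp v).
Definition nl' (f : R -> R) v := f' f (clamp v).

End one_sided_calculus.

Section nonlinearity.
Context {R : realType} (f : R -> R) (theta : R) (Hf : bistable f theta).
Local Notation mu := (@lebesgue_measure R).

Let D0 : forall x, `[0, 1]%classic x -> derivable_within `[0, 1] f x.
Proof. by case: Hf => _ [D _] _ _ _ x x01; exact: (D 0). Qed.
Let D1 : forall x, `[0, 1]%classic x -> derivable_within `[0, 1] (f' f) x.
Proof. by case: Hf => _ [D _] _ _ _ x x01; exact: (D 1). Qed.
Let D2 : forall x, `[0, 1]%classic x -> derivable_within `[0, 1] (derive_within `[0, 1] (f' f)) x.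
Proof. by case: Hf => _ [D _] _ _ _ x x01; exact: (D 2). Qed.

Let within_bounded (g : R -> R) : {within `[0, 1], continuous g} ->
  exists2 C, 0 < C & forall x, 0 <= x <= 1 -> `|g x| <= C.
Proof.
move=> cg; have cng : {within `[0, 1], continuous (fun x => `|g x|)}.
  by move=> x; apply: (@cvg_norm _ _ _ _ _ _ _ (cg x)).
have [z _ H] := EVT_max ler01 cng.
exists (`|g z| + 1); first by rewrite ltr_wpDl.
by move=> x x01; rewrite (le_trans (H x _)) ?lerDl// in_itv.
Qed.

(** The first two derivatives are continuous on a compact interval, hence bounded;
    the mean value theorem turns the bounds into Lipschitz and Taylor estimates. *)
Lemma bistable_bounds : exists L M : R, [/\ 0 < L, 0 < M,
  forall v, 0 <= v <= 1 -> `|f v| <= L /\ `|f' f v| <= L,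
  forall v v', 0 <= v <= 1 -> 0 <= v' <= 1 ->
    `|f v' - f v| <= L * `|v' - v| /\ `|f' f v' - f' f v| <= M * `|v' - v| &
  forall v v', 0 <= v <= 1 -> 0 <= v' <= 1 ->
    `|f v' - f v - f' f v * (v' - v)| <= M * `|v' - v| ^+ 2].
Proof.
have [B0 B00 fB0] := within_bounded (derivable_within_cont D0).
have [B1 B10 fB1] := within_bounded (derivable_within_cont D1).
have [M M0 fM] := within_bounded (derivable_within_cont D2).
have mv (g : R -> R) v v' : (forall x, `[0, 1]%classic x -> derivable_within `[0, 1] g x) ->
    0 <= v <= 1 -> 0 <= v' <= 1 -> exists z, [/\ 0 <= z <= 1, `|z - v| <= `|v' - v| &
      g v' - g v = derive_within `[0, 1] g z * (v' - v)].
  move=> Dg /andP[v0 v1] /andP[v'0 v'1].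
  have [vv|/ltW vv] := leP v v'.
    have [z /andP[z1 z2] E] := derivable_within_mvt Dg v0 vv v'1.
    exists z; split => //; first by apply/andP; split; lra.
    by rewrite !ger0_norm ?subr_ge0// lerD2r.
  have [z /andP[z1 z2] E] := derivable_within_mvt Dg v'0 vv v1.
  exists z; split; first by apply/andP; split; lra.
    by rewrite !ler0_norm ?subr_le0// !opprB lerD2l lerN2.
  by rewrite -opprB E -mulrN opprB.
have fL v v' : 0 <= v <= 1 -> 0 <= v' <= 1 -> `|f' f v' - f' f v| <= M * `|v' - v|.
  move=> v01 v'01; have [z [z01 _ ->]] := mv _ v v' D1 v01 v'01.
  by rewrite normrM ler_wpM2r// fM.
exists (B0 + B1), M; split => //.
- by rewrite addr_gt0.
- by move=> v v01; have := fB0 v v01; have := fB1 v v01; rewrite -/(f' f); split; lra.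
- move=> v v' v01 v'01; split; last exact: fL.
  have [z [z01 _ ->]] := mv _ v v' D0 v01 v'01.
  rewrite normrM ler_wpM2r//; have := fB1 z z01; rewrite -/(f' f); lra.
- move=> v v' v01 v'01; have [z [z01 zv ->]] := mv _ v v' D0 v01 v'01.
  rewrite -/(f' f) -mulrBl normrM expr2 mulrA; apply: ler_wpM2r => //.
  by apply: (le_trans (fL _ _ v01 z01)); apply: ler_wpM2l => //; exact: ltW.
Qed.

Lemma supnorm_bound v : 0 <= v <= 1 -> `|f' f v| <= f'_supnorm f.
Proof.
move=> v01; have [L [M [_ _ H _ _]]] := bistable_bounds.
apply: ub_le_sup; last by exists v.
by exists L => _ [s /= s01 <-]; apply: (H s _).2; move: s01; rewrite in_itv.
Qed.

Lemma nl_lipschitz : exists L M : R, [/\ 0 < L /\ 0 < M,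
  forall v, `|nl f v| <= L /\ `|nl' f v| <= L,
  forall v v', `|nl f v' - nl f v| <= L * `|v' - v|,
  forall v v', `|nl' f v' - nl' f v| <= M * `|v' - v| &
  forall v v', 0 <= v <= 1 -> 0 <= v' <= 1 ->
    `|nl f v' - nl f v - nl' f v * (v' - v)| <= M * `|v' - v| ^+ 2].
Proof.
have [L [M [L0 M0 fB fL fT]]] := bistable_bounds.
exists L, M; split => //.
- by move=> v; exact/fB/clamp01.
- move=> v v'; have [h _] := fL _ _ (clamp01 v) (clamp01 v'); apply: (le_trans h).
  by apply: ler_wpM2l; [exact: ltW|exact: clamp_lip].
- move=> v v'; have [_ h] := fL _ _ (clamp01 v) (clamp01 v'); apply: (le_trans h).
  by apply: ler_wpM2l; [exact: ltW|exact: clamp_lip].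
- by move=> v v' v01 v01'; rewrite /nl /nl' !clamp_id//; exact: fT.
Qed.

(** [f'] is negative at both ends and Lipschitz, hence negative near them; beyond
    the ends [nl f] is constant, so monotonicity extends to two half-lines. *)
Lemma stable_ends : exists a0 b0 : R, [/\ 0 < a0, a0 < b0, b0 < 1,
  forall v v', v <= v' -> v' <= a0 -> nl f v' <= nl f v &
  forall v v', v <= v' -> b0 <= v -> nl f v' <= nl f v].
Proof.
have [L [M [L0 M0 _ HM _]]] := bistable_bounds.
have [_ _ _ [f0 f1] _] := Hf.
(* the bounds [1 / 4] and [3 / 4] only ensure [a0 < b0] *)
pose a0 := Num.min (1 / 4) (- f' f 0 / M); pose b0 := Num.max (3 / 4) (1 + f' f 1 / M).
have a00 : 0 < a0 by rewrite lt_min divr_gt0//= divr_gt0// oppr_gt0.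
have a04 : a0 <= 1 / 4 by rewrite ge_min lexx.
have b01 : b0 < 1 by rewrite gt_max gtrDl pmulr_llt0 ?invr_gt0// f1 andbT; lra.
have b04 : 3 / 4 <= b0 by rewrite le_max lexx.
have zero01 : 0 <= (0 : R) <= 1 by rewrite lexx ler01.
have one01 : 0 <= (1 : R) <= 1 by rewrite lexx ler01.
have A v : 0 <= v <= a0 -> f' f v <= 0.
  move=> /andP[v0 va]; have v01 : 0 <= v <= 1 by apply/andP; split; lra.
  have [_ H] := HM 0 v zero01 v01; rewrite subr0 (ger0_norm v0) in H.
  have : M * v <= - f' f 0 by rewrite mulrC -ler_pdivlMr// (le_trans va)// ge_min lexx orbT.
  by have := ler_norm (f' f v - f' f 0); lra.
have B v : b0 <= v <= 1 -> f' f v <= 0.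
  move=> /andP[v0 va]; have v01 : 0 <= v <= 1 by apply/andP; split; lra.
  have [_ H] := HM 1 v one01 v01; rewrite (distrC v 1) (ger0_norm (_ : 0 <= 1 - v)) ?subr_ge0// in H.
  have : M * (1 - v) <= - f' f 1.
    rewrite mulrC -ler_pdivlMr// mulNr lerBlDr -lerBlDl opprK (le_trans _ v0)//.
    by rewrite le_max lexx orbT.
  by have := ler_norm (f' f v - f' f 1); lra.
have mono a b : 0 <= a -> b <= 1 -> a <= b -> (forall z, a <= z <= b -> f' f z <= 0) -> f b <= f a.
  move=> a0' b1 ab H; have [z zab E] := derivable_within_mvt D0 a0' ab b1.
  by rewrite -subr_le0 E mulr_le0_ge0 ?subr_ge0// H.
exists a0, b0; split => //; first by lra.
- move=> v v' vv va; have /andP[c0 c1] := clamp01 v; have /andP[c0' c1'] := clamp01 v'.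
  apply: mono => //; first exact: clamp_le.
  move=> z /andP[z1 z2]; apply: A; apply/andP; split; first by lra.
  apply: (le_trans z2); rewrite /clamp ge_max (ltW a00)/= ge_min va//.
- move=> v v' vv vb; have /andP[c0 c1] := clamp01 v; have /andP[c0' c1'] := clamp01 v'.
  apply: mono => //; first exact: clamp_le.
  move=> z /andP[z1 z2]; apply: B; apply/andP; split; last by lra.
  apply: le_trans z1; rewrite /clamp le_max le_min vb (ltW b01) orbT//.
Qed.

End nonlinearity.

(** * The travelling wave *)
Section wave.
Context {R : realType} (f : R -> R) (theta : R) (Hf : bistable f theta).
Variables (c : R) (phi : R -> R) (Hphi : travelling_wave f theta c phi).
Local Notation mu := (@lebesgue_measure R).
Local Notation p := (phi^`())%classic.

Lemma wave01 z : 0 <= phi z <= 1. Proof. by case: Hphi. Qed.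

Lemma wave_derive (z : R) : is_derive z (1 : R) phi (p z).
Proof.
by case: Hphi => [[D _] _ _ _ _]; apply: DeriveDef; [exact: (D 0%N)|rewrite derive1E].
Qed.

Lemma wave_derive2 (z : R) : is_derive z (1 : R) p (- c * p z - f (phi z)).
Proof.
case: Hphi => [[D _] _ E _ _]; apply: DeriveDef; first exact: (D 1%N).
have -> : 'D_1 p z = derive1n 2 phi z by rewrite -derive1E.
by have := E z; lra.
Qed.

Lemma wave_left : phi z @[z --> -oo] --> (1 : R). Proof. by case: Hphi => _ _ _ []. Qed.
Lemma wave_right : phi z @[z --> +oo] --> (0 : R). Proof. by case: Hphi => _ _ _ []. Qed.

Lemma wave_right_eps e : 0 < e -> exists N : R, forall z, N <= z -> phi z <= e.
Proof.
move=> e0; have /cvgrPdist_le /(_ e e0) [N [_ H]] := wave_right.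
exists (N + 1) => z Nz; have := H z; rewrite sub0r normrN => /(_ _)/(le_trans (ler_norm _)); apply.
by rewrite (lt_le_trans _ Nz)// ltrDl.
Qed.

Lemma wave_left_eps e : 0 < e -> exists N : R, forall z, z <= N -> 1 - e <= phi z.
Proof.
move=> e0; have /cvgrPdist_le /(_ e e0) [N [_ H]] := wave_left.
exists (N - 1) => z Nz; rewrite lerBlDr -lerBlDl; apply: (le_trans (ler_norm _)); apply: H.
by rewrite (le_lt_trans Nz)// ltrBlDr ltrDl.
Qed.

Local Notation ft := (nl f).

Let f0 : f 0 = 0. Proof. by case: Hf => _ _ []. Qed.
Let f1 : f 1 = 0. Proof. by case: Hf => _ _ []. Qed.

Let ft_cont : continuous ft.
Proof. by have [L [M [_ _ H _ _]]] := nl_lipschitz Hf; exact: lipschitz_continuous H. Qed.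

Let ft_phi z : ft (phi z) = f (phi z). Proof. by rewrite /nl clamp_id// wave01. Qed.

(** The slope of the profile is controlled by its distance to an equilibrium on
    the next unit interval: by the mean value theorem the slope is small
    somewhere there, and [p + c phi] has derivative [- f phi]. *)
Lemma wave_slope : exists2 C, 0 < C & forall z k e, (k = 0 \/ k = 1) ->
  (forall y, z <= y <= z + 1 -> `|phi y - k| <= e) -> `|p z| <= C * e.
Proof.
have [L [M [L0 _ _ HL _]]] := bistable_bounds Hf.
exists (2 + 2 * `|c| + L); first by rewrite addr_gt0// ltr_wpDr// mulr_ge0.
move=> z k e k01 He.
have k01' : 0 <= k <= 1 by case: k01 => ->; rewrite lexx ler01.
have fk : f k = 0 by case: k01 => ->.
have z1 : z <= z + 1 by rewrite lerDl.
have e0 : 0 <= e by apply: le_trans (He z _); rewrite ?lexx.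
have [y yz Ey] := mvt wave_derive z1.
have {Ey} Ey : p y = (phi (z + 1) - k) - (phi z - k).
  by move: Ey; rewrite [z + 1 - z]addrAC subrr add0r mulr1 => <-; ring.
have py : `|p y| <= 2 * e.
  rewrite Ey (le_trans (ler_normB _ _))//.
  have := He z; have := He (z + 1); rewrite !lexx !z1 => /(_ isT) h1 /(_ isT) h2; lra.
have dq (x : R) : is_derive x (1 : R) (fun x => p x + c * phi x) (- f (phi x)).
  by apply: is_derive_eq (is_deriveD (wave_derive2 x) (is_derive_scale c (wave_derive x))) _; ring.
have /andP[zy yz1] := yz.
have [x /andP[zx xy] Ex] := mvt dq zy.
have fx : `|f (phi x)| <= L * e.
  have [I _] := HL k (phi x) k01' (wave01 x); rewrite fk subr0 in I.
  apply: (le_trans I); apply: ler_wpM2l; first exact: ltW.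
  by apply: He; rewrite zx (le_trans xy).
have -> : p z = p y + c * ((phi y - k) - (phi z - k)) + f (phi x) * (y - z).
  by move: Ex; set A := f (phi x); lra.
have B1 : `|f (phi x) * (y - z)| <= L * e.
  rewrite normrM (ger0_norm (_ : 0 <= y - z)) ?subr_ge0//.
  by rewrite -[leRHS]mulr1; apply: ler_pM; rewrite ?subr_ge0// lerBlDl.
have B2 : `|c * ((phi y - k) - (phi z - k))| <= `|c| * (2 * e).
  rewrite normrM; apply: ler_wpM2l => //; apply: (le_trans (ler_normB _ _)).
  have := He y yz; have := He z; rewrite lexx z1 => /(_ isT) h1 h2; lra.
apply: (le_trans (ler_normD _ _)); apply: (le_trans (lerD (ler_normD _ _) (lexx _))).
by rewrite !mulrDl; lra.
Qed.

Lemma wave_slope_bounded : exists2 P, 0 < P & forall z, `|p z| <= P.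
Proof.
have [C C0 H] := wave_slope; exists C => // z.
rewrite -[C]mulr1; apply: (H z 0 1); first by left.
by move=> y _; rewrite subr0; have /andP[a b] := wave01 y; rewrite ger0_norm.
Qed.

Lemma wave_slope_right e : 0 < e -> exists N : R, forall z, N <= z -> `|p z| <= e.
Proof.
move=> e0; have [C C0 H] := wave_slope.
have [N HN] := wave_right_eps (divr_gt0 e0 C0); exists N => z Nz.
have -> : e = C * (e / C) by field; exact: lt0r_neq0.
apply: (H z 0); first by left.
move=> y /andP[zy _]; rewrite subr0; have /andP[a b] := wave01 y; rewrite ger0_norm//.
exact: HN (le_trans Nz zy).
Qed.

Let Ft := prim ft.
Let lft : loc_bounded ft. Proof. exact: cont_loc_bounded. Qed.
Let dFt (v : R) : is_derive v (1 : R) Ft (ft v).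
Proof. by apply: prim_is_derive => //; exact: ft_cont. Qed.

Let Ft1 : 0 < Ft 1.
Proof.
have := prim_sub lft ler01; rewrite prim0 subr0 => E.
rewrite /Ft E; case: Hf => _ _ _ _ [_ _]; congr (0 < _); apply: eq_Rintegral => s.
by rewrite inE/= in_itv/= => s01; rewrite /nl clamp_id.
Qed.

Let Ft_neg v : 0 < v <= theta -> Ft v < 0.
Proof.
move=> /andP[v0 vt]; case: Hf => /andP[t0 t1] _ _ _ [Hneg _ _].
have v20 : 0 <= v / 2 by lra.
have neg s : 0 <= s <= v -> ft s <= 0.
  move=> /andP[s0 sv]; rewrite /nl clamp_id; last by apply/andP; split; lra.
  have [->|s0'] := eqVneq s 0; first by rewrite f0.
  have [->|st] := eqVneq s theta; first by case: Hf => _ _ [_ -> _].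
  by apply/ltW/Hneg; rewrite !lt_neqAle s0 st eq_sym s0'/= (le_trans sv).
have A : Ft (v / 2) <= 0.
  rewrite -(prim0 ft); apply: (derive_le0 dFt v20) => z /andP[z0 zv].
  by apply: neg; apply/andP; split; lra.
suff : Ft v < Ft (v / 2) by move=> H; exact: lt_le_trans A.
have v2v : v / 2 < v by lra.
have [z] := MVT v2v (fun y _ => dFt y) (continuous_subspaceT (is_derive_cont dFt)).
rewrite in_itv/= => /andP[z1 z2] E; rewrite -subr_lt0 E pmulr_llt0 ?subr_gt0//.
rewrite /nl clamp_id; last by apply/andP; split; lra.
by apply: Hneg; apply/andP; split; lra.
Qed.

(** The mechanical energy of [phi'' + c phi' + f (phi) = 0]: its derivative is
    [- c p^2], and it goes from the positive integral of [f] at the rear to [0] at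
    the front. *)
Let energy z := p z ^+ 2 / 2 + Ft (phi z).

Let denergy (z : R) : is_derive z (1 : R) energy (- c * p z ^+ 2).
Proof.
have d1 : is_derive z (1 : R) (fun z => Ft (phi z)) (ft (phi z) * p z).
  have := is_derive1_comp (dFt (phi z)) (wave_derive z); exact.
have d2 : is_derive z (1 : R) (fun z => p z * p z * 2^-1) ((- c * p z - f (phi z)) * p z).
  have d3 : is_derive z (1 : R) (fun z => p z * p z) (2 * ((- c * p z - f (phi z)) * p z)).
    apply: is_derive_eq (is_deriveM (wave_derive2 z) (wave_derive2 z)) _.
    set a := - c * p z - f (phi z); rewrite -[LHS]/(p z * a + p z * a); ring.
  apply: is_derive_eq (is_deriveM d3 (is_derive_cst (2^-1 : R) z 1)) _.
  by rewrite scaler0 add0r -[LHS]/(2^-1 * _) mulKf.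
have := is_deriveD d2 d1; rewrite ft_phi.
rewrite (_ : _ + _ = energy); last by apply/funext => y; rewrite /energy expr2.
by rewrite (_ : (_ - _) * _ + _ = - c * p z ^+ 2)//; ring.
Qed.

Let energy_right e : 0 < e -> exists N : R, forall z, N <= z -> `|energy z| <= e.
Proof.
move=> e0.
have e20 : 0 < e / 2 by rewrite divr_gt0.
have m0 : 0 < Num.min 1 (e / 2) by rewrite lt_min ltr01.
have [N1 H1] := wave_slope_right m0.
have cF : continuous Ft := is_derive_cont dFt.
have /cvgrPdist_le /(_ _ e20) /nbhs_ballP[d /= d0 Hd] := cF (0 : R).
have [N2 H2] := wave_right_eps (divr_gt0 d0 (ltr0Sn R 1)).
exists (Num.max N1 N2) => z; rewrite ge_max => /andP[z1 z2].
have := H1 z z1; rewrite le_min => /andP[p1 p2].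
have := Hd (phi z); rewrite /ball/= sub0r normrN /Ft prim0 sub0r normrN -/Ft => I.
have {I} I : `|Ft (phi z)| <= e / 2.
  apply: I; have /andP[a b] := wave01 z; rewrite ger0_norm// (le_lt_trans (H2 z z2))//.
  by rewrite ltr_pdivrMr// ltr_pMr// ltr1n.
rewrite /energy (le_trans (ler_normD _ _))// (splitr e) lerD//.
rewrite normrM normrX [`|2^-1|]ger0_norm ?invr_ge0//; apply: ler_wpM2r; first by rewrite invr_ge0.
rewrite expr2; apply: (@le_trans _ _ (1 * `|p z|)); first exact: ler_wpM2r.
by rewrite mul1r (le_trans p2)// ler_pdivrMr// ler_peMr ?ler1n// ltW.
Qed.

(** If [c <= 0] the energy would be nondecreasing, although it is positive at the
    rear and vanishes at the front. *)
Lemma wave_speed_gt0 : 0 < c.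
Proof.
rewrite ltNge; apply/negP => c0.
have [N1 H1] := @energy_right (Ft 1 / 4) (divr_gt0 Ft1 (ltr0Sn _ _)).
have e20 : 0 < Ft 1 / 4 by rewrite divr_gt0.
have cF : continuous Ft := is_derive_cont dFt.
have /cvgrPdist_le /(_ _ e20) /nbhs_ballP[d /= d0 Hd] := cF (1 : R).
have [N2 H2] := wave_left_eps (divr_gt0 d0 (ltr0Sn R 1)).
pose z1 := Num.min N1 N2.
have z12 : z1 <= N2 by rewrite ge_min lexx orbT.
have z11 : z1 <= N1 by rewrite ge_min lexx.
have I : `|Ft 1 - Ft (phi z1)| <= Ft 1 / 4.
  apply: Hd; rewrite /ball/=; have /andP[a b] := wave01 z1; rewrite ger0_norm ?subr_ge0//.
  have := H2 z1 z12; lra.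
have J : energy z1 <= energy N1.
  apply: (derive_ge0 denergy z11) => z _.
  by rewrite mulr_ge0 ?oppr_ge0// sqr_ge0.
have := H1 N1 (lexx _); move: J; rewrite {1}/energy.
have := sqr_ge0 (p z1); have := ler_norm (Ft 1 - Ft (phi z1)); have := ler_norm (energy N1).
by move: (p z1 ^+ 2) => q; lra.
Qed.

Let energy_ge0 z : 0 <= energy z.
Proof.
apply/ler_addgt0Pl => e e0; have [N HN] := energy_right e0.
have zM : z <= Num.max z N by rewrite le_max lexx.
have NM : N <= Num.max z N by rewrite le_max lexx orbT.
have : energy (Num.max z N) <= energy z.
  apply: (derive_le0 denergy zM) => y _.
  by rewrite mulNr oppr_le0 mulr_ge0 ?sqr_ge0// ltW// wave_speed_gt0.
have := HN _ NM; rewrite ler_norml => /andP[]; lra.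
Qed.

(** At a critical point the energy is the potential, which is negative on (0, theta];
    as the energy is nonnegative, the point lies above [theta]. *)
Let critical z : p z = 0 -> 0 < phi z < 1 -> 0 < f (phi z).
Proof.
move=> p0 /andP[v0 v1]; case: Hf => _ _ _ _ [_ Hpos _]; apply: Hpos; rewrite v1 andbT ltNge.
apply/negP => vt; have := energy_ge0 z; rewrite /energy p0 expr0n/= mul0r add0r leNgt.
by rewrite Ft_neg// v0.
Qed.

Let decreasing_after (z : R) : p z = 0 -> 0 < phi z < 1 ->
  exists2 d : R, 0 < d & forall h, 0 < h < d -> phi (z + h) < phi z /\ 0 < p (z - h).
Proof.
move=> p0 v01; have fz := critical p0 v01.
have := wave_derive2 z; rewrite p0 mulr0 sub0r => d2.
have [d d0 H] := is_derive_epsP d2 (divr_gt0 fz (ltr0Sn R 1)).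
exists d => // h /andP[h0 hd].
have neg (k : R) : 0 < k -> k <= h -> p (z + k) < 0.
  move=> k0 kh; have := H k; rewrite gtr0_norm// p0 subr0 mulNr opprK => /(_ (le_lt_trans kh hd)).
  move=> /(le_trans (ler_norm _)) I.
  have : 0 < f (phi z) * k by rewrite mulr_gt0.
  lra.
split.
  have zh : z < z + h by rewrite ltrDl.
  have [y] := MVT zh (fun y _ => wave_derive y) (continuous_subspaceT (is_derive_cont wave_derive)).
  rewrite in_itv/= => /andP[y1 y2] E; rewrite -subr_lt0 E pmulr_llt0 ?subr_gt0//.
  have := neg (y - z); rewrite subr_gt0 [z + _]addrC subrK; apply => //; lra.
have := H (- h); rewrite normrN gtr0_norm// => /(_ hd); rewrite p0 subr0 mulrN mulNr opprK.
rewrite distrC => /(le_trans (ler_norm _)) I.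
have : 0 < f (phi z) * h by rewrite mulr_gt0.
lra.
Qed.

(** If the slope is positive at [z], the profile has a minimum to the left of [z] at an
    interior point. The value there is not in (0, 1), by the concavity of the
    profile at critical points; and if it is [0], the energy vanishes from there
    on, so the profile is stationary and cannot increase at [z]. *)
Let slope_le0_inside z : 0 < phi z < 1 -> p z <= 0.
Proof.
move=> v01; rewrite leNgt; apply/negP => pz.
have /andP[v0 v1] := v01.
have pz2 : 0 < p z / 2 by rewrite divr_gt0.
have [d d0 H] := is_derive_epsP (wave_derive z) pz2.
have [y yz yv] : exists2 y, y < z & phi y < phi z.
  exists (z - d / 2); first by rewrite ltrBlDr ltrDl divr_gt0.
  have := H (- (d / 2)); rewrite normrN gtr0_norm ?divr_gt0// ltr_pdivrMr// ltr_pMr// ltr1n => /(_ isT).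
  move=> /(le_trans (ler_norm _)).
  have : 0 < p z * d by rewrite mulr_gt0.
  by move: (phi (z - d / 2)) => q; lra.
have v1' : 0 < 1 - phi z by rewrite subr_gt0.
have [N HN] := wave_left_eps (divr_gt0 v1' (ltr0Sn R 1)).
pose N' := Num.min N (y - 1).
have N'y : N' < y by rewrite gt_min (_ : y - 1 < y) ?orbT// ltrBlDr ltrDl.
have N'z : N' <= z by lra.
have cphi : {within `[N', z], continuous phi} by apply: continuous_subspaceT; exact: is_derive_cont wave_derive.
have [m] := EVT_min N'z cphi; rewrite in_itv/= => /andP[m1 m2] Hm.
have my : phi m <= phi y by apply: Hm; rewrite in_itv/=; apply/andP; split; lra.
have mz : m < z.
  by rewrite lt_neqAle m2 andbT; apply/eqP => E; move: my; rewrite E; lra.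
have Nm : N' < m.
  rewrite lt_neqAle m1 andbT; apply/eqP => E.
  have := HN N'; rewrite ge_min lexx => /(_ isT); rewrite E; lra.
have pm : p m = 0.
  apply: (@global_min_derive0 _ _ _ m (Num.min (m - N') (z - m)) wave_derive).
    by rewrite lt_min !subr_gt0 Nm.
  move=> x; rewrite lt_min => /andP[x1 x2]; apply: Hm; rewrite in_itv/=.
  have := ler_norm (x - m); have := ler_norm (- (x - m)); rewrite normrN => h1 h2.
  by apply/andP; split; lra.
have /andP[pm0 pm1] := wave01 m.
have [pm0'|pm0'] := ltP 0 (phi m).
  have v01m : 0 < phi m < 1 by rewrite pm0'/=; lra.
  have [r r0 Hr] := decreasing_after pm v01m.
  pose h := Num.min r (z - m) / 2.
  have hm0 : 0 < Num.min r (z - m) by rewrite lt_min r0 subr_gt0.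
  have h0 : 0 < h by rewrite divr_gt0.
  have hr : h < Num.min r (z - m) by rewrite /h; lra.
  move: hr; rewrite lt_min => /andP[hr hz].
  have [] := Hr h; first by rewrite h0.
  rewrite ltNge Hm// in_itv/=; apply/andP; split; lra.
have phim : phi m = 0 by apply/eqP; rewrite eq_le pm0' pm0.
have em : energy m = 0 by rewrite /energy pm phim /Ft prim0 expr0n/= mul0r addr0.
have em0 x : m <= x -> energy x = 0.
  move=> mx; apply/eqP; rewrite eq_le energy_ge0 andbT -em.
  apply: (derive_le0 denergy mx) => w _.
  by rewrite mulNr oppr_le0 mulr_ge0 ?sqr_ge0// ltW// wave_speed_gt0.
have : - c * p z ^+ 2 = 0.
  have zr : z - m > 0 by rewrite subr_gt0.
  apply: (@global_min_derive0 _ _ (fun x => - c * p x ^+ 2) z (z - m) denergy zr).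
  by move=> w wz; rewrite !em0// ?ltW//; have := ler_norm (- (w - z)); rewrite normrN; lra.
move/eqP; rewrite mulf_eq0 oppr_eq0 (gt_eqF wave_speed_gt0)/= expf_eq0/=.
by rewrite gt_eqF.
Qed.

Lemma wave_slope_lt0 z : 0 < phi z < 1 -> p z < 0.
Proof.
move=> v01; rewrite lt_neqAle slope_le0_inside// andbT; apply/eqP => p0.
have [d d0 H] := decreasing_after p0 v01.
have /andP[v0 v1] := v01.
have cphi : continuous phi := is_derive_cont wave_derive.
have m0 : 0 < Num.min (phi z) (1 - phi z) by rewrite lt_min v0 subr_gt0.
have /cvgrPdist_lt /(_ _ m0) /nbhs_ballP[r /= r0 Hr] := cphi z.
pose h := Num.min d r / 2.
have dr0 : 0 < Num.min d r by rewrite lt_min d0.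
have h0 : 0 < h by rewrite divr_gt0.
have : h < Num.min d r by rewrite /h; lra.
rewrite lt_min => /andP[hd hr].
have [] := H h; first by rewrite h0.
move=> _; rewrite ltNge slope_le0_inside//.
have := Hr (z - h); rewrite /ball/= opprB addrC subrK gtr0_norm// => /(_ hr).
rewrite lt_min => /andP[]; have := ler_norm (phi z - phi (z - h)); have := ler_norm (- (phi z - phi (z - h))).
rewrite normrN => h1 h2 h3 h4; apply/andP; split; lra.
Qed.

Lemma wave_slope_le0 z : p z <= 0.
Proof.
have /andP[a b] := wave01 z.
have [v0|v0] := ltP 0 (phi z); last first.
  rewrite (@global_min_derive0 _ _ _ z 1 wave_derive)// => y _.
  by rewrite (le_trans v0)//; have /andP[] := wave01 y.
have [v1|v1] := ltP (phi z) 1; first by rewrite ltW// wave_slope_lt0// v0.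
have dN (x : R) : is_derive x (1 : R) (fun x => - phi x) (- p x).
  exact: is_deriveN (wave_derive x).
have := @global_min_derive0 _ _ _ z 1 dN ltr01.
rewrite -[X in X <= 0]opprK => ->; first by rewrite oppr0.
by move=> y _; rewrite lerN2 (le_trans _ v1)//; have /andP[] := wave01 y.
Qed.

(** A minimum over a compact interval of [- p] plus penalties that vanish exactly
    where [phi] lies between [a] and [b]; the profile is outside that range beyond
    the interval. *)
Lemma wave_middle_slope a b : 0 < a -> b < 1 -> exists2 beta, 0 < beta &
  forall z, a <= phi z <= b -> p z <= - beta.
Proof.
move=> a0 b1.
have a20 : 0 < a / 2 by rewrite divr_gt0.
have b20 : 0 < (1 - b) / 2 by rewrite divr_gt0 ?subr_gt0.
have [N1 H1] := wave_left_eps b20; have [N2 H2] := wave_right_eps a20.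
pose M2 := Num.max N1 N2; have M12 : N1 <= M2 by rewrite le_max lexx.
pose q z := - p z + (`|phi z - b| + (phi z - b)) + (`|a - phi z| + (a - phi z)).
have cphi : continuous phi := is_derive_cont wave_derive.
have cp : continuous p := is_derive_cont wave_derive2.
have cq : continuous q.
  have c1 : continuous (fun z => phi z - b) by move=> z; apply: cvgB; [exact: cphi|exact: cvg_cst].
  have c2 : continuous (fun z => a - phi z) by move=> z; apply: cvgB; [exact: cvg_cst|exact: cphi].
  move=> z; apply: cvgD; [apply: cvgD|]; [by apply: cvgN; exact: cp| |].
  - by apply: cvgD; [apply: cvg_norm; exact: c1|exact: c1].
  - by apply: cvgD; [apply: cvg_norm; exact: c2|exact: c2].
have [m mI Hm] := EVT_min M12 (continuous_subspaceT cq).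
have q0 z : 0 < q z.
  have /andP[v0 v1] := wave01 z; have p0 := wave_slope_le0 z; rewrite /q.
  have m1 : 0 <= `|phi z - b| + (phi z - b) by have := ler_norm (- (phi z - b)); rewrite normrN; lra.
  have m2 : 0 <= `|a - phi z| + (a - phi z) by have := ler_norm (- (a - phi z)); rewrite normrN; lra.
  have m1' := ler_norm (phi z - b); have m2' := ler_norm (a - phi z).
  have [v0'|v0'] := ltP 0 (phi z); last by lra.
  have [v1'|v1'] := ltP (phi z) 1; last by lra.
  by have := @wave_slope_lt0 z; rewrite v0' v1' => /(_ isT); lra.
exists (q m) => // z /andP[az zb].
have zI : z \in `[N1, M2]%R.
  rewrite in_itv/=; apply/andP; split; apply/ltW; rewrite ltNge; apply/negP => Hz.
    by have := H1 z Hz; lra.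
  have Nz : N2 <= z by rewrite (le_trans _ Hz)// le_max lexx orbT.
  by have := H2 z Nz; lra.
have := Hm z zI; rewrite {2}/q.
rewrite (ler0_norm (_ : phi z - b <= 0)) ?subr_le0// (ler0_norm (_ : a - phi z <= 0)) ?subr_le0//; lra.
Qed.

(** Ahead of the front [f (phi) <= 0], so [p + c phi] increases to its limit [0] and is
    therefore nonpositive: [phi * exp (c z)] decreases. *)
Lemma wave_decay : exists2 C0, 0 < C0 & forall z, phi z <= C0 * expR (- c * z).
Proof.
have [a0 [b0 [a00 ab b01 Ha _]]] := stable_ends Hf.
have [N HN] := wave_right_eps a00.
have fneg z : N <= z -> f (phi z) <= 0.
  move=> Nz; have /andP[v0 v1] := wave01 z.
  by have := Ha 0 (phi z) v0 (HN z Nz); rewrite /nl (clamp_lt0 (lexx 0)) (clamp_id (wave01 z)) f0.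
pose y z := p z + c * phi z.
have dy (x : R) : is_derive x (1 : R) y (- f (phi x)).
  by apply: is_derive_eq (is_deriveD (wave_derive2 x) (is_derive_scale c (wave_derive x))) _; ring.
have c0 := wave_speed_gt0.
have yneg z : N <= z -> y z <= 0.
  move=> Nz; apply/ler_addgt0Pl => e e0.
  have e1 : 0 < e / (1 + c) by rewrite divr_gt0// addr_gt0.
  have [K1 HK1] := wave_slope_right e1; have [K2 HK2] := wave_right_eps e1.
  pose x := Num.max z (Num.max K1 K2).
  have zx : z <= x by rewrite le_max lexx.
  have K1x : K1 <= x by rewrite !le_max lexx orbT.
  have K2x : K2 <= x by rewrite !le_max lexx !orbT.
  have yy : y z <= y x.
    apply: (derive_ge0 dy zx) => w /andP[zw _]; rewrite oppr_ge0 fneg//; exact: le_trans zw.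
  apply: (le_trans yy); rewrite addr0.
  have -> : e = e / (1 + c) + c * (e / (1 + c)) by field; rewrite gt_eqF// addr_gt0.
  apply: lerD; first by rewrite (le_trans (ler_norm _))// HK1.
  by apply: ler_wpM2l; [exact: ltW|exact: HK2].
have dE (x : R) : is_derive x (1 : R) (fun x => expR (c * x)) (c * expR (c * x)).
  have d1 : is_derive x (1 : R) (fun x => c * x) c.
    exact: is_derive_lin.
  by have := is_derive1_comp (is_derive_expR (c * x)) d1; rewrite mulrC; apply.
have dPE (x : R) : is_derive x (1 : R) (fun x => phi x * expR (c * x)) (y x * expR (c * x)).
  apply: is_derive_eq (is_deriveM (wave_derive x) (dE x)) _.
  by rewrite -[LHS]/(phi x * (c * expR (c * x)) + expR (c * x) * p x) /y; ring.
exists (expR (c * N)); first exact: expR_gt0.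
move=> z; have /andP[v0 v1] := wave01 z.
have [Nz|/ltW zN] := leP N z.
  have := derive_le0 dPE Nz; have /andP[n0 n1] := wave01 N => H.
  have {H} H : phi z * expR (c * z) <= expR (c * N).
    apply: (@le_trans _ _ (phi N * expR (c * N))).
      apply: H => w /andP[Nw _]; apply: mulr_le0_ge0; [exact: yneg|exact: expR_ge0].
    by rewrite ler_piMl// expR_ge0.
  by rewrite mulNr expRN ler_pdivlMr// expR_gt0.
apply: (le_trans v1); rewrite -expRD -expR0 ler_expR mulNr subr_ge0.
by apply: ler_wpM2l => //; exact: ltW.
Qed.

End wave.

(** * Comparison for the integral equation *)

Section smooth.
Context {R : realType} (K : R) (K0 : 0 < K).
Local Notation mu := (@lebesgue_measure R).
Local Notation mR := (measurableTypeR R).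

Variables (W Wt Wx Wxx : R -> R -> R) (C T0 : R).
Hypothesis dWt : forall t x, is_derive t (1 : R) (W^~ x) (Wt t x).
Hypothesis dWx : forall t x, is_derive x (1 : R) (W t) (Wx t x).
Hypothesis dWxx : forall t x, is_derive x (1 : R) (Wx t) (Wxx t x).
Hypothesis cW : continuous (fun p : R * R => W p.1 p.2).
Hypothesis cWt : continuous (fun p : R * R => Wt p.1 p.2).
Hypothesis cWx : continuous (fun p : R * R => Wx p.1 p.2).
Hypothesis cWxx : continuous (fun p : R * R => Wxx p.1 p.2).
Hypothesis bW : forall t x, t <= T0 -> `|W t x| <= C.
Hypothesis bWt : forall t x, t <= T0 -> `|Wt t x| <= C.
Hypothesis bWx : forall t x, t <= T0 -> `|Wx t x| <= C.
Hypothesis bWxx : forall t x, t <= T0 -> `|Wxx t x| <= C.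

Local Notation joint_meas G := (measurable_fun setT (fun p : mR * mR => G p.1 p.2)).
Hypotheses (mW : joint_meas W) (mWt : joint_meas Wt) (mWx : joint_meas Wx) (mWxx : joint_meas Wxx).

Lemma smooth_representation t x : t <= T0 ->
  \int[walk K0]_w (K * W (t - life w) (x - Y w) + Wt (t - life w) (x - Y w) - Wxx (t - life w) (x - Y w))
   = K * W t x.
Proof.
move=> tT.
have refl (G : R -> R -> R) : continuous (fun p : R * R => G p.1 p.2) ->
    continuous (fun p : R * R => G (t - p.1) (x - p.2)).
  by move=> cG; apply: (continuous2_comp cG) => q; apply: cvgB;
    [exact: cvg_cst|exact: cvg_fst|exact: cvg_cst|exact: cvg_snd].
have m1 : measurable_fun setT (fun p : mR * mR => t - p.1) by apply: measurable_funB => //; exact: measurable_fst.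
have m2 : measurable_fun setT (fun p : mR * mR => x - p.2) by apply: measurable_funB => //; exact: measurable_snd.
have := @heat_representation R K K0 (fun s y => W (t - s) (x - y))
  (fun s y => - Wt (t - s) (x - y)) (fun s y => - Wx (t - s) (x - y))
  (fun s y => Wxx (t - s) (x - y)) C.
rewrite !subr0 => H.
transitivity (\int[walk K0]_w (K * W (t - life w) (x - Y w) - - Wt (t - life w) (x - Y w) - Wxx (t - life w) (x - Y w))).
  by apply: eq_Rintegral => w _; rewrite opprK.
apply: H.
- by move=> s y; apply: (@reflect_derive R (W^~ (x - y))); exact: dWt.
- by move=> s y; apply: (@reflect_derive R (W (t - s))); exact: dWx.
- exact: (refl W).
- by move=> p; apply: cvgN; exact: (refl Wt).
- by move=> p; apply: cvgN; exact: (refl Wx).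
- exact: (joint_meas_comp mW m1 m2).
- by apply: measurable_funN; exact: (joint_meas_comp mWt m1 m2).
- by apply: measurable_funN; exact: (joint_meas_comp mWx m1 m2).
- exact: (joint_meas_comp mWxx m1 m2).
- move=> s a b s0 ab.
  have cs : continuous (Wxx (t - s)).
    by apply: (continuous2_comp (al := cst (t - s)) (be := id) cWxx) => y; [exact: cvg_cst|exact: cvg_id].
  have lW := cont_loc_bounded cs.
  have ab' : x - b <= x - a by lra.
  rewrite (itv_reflect a b x lW) -prim_sub//.
  by rewrite (prim_ftc (dWxx (t - s)) cs ab'); ring.
- by move=> s y s0; apply: bW; lra.
- by move=> s y s0; rewrite normrN; apply: bWt; lra.
- by move=> s y s0; rewrite normrN; apply: bWx; lra.
- by move=> s y s0; apply: bWxx; lra.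
Qed.

End smooth.

(** In integral form the equation is [K u = avg (react u)]. Constants [0] and [1]
    solve it because [n] vanishes there, and a comparison function known only for
    [t <= T0] can be continued by such a constant: averages look at the past. *)
Section comparison.
Context {R : realType} (K : R) (K0 : 0 < K).
Local Notation mu := (@lebesgue_measure R).
Local Notation mR := (measurableTypeR R).
Local Notation avg := (tavg (walk K0) (@life R) (@Y R)).
Variables (n ga : R -> R) (B G : R).
Hypothesis mn : measurable_fun setT (n : mR -> R).
Hypothesis cn : continuous n.
Hypothesis nB : forall v, `|n v| <= B.
Hypothesis mga : measurable_fun setT (ga : mR -> R).
Hypothesis gaG : forall x, `|ga x| <= G.
Hypothesis Hmono : forall x v v', v <= v' -> K * v + ga x * n v <= K * v' + ga x * n v'.
Hypothesis n0 : n 0 = 0.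
Hypothesis n1 : n 1 = 0.

Definition unit_valued (u : R -> R -> R) := measurable_fun setT (fun p : mR * mR => u p.1 p.2) /\
  forall t x, 0 <= u t x <= 1.

Definition react (u : R -> R -> R) t x := K * u t x + ga x * n (u t x).

Lemma unit_valued_bmeas u : unit_valued u -> bmeas u 1.
Proof. by move=> [mu_ u01]; split => // t x; have /andP[a b] := u01 t x; rewrite ger0_norm. Qed.

Lemma react_bmeas u : unit_valued u -> bmeas (react u) (K + G * B).
Proof.
move=> uu; have u1 := unit_valued_bmeas uu.
have g1 : bmeas (fun _ x => ga x) G.
  by split => //; apply: measurableT_comp => //; exact: measurable_snd.
have nu : bmeas (fun t x => n (u t x)) B.
  by split => //; apply: (@measurableT_comp _ _ _ _ _ _ n) => //; exact: uu.1.
have := bmeasD (bmeasM (bmeas_cst K) u1) (bmeasM g1 nu).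
by rewrite mulr1 gtr0_norm.
Qed.

Lemma react_itv u t x : unit_valued u -> 0 <= avg (react u) t x <= K.
Proof.
move=> uu; have ru := react_bmeas uu.
have z0 : bmeas (fun _ _ => 0 : R) `|0| := bmeas_cst 0.
have zK : bmeas (fun _ _ => K) `|K| := bmeas_cst K.
have e0 : avg (fun _ _ => 0) t x = 0 by exact: average_cst.
have eK : avg (fun _ _ => K) t x = K by exact: average_cst.
apply/andP; split.
  rewrite -[leLHS]e0; apply: (tavg_le _ (@life_meas R) (@Y_meas R) z0 ru) => w.
  by have /andP[a _] := uu.2 (t - life w) (x - Y w); have := Hmono (x - Y w) a; rewrite n0 !mulr0 addr0.
rewrite -[leRHS]eK; apply: (tavg_le _ (@life_meas R) (@Y_meas R) ru zK) => w.
by have /andP[_ a] := uu.2 (t - life w) (x - Y w); have := Hmono (x - Y w) a; rewrite n1 mulr0 addr0 mulr1.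
Qed.

(** The source [react] is monotone in [u], so the iterates started from the lower
    barrier increase and stay below the upper one; dominated convergence passes to
    the limit in the averages. *)
Lemma monotone_fixed_point (s0 s1 : R -> R -> R) : unit_valued s0 -> unit_valued s1 ->
  (forall t x, s0 t x <= s1 t x) ->
  (forall t x, K * s0 t x <= avg (react s0) t x) ->
  (forall t x, avg (react s1) t x <= K * s1 t x) ->
  exists u, [/\ unit_valued u, forall t x, s0 t x <= u t x <= s1 t x &
    forall t x, K * u t x = avg (react u) t x].
Proof.
move=> uu0 uu1 s01 sub0 sup1.
pose T (u : R -> R -> R) t x := K^-1 * avg (react u) t x.
pose U k := iter k T s0.
have TK u t x : K * T u t x = avg (react u) t x by rewrite /T mulVKf// gt_eqF.
have Tuv u : unit_valued u -> unit_valued (T u).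
  move=> uu; split.
    apply: measurable_funM => //.
    exact: (tavg_bmeas (walk K0) (@life_meas R) (@Y_meas R) (react_bmeas uu)).1.
  move=> t x; have /andP[a b] := react_itv t x uu; rewrite /T mulr_ge0 ?invr_ge0 ?(ltW K0)//=.
  by rewrite mulrC ler_pdivrMr// mul1r.
have Tle u v : unit_valued u -> unit_valued v -> (forall t x, u t x <= v t x) ->
    forall t x, T u t x <= T v t x.
  move=> uu uv uv_le t x; apply: ler_wpM2l; first by rewrite invr_ge0 ltW.
  apply: (tavg_le _ (@life_meas R) (@Y_meas R) (react_bmeas uu) (react_bmeas uv)) => w.
  exact: Hmono.
have Uuv k : unit_valued (U k) by elim: k => // k IH; exact: Tuv.
have Uinc k : forall t x, U k t x <= U k.+1 t x.
  elim: k => [|k IH] t x; first by rewrite -(ler_pM2l K0) TK.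
  by apply: Tle => //; exact: (Uuv k.+1).
have Us1 k : forall t x, U k t x <= s1 t x.
  elim: k => // k IH t x; rewrite -(ler_pM2l K0) (le_trans _ (sup1 t x))// TK.
  by rewrite -TK -(TK s1) ler_pM2l//; exact: Tle.
pose u t x := lim (U k t x @[k --> \oo]).
have Und t x : nondecreasing_seq (fun k => U k t x) by apply/nondecreasing_seqP => k; exact: Uinc.
have Ucv t x : U k t x @[k --> \oo] --> u t x.
  apply: nondecreasing_is_cvgn => //; exists (s1 t x) => _ [k _ <-]; exact: Us1.
have s0u t x : s0 t x <= u t x by have := nondecreasing_cvgn_le (Und t x) (Ucv t x) 0%N.
have us1 t x : u t x <= s1 t x.
  by apply: limr_le; [exact: Ucv|apply: nearW => k; exact: Us1].
have uuv : unit_valued u.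
  split; last first.
    move=> t x; have /andP[a _] := uu0.2 t x; have /andP[_ b] := uu1.2 t x.
    by rewrite (le_trans a (s0u t x)) (le_trans (us1 t x) b).
  apply: (@measurable_fun_cvg _ _ _ setT (fun k (p : mR * mR) => U k p.1 p.2)).
    by move=> k; exact: (Uuv k).1.
  by move=> p _; exact: Ucv.
exists u; split => //; first by move=> t x; rewrite s0u us1.
move=> t x.
have c1 : avg (react (U k)) t x @[k --> \oo] --> avg (react u) t x.
  apply: (@dominated_Rintegral R _ _ _ setT _ _ (fun _ => K + G * B)) => //.
  - by move=> k; exact: (tavg_slice (@life_meas R) (@Y_meas R) t x (react_bmeas (Uuv k))).
  - exact: (tavg_slice (@life_meas R) (@Y_meas R) t x (react_bmeas uuv)).
  - move=> w _; apply: cvgD; first by apply: cvgM; [exact: cvg_cst|exact: Ucv].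
    apply: cvgM; first exact: cvg_cst.
    apply: (@cvg_comp _ _ _ (fun k => U k (t - life w) (x - Y w)) n \oo (nbhs (u (t - life w) (x - Y w)))).
      exact: Ucv.
    exact: cn.
  - by apply: (bounded_integrable (walk K0) (C := `|K + G * B|)) => // w.
  - by move=> k w _; exact: (react_bmeas (Uuv k)).2.
have c2 : avg (react (U k)) t x @[k --> \oo] --> K * u t x.
  have -> : (fun k => avg (react (U k)) t x) = (fun k => K * U k.+1 t x).
    by apply/funext => k; rewrite -TK.
  apply: cvgM; first exact: cvg_cst.
  by have := Ucv t x; rewrite -(cvg_shiftS (fun k => U k t x)); apply.
exact: (cvg_unique _ c2 c1).
Qed.

Variables (W Wt Wxx : R -> R -> R) (C T0 : R).
Hypothesis mW : measurable_fun setT (fun p : mR * mR => W p.1 p.2).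
Hypothesis mWh : forall t x, measurable_fun setT (fun w => K * W (t - life w) (x - Y w)
  + Wt (t - life w) (x - Y w) - Wxx (t - life w) (x - Y w)).
Hypothesis bWh : forall t x, t <= T0 -> `|K * W t x + Wt t x - Wxx t x| <= C.
Hypothesis Wrep : forall t x, t <= T0 ->
  \int[walk K0]_w (K * W (t - life w) (x - Y w) + Wt (t - life w) (x - Y w) - Wxx (t - life w) (x - Y w))
   = K * W t x.

Definition barrier (r : R) t x := if t <= T0 then clamp (W t x) else r.

Lemma barrier_unit_valued r : 0 <= r <= 1 -> unit_valued (barrier r).
Proof.
move=> r01; split; last by move=> t x; rewrite /barrier; case: ifP => // _; exact: clamp01.
have -> : (fun p : mR * mR => barrier r p.1 p.2) =
    (fun p => clamp (W p.1 p.2) * \1_`]-oo, T0] p.1 + r * (1 - \1_`]-oo, T0] p.1)).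
  apply/funext => p; rewrite /barrier indicE mem_setE in_itv/=.
  by case: ifP => _; rewrite ?subrr ?subr0 ?mulr0 ?mulr1 ?addr0 ?add0r.
have mi : measurable_fun setT (fun p : mR * mR => \1_`]-oo, T0] p.1 : R).
  apply: (@measurableT_comp _ _ _ _ _ _ (\1_`]-oo, T0] : mR -> R)); last exact: measurable_fst.
  exact: measurable_indic.
apply: measurable_funD; apply: measurable_funM => //; last exact: measurable_funB.
rewrite /clamp; apply: measurable_maxr => //; apply: measurable_minr => //.
Qed.

Let int_le (k : R -> R -> R) D t x : bmeas k D -> t <= T0 ->
  (forall w, K * W (t - life w) (x - Y w) + Wt (t - life w) (x - Y w) - Wxx (t - life w) (x - Y w)
     <= k (t - life w) (x - Y w)) -> K * W t x <= avg k t x.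
Proof.
move=> kD tT H; rewrite -Wrep//.
apply: (@average_le _ _ _ _ _ _ (Num.max C D)) => //.
- by move=> w; rewrite le_max bWh// (le_trans _ tT)// gerBl; exact: life_ge0.
- exact: (tavg_slice (@life_meas R) (@Y_meas R) t x kD).
- by move=> w; rewrite le_max kD.2 orbT.
Qed.

Let int_ge (k : R -> R -> R) D t x : bmeas k D -> t <= T0 ->
  (forall w, k (t - life w) (x - Y w) <=
   K * W (t - life w) (x - Y w) + Wt (t - life w) (x - Y w) - Wxx (t - life w) (x - Y w))
    -> avg k t x <= K * W t x.
Proof.
move=> kD tT H; rewrite -Wrep//.
apply: (@average_le _ _ _ _ _ _ (Num.max C D)) => //.
- exact: (tavg_slice (@life_meas R) (@Y_meas R) t x kD).
- by move=> w; rewrite le_max kD.2 orbT.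
- by move=> w; rewrite le_max bWh// (le_trans _ tT)// gerBl; exact: life_ge0.
Qed.

Lemma sub_barrier : (forall t x, t <= T0 -> W t x <= 1) ->
  (forall t x, t <= T0 -> Wt t x - Wxx t x <= ga x * n (W t x)) ->
  forall t x, K * barrier 0 t x <= avg (react (barrier 0)) t x.
Proof.
move=> W1 HW t x.
have r01 : 0 <= (0 : R) <= 1 by rewrite lexx ler01.
have uv := barrier_unit_valued r01; have /andP[A _] := react_itv t x uv.
rewrite {1}/barrier; case: ifPn => [tT|_]; last by rewrite mulr0.
have [W0|W0] := leP (W t x) 0; first by rewrite clamp_lt0// mulr0.
rewrite clamp_id ?(ltW W0) ?W1//.
apply: (int_le (react_bmeas uv) tT) => w.
have sT : t - life w <= T0 by rewrite (le_trans _ tT)// gerBl; exact: life_ge0.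
rewrite /react /barrier sT.
have := HW (t - life w) (x - Y w) sT.
have := Hmono (x - Y w) (_ : W (t - life w) (x - Y w) <= clamp (W (t - life w) (x - Y w))).
rewrite {1}/clamp le_max le_min lexx W1// orbT => /(_ isT); lra.
Qed.

Lemma super_barrier : (forall t x, t <= T0 -> 0 <= W t x) ->
  (forall t x, t <= T0 -> ga x * n (W t x) <= Wt t x - Wxx t x) ->
  forall t x, avg (react (barrier 1)) t x <= K * barrier 1 t x.
Proof.
move=> W1 HW t x.
have r01 : 0 <= (1 : R) <= 1 by rewrite lexx ler01.
have uv := barrier_unit_valued r01; have /andP[_ A] := react_itv t x uv.
rewrite {2}/barrier; case: ifPn => [tT|_]; last by rewrite mulr1.
have [W0|W0] := leP 1 (W t x); first by rewrite clamp_gt1// mulr1.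
rewrite clamp_id ?(ltW W0) ?W1//.
apply: (int_ge (react_bmeas uv) tT) => w.
have sT : t - life w <= T0 by rewrite (le_trans _ tT)// gerBl; exact: life_ge0.
rewrite /react /barrier sT.
have := HW (t - life w) (x - Y w) sT.
have := Hmono (x - Y w) (_ : clamp (W (t - life w) (x - Y w)) <= W (t - life w) (x - Y w)).
rewrite {1}/clamp ge_max ge_min lexx W1// => /(_ isT); lra.
Qed.

End comparison.

(** * Barriers built from the travelling wave *)

Section barriers.
Context {R : realType} (f : R -> R) (theta : R) (Hf : bistable f theta).
Variables (c : R) (phi : R -> R) (Hphi : travelling_wave f theta c phi).
Local Notation mu := (@lebesgue_measure R).
Local Notation mR := (measurableTypeR R).
Local Notation p := (phi^`())%classic.
Local Notation joint_meas G := (measurable_fun setT (fun p : mR * mR => G p.1 p.2)).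

Local Notation nl := (nl f).
Variables (L : R) (L0 : 0 < L).
Hypothesis nlL : forall v v', `|nl v' - nl v| <= L * `|v' - v|.
Hypothesis nlB : forall v, `|nl v| <= L.
Variables (a0 b0 : R) (a00 : 0 < a0) (ab0 : a0 < b0) (b01 : b0 < 1).
Hypothesis nla : forall v v', v <= v' -> v' <= a0 -> nl v' <= nl v.
Hypothesis nlb : forall v v', v <= v' -> b0 <= v -> nl v' <= nl v.
Variables (beta P C0 : R) (beta0 : 0 < beta) (P0 : 0 < P) (C00 : 0 < C0).
Hypothesis pbeta : forall z, a0 / 2 <= phi z <= (1 + b0) / 2 -> p z <= - beta.
Hypothesis pP : forall z, `|p z| <= P.
Hypothesis decay : forall z, phi z <= C0 * expR (- c * z).
Variables (gt : R -> R) (M kappa : R) (M0 : 0 <= M) (kappa0 : 0 < kappa).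
Hypothesis gtM : forall x, `|gt x| <= M.
Hypothesis gtk : forall x, `|gt x| <= expR (kappa * x).
Hypothesis gt1 : forall x, -1 <= gt x.

Let c0 : 0 < c := wave_speed_gt0 Hf Hphi.
Let nl_phi z : nl (phi z) = f (phi z). Proof. by rewrite /nl clamp_id// (wave01 Hphi). Qed.
Let p_le0 z : p z <= 0 := wave_slope_le0 Hf Hphi z.

(** Exponents and constants of the barriers. The two quantities in [rate] are the
    decay rates of the perturbation at [c t / 2] and of the profile at distance
    [- c t / 2] ahead of the front; [err] collects the constants of both estimates,
    and [ampl] solves [ampl' = err * exp (rate * t)]. The barriers are used up to
    the time [start], before which the drift is at most [1] and a change by
    [ampl] of a value near a stable state stays where [nl f] decreases. *)
Definition rate := Num.min (kappa * c / 2) (c ^+ 2 / 2).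
Definition err := L + M * (L * (C0 * expR c)).
Definition ampl t := err / rate * expR (rate * t).
Definition drift t := (1 + M) * L / (beta * rate) * ampl t.
Definition start := Num.min 0 (ln (Num.min (Num.min (a0 / 2) ((1 - b0) / 2))
  (beta * rate / ((1 + M) * L)) / (err / rate)) / rate).

Lemma rate_gt0 : 0 < rate.
Proof. by rewrite lt_min !divr_gt0 ?mulr_gt0 ?exprn_gt0. Qed.

Lemma err_gt0 : 0 < err.
Proof. by rewrite ltr_wpDr// !mulr_ge0// ?expR_ge0// ltW. Qed.

Lemma ampl_gt0 t : 0 < ampl t.
Proof. by rewrite !mulr_gt0 ?invr_gt0 ?expR_gt0 ?rate_gt0 ?err_gt0. Qed.

Let M1 : 0 < 1 + M. Proof. by rewrite ltr_wpDr. Qed.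

Lemma drift_gt0 t : 0 < drift t.
Proof. by rewrite mulr_gt0 ?ampl_gt0// divr_gt0 ?mulr_gt0 ?rate_gt0. Qed.

Lemma start_le0 : start <= 0. Proof. by rewrite ge_min lexx. Qed.

Lemma ampl_small t : t <= start -> [/\ ampl t <= a0 / 2, ampl t <= (1 - b0) / 2 & drift t <= 1].
Proof.
move=> tT; set m := Num.min (Num.min (a0 / 2) ((1 - b0) / 2)) (beta * rate / ((1 + M) * L)).
have r0 := rate_gt0; have e0 := err_gt0.
have m0 : 0 < m by rewrite !lt_min !divr_gt0 ?subr_gt0 ?mulr_gt0.
have am : ampl t <= m.
  rewrite /ampl mulrC -ler_pdivlMr ?divr_gt0// -[leRHS]lnK ?posrE ?divr_gt0// ler_expR.
  rewrite mulrC -ler_pdivlMr// (le_trans tT)// /start ge_min lexx orbT//.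
have m1 : m <= a0 / 2 by rewrite /m !ge_min lexx.
have m2 : m <= (1 - b0) / 2 by rewrite /m !ge_min lexx orbT.
have m3 : m <= beta * rate / ((1 + M) * L) by rewrite /m !ge_min lexx !orbT.
split; [exact: le_trans am m1|exact: le_trans am m2|].
have ML : 0 < (1 + M) * L by rewrite mulr_gt0.
have br : 0 < beta * rate by rewrite mulr_gt0.
rewrite /drift -ler_pdivlMl ?divr_gt0// mulr1 invf_div; exact: le_trans am m3.
Qed.

Let f0 : f 0 = 0. Proof. by case: Hf => _ _ []. Qed.
Let f1 : f 1 = 0. Proof. by case: Hf => _ _ []. Qed.

(** To the left of [c t / 2] the perturbation is exponentially small as [t -> -oo];
    to the right of it the front, located at [c t], is far behind and the profile
    is exponentially small. *)
Lemma perturbation_small t x s : t <= start -> s <= 1 ->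
  `|gt x * f (phi (x - c * t - s))| <= rate * ampl t.
Proof.
move=> tT s1; have r0 := rate_gt0.
have t0 : t <= 0 := le_trans tT start_le0.
have -> : rate * ampl t = L * expR (rate * t) + M * (L * (C0 * expR c)) * expR (rate * t).
  by rewrite /ampl /err; field; exact: lt0r_neq0.
have eb : 0 <= expR (rate * t) by exact: expR_ge0.
have fB z : `|f (phi z)| <= L by rewrite -nl_phi.
have fv z : `|f (phi z)| <= L * phi z.
  have := nlL 0 (phi z); rewrite nl_phi /nl (clamp_lt0 (lexx 0)) f0 !subr0.
  by have /andP[a _] := wave01 Hphi z; rewrite (ger0_norm a).
rewrite normrM; have [xt|xt] := leP x (c * t / 2).
  apply: (@le_trans _ _ (L * expR (rate * t))); last first.
    by rewrite lerDl !mulr_ge0 ?expR_ge0// ltW.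
  rewrite mulrC; apply: ler_pM => //; apply: (le_trans (gtk x)); rewrite ler_expR.
  apply: (@le_trans _ _ (kappa * (c * t / 2))); first by apply: ler_wpM2l => //; exact: ltW.
  rewrite (_ : kappa * (c * t / 2) = (kappa * c / 2) * t); last by field.
  by apply: ler_wnM2r => //; rewrite ge_min lexx.
apply: (@le_trans _ _ (M * (L * (C0 * expR c)) * expR (rate * t))); last first.
  by rewrite lerDr mulr_ge0// ltW.
rewrite -mulrA; apply: ler_pM => //; apply: (le_trans (fv _)).
rewrite -mulrA; apply: ler_wpM2l; first exact: ltW.
apply: (le_trans (decay _)); rewrite -mulrA -expRD; apply: ler_wpM2l; first exact: ltW.
rewrite ler_expR.
have cs : c * s <= c by rewrite ger_pMr.
have h1 : - c * x <= - c * (c * t / 2) by rewrite !mulNr lerN2; apply: ler_wpM2l; exact: ltW.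
have h2 : c ^+ 2 / 2 * t <= rate * t by apply: ler_wnM2r => //; rewrite ge_min lexx orbT.
rewrite (_ : - c * (x - c * t - s) = - c * x + c ^+ 2 * t + c * s); last by ring.
have h3 : - c * (c * t / 2) = - (c ^+ 2 / 2 * t) by field.
have h4 : c ^+ 2 * t = c ^+ 2 / 2 * t + c ^+ 2 / 2 * t by field.
rewrite h4; lra.
Qed.

Section one_side.
(** [sg = 1] gives the upper barrier, [sg = -1] the lower one. *)
Variables (sg : R) (sg1 : sg = 1 \/ sg = -1).

Definition comoving t x := x - c * t - sg * drift t.
Definition profile t x := phi (comoving t x) + sg * ampl t.
Definition profile_t t x := - (c + sg * (rate * drift t)) * p (comoving t x) + sg * (rate * ampl t).
Definition profile_x t x := p (comoving t x).
Definition profile_xx t x := - c * p (comoving t x) - f (phi (comoving t x)).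

Let dphi z : is_derive z (1 : R) phi (p z) := wave_derive Hphi z.
Let dp z : is_derive z (1 : R) p (- c * p z - f (phi z)) := wave_derive2 Hphi z.

Lemma ampl_derive t : is_derive t (1 : R) ampl (rate * ampl t).
Proof.
have dE : is_derive t (1 : R) (fun t => expR (rate * t)) (rate * expR (rate * t)).
  by have := is_derive1_comp (is_derive_expR (rate * t)) (is_derive_lin rate t); rewrite mulrC; apply.
by apply: is_derive_eq (is_derive_scale (err / rate) dE) _; rewrite /ampl [RHS]mulrCA.
Qed.

Lemma drift_derive t : is_derive t (1 : R) drift (rate * drift t).
Proof.
apply: is_derive_eq (is_derive_scale ((1 + M) * L / (beta * rate)) (ampl_derive t)) _.
by rewrite /drift [RHS]mulrCA.
Qed.

Lemma comoving_derive_t t x : is_derive t (1 : R) (comoving^~ x) (- (c + sg * (rate * drift t))).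
Proof.
apply: is_derive_eq (is_deriveB (is_deriveB (is_derive_cst x t 1) (is_derive_lin c t))
  (is_derive_scale sg (drift_derive t))) _.
by rewrite sub0r opprD.
Qed.

Lemma profile_derive_t t x : is_derive t (1 : R) (profile^~ x) (profile_t t x).
Proof.
have d1 : is_derive t (1 : R) (fun t => phi (comoving t x)) (p (comoving t x) * - (c + sg * (rate * drift t))).
  have h1 := dphi (comoving t x); have h2 := comoving_derive_t t x.
  by have := @is_derive1_comp R phi (comoving^~ x) t; apply.
by apply: is_derive_eq (is_deriveD d1 (is_derive_scale sg (ampl_derive t))) _; rewrite /profile_t [p _ * _]mulrC.
Qed.

Let comoving_shift (g : R -> R) g' t x : (forall z : R, is_derive z (1 : R) g (g' z)) ->
  is_derive x (1 : R) (fun x => g (comoving t x)) (g' (comoving t x)).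
Proof.
move=> dg; have := @translate_derive R g (- (c * t) - sg * drift t) x (g' (comoving t x)).
rewrite addrA -/(comoving t x) => /(_ (dg _)).
by rewrite (_ : (fun s => _) = (fun x => g (comoving t x)))//; apply/funext => y; rewrite /comoving addrA.
Qed.

Lemma profile_derive_x t x : is_derive x (1 : R) (profile t) (profile_x t x).
Proof.
by apply: is_derive_eq (is_deriveD (comoving_shift t x dphi) (is_derive_cst (sg * ampl t) x 1)) _; rewrite addr0.
Qed.

Lemma profile_derive_xx t x : is_derive x (1 : R) (profile_x t) (profile_xx t x).
Proof. exact: (comoving_shift t x dp). Qed.

Let ampl_cont : continuous ampl := is_derive_cont ampl_derive.
Let drift_cont : continuous drift := is_derive_cont drift_derive.

Let comoving_cont : continuous (fun q : R * R => comoving q.1 q.2).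
Proof.
move=> q; apply: cvgB; [apply: cvgB|].
- exact: cvg_snd.
- by apply: cvgM; [exact: cvg_cst|exact: cvg_fst].
- apply: cvgM; first exact: cvg_cst.
  by apply: (@continuous_comp _ _ _ (@fst R R) drift); [exact: cvg_fst|exact: drift_cont].
Qed.

Let comp_frame (g : R -> R) : continuous g -> continuous (fun q : R * R => g (comoving q.1 q.2)).
Proof.
by move=> cg q; apply: (@continuous_comp _ _ _ (fun q : R * R => comoving q.1 q.2) g); [exact: comoving_cont|exact: cg].
Qed.

Let comp_time (g : R -> R) : continuous g -> continuous (fun q : R * R => g q.1).
Proof. by move=> cg q; apply: (@continuous_comp _ _ _ (@fst R R) g); [exact: cvg_fst|exact: cg]. Qed.

Let cphi : continuous phi := is_derive_cont dphi.
Let cp : continuous p := is_derive_cont dp.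
Let nl_cont : continuous nl := lipschitz_continuous nlL.
Let cfphi : continuous (fun z => f (phi z)).
Proof.
rewrite (_ : (fun z => _) = nl \o phi); last by apply/funext => z; rewrite /= nl_phi.
by move=> z; apply: continuous_comp; [exact: cphi|exact: nl_cont].
Qed.
Let cd2 : continuous (fun z => - c * p z - f (phi z)).
Proof. by move=> z; apply: cvgB; [apply: cvgM; [exact: cvg_cst|exact: cp]|exact: cfphi]. Qed.
Let ct2 : continuous (fun t => - (c + sg * (rate * drift t))).
Proof.
move=> t; apply: cvgN; apply: cvgD; first exact: cvg_cst.
by apply: cvgM; [exact: cvg_cst|apply: cvgM; [exact: cvg_cst|exact: drift_cont]].
Qed.

Lemma profile_cont : [/\ continuous (fun q : R * R => profile q.1 q.2),
  continuous (fun q : R * R => profile_t q.1 q.2),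
  continuous (fun q : R * R => profile_x q.1 q.2) &
  continuous (fun q : R * R => profile_xx q.1 q.2)].
Proof.
split => q.
- apply: cvgD; first exact: (comp_frame cphi).
  by apply: cvgM; [exact: cvg_cst|exact: (comp_time ampl_cont)].
- apply: cvgD; first by apply: cvgM; [exact: (comp_time ct2)|exact: (comp_frame cp)].
  by apply: cvgM; [exact: cvg_cst|apply: cvgM; [exact: cvg_cst|exact: (comp_time ampl_cont)]].
- exact: (comp_frame cp).
- exact: (comp_frame cd2).
Qed.

Let mframe : joint_meas comoving.
Proof.
apply: measurable_funB; first apply: measurable_funB; first exact: measurable_snd.
- by apply: measurable_funM => //; exact: measurable_fst.
- apply: measurable_funM => //.
  by apply: (measurableT_comp (f := drift)); [exact: continuous_measurable_fun|exact: measurable_fst].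
Qed.

Let mcomp_frame (g : R -> R) : continuous g -> joint_meas (fun t x => g (comoving t x)).
Proof.
by move=> cg; apply: (measurableT_comp (f := g)); [exact: continuous_measurable_fun|exact: mframe].
Qed.

Let mcomp_time (g : R -> R) : continuous g -> measurable_fun setT (fun q : mR * mR => g q.1).
Proof.
by move=> cg; apply: (measurableT_comp (f := g)); [exact: continuous_measurable_fun|exact: measurable_fst].
Qed.

Lemma profile_meas : [/\ joint_meas profile, joint_meas profile_t, joint_meas profile_x & joint_meas profile_xx].
Proof.
split.
- apply: measurable_funD; first exact: (mcomp_frame cphi).
  by apply: measurable_funM => //; exact: (mcomp_time ampl_cont).
- apply: measurable_funD.
    by apply: measurable_funM; [exact: (mcomp_time ct2)|exact: (mcomp_frame cp)].
  by apply: measurable_funM => //; apply: measurable_funM => //; exact: (mcomp_time ampl_cont).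
- exact: (mcomp_frame cp).
- exact: (mcomp_frame cd2).
Qed.

Let nsg : `|sg| = 1. Proof. by case: sg1 => ->; rewrite ?normrN normr1. Qed.

Definition profile_bound := 2 + ((c + rate) * P + rate) + P + (c * P + L).

Lemma profile_bounded t x : t <= start ->
  [/\ `|profile t x| <= profile_bound, `|profile_t t x| <= profile_bound,
      `|profile_x t x| <= profile_bound & `|profile_xx t x| <= profile_bound].
Proof.
move=> tT; have [A1 A2 A3] := ampl_small tT.
have A0 := ampl_gt0 t; have S0 := drift_gt0 t; have r0 := rate_gt0.
have a1 : ampl t <= 1 by have := A2; have := a00; have := ab0; lra.
have pf := pP (comoving t x); have /andP[v0 v1] := wave01 Hphi (comoving t x).
have B1 : 0 <= (c + rate) * P by rewrite mulr_ge0 ?(ltW P0)// addr_ge0// ltW.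
have B2 : 0 <= c * P by rewrite mulr_ge0 ?(ltW P0)// ltW.
have rP : 0 <= rate * P by rewrite mulr_ge0 ?(ltW P0)// ltW.
rewrite /profile_bound; split.
- have : `|profile t x| <= 1 + 1.
    have e1 : `|sg * ampl t| <= 1 by rewrite normrM nsg mul1r gtr0_norm.
    by rewrite (le_trans (ler_normD _ _))// lerD// ger0_norm.
  by have := P0; have := L0; lra.
- have : `|profile_t t x| <= (c + rate) * P + rate.
    rewrite (le_trans (ler_normD _ _))// lerD//.
      rewrite normrM normrN; apply: ler_pM => //; rewrite (le_trans (ler_normD _ _))// (gtr0_norm c0) lerD2l.
      by rewrite normrM nsg mul1r normrM (gtr0_norm r0) (gtr0_norm S0) ger_pMr.
    by rewrite normrM nsg mul1r normrM (gtr0_norm r0) (gtr0_norm A0) ger_pMr.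
  by have := P0; have := L0; lra.
- by rewrite /profile_x; have := L0; lra.
- have : `|profile_xx t x| <= c * P + L.
    rewrite (le_trans (ler_normB _ _))// lerD//; last by rewrite -nl_phi.
    by rewrite normrM normrN (gtr0_norm c0); apply: ler_wpM2l => //; exact: ltW.
  by have := P0; lra.
Qed.

(** Three effects are balanced. The growth of the amplitude, [rate * ampl], pays for
    the perturbation [gt * f phi]. Near the two stable states [nl f] decreases, so
    moving the value by [sg * ampl] has the right sign. In the middle of the front
    that move costs at most [(1 + M) * L * ampl], which is what the drift earns
    because the slope is at most [- beta] there. *)
Lemma profile_defect t x : t <= start ->
  0 <= sg * (profile_t t x - profile_xx t x - (1 + gt x) * nl (profile t x)).
Proof.
move=> tT; have [A1 A2 A3] := ampl_small tT.
have r0 := rate_gt0; have S0 := drift_gt0 t.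
have ss : sg * drift t <= 1 by case: sg1 => ->; rewrite ?mul1r ?mulN1r//; lra.
have E := perturbation_small x tT ss; rewrite -/(comoving t x) in E.
set z := comoving t x in E *; set q := ampl t in E A1 A2 *.
have q0 : 0 < q := ampl_gt0 t.
have X : rate * drift t = (1 + M) * L * q / beta.
  by rewrite /drift -/q; field; rewrite !gt_eqF.
have X0 : 0 < rate * drift t by rewrite mulr_gt0.
have pz := p_le0 z.
have [G0 G1] : 0 <= 1 + gt x /\ 1 + gt x <= 1 + M.
  by have := gtM x; rewrite ler_norml => /andP[_ h]; have := gt1 x; split; lra.
have sg2 : sg * sg = 1 by case: sg1 => ->; ring.
have D1 : profile_t t x - profile_xx t x - (1 + gt x) * nl (profile t x) =
   sg * (- (rate * drift t * p z)) + sg * (rate * q) - gt x * f (phi z) +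
   (1 + gt x) * (f (phi z) - nl (phi z + sg * q)).
  by rewrite /profile_t /profile_xx /profile -/z -/q; ring.
rewrite D1.
have -> : sg * (sg * (- (rate * drift t * p z)) + sg * (rate * q) - gt x * f (phi z) +
   (1 + gt x) * (f (phi z) - nl (phi z + sg * q))) =
   (rate * drift t * (- p z)) + (rate * q - sg * (gt x * f (phi z))) +
   (1 + gt x) * (sg * (f (phi z) - nl (phi z + sg * q))).
  move: (f (phi z)) (nl _) (p z) (rate * drift t) (rate * q) => *.
  by case: sg1 => ->; ring.
have E2 : 0 <= rate * q - sg * (gt x * f (phi z)).
  rewrite subr_ge0 (le_trans _ E)// (le_trans (ler_norm _))//.
  by rewrite normrM nsg mul1r.
have [/andP[z1 z2]|zout] := boolP (a0 / 2 <= phi z <= (1 + b0) / 2).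
  have pb : beta <= - p z by rewrite lerNr; apply: pbeta; rewrite z1.
  have T1 : (1 + M) * L * q <= rate * drift t * - p z.
    have -> : (1 + M) * L * q = rate * drift t * beta by rewrite X; field; rewrite gt_eqF.
    by apply: ler_wpM2l => //; exact: ltW.
  have T2 : `|(1 + gt x) * (sg * (f (phi z) - nl (phi z + sg * q)))| <= (1 + M) * L * q.
    rewrite !normrM nsg mul1r (ger0_norm G0) -mulrA; apply: ler_pM => //.
    rewrite distrC -nl_phi (le_trans (nlL _ _))// addrAC subrr add0r normrM nsg mul1r gtr0_norm//.
  by move: T2; rewrite ler_norml => /andP[]; lra.
have T0 : 0 <= rate * drift t * - p z by rewrite mulr_ge0 ?oppr_ge0// ltW.
suff : 0 <= sg * (f (phi z) - nl (phi z + sg * q)).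
  by move=> H; have := mulr_ge0 G0 H; lra.
rewrite -nl_phi; move: zout; rewrite negb_and -!ltNge => zout.
case: sg1 => ->; rewrite ?mul1r ?mulN1r ?opprB subr_ge0; case/orP: zout => zo;
  [apply: nla|apply: nlb|apply: nla|apply: nlb]; lra.
Qed.

Variables (K : R) (K0 : 0 < K).
Lemma profile_representation t x : t <= start ->
  \int[walk K0]_w (K * profile (t - life w) (x - Y w) + profile_t (t - life w) (x - Y w)
    - profile_xx (t - life w) (x - Y w)) = K * profile t x.
Proof.
move=> tT; have [c1 c2 c3 c4] := profile_cont; have [m1 m2 m3 m4] := profile_meas.
apply: (@smooth_representation R K K0 profile profile_t profile_x profile_xx profile_bound start) => //.
- exact: profile_derive_t.
- exact: profile_derive_x.
- exact: profile_derive_xx.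
- by move=> s y sT; have [] := profile_bounded y sT.
- by move=> s y sT; have [] := profile_bounded y sT.
- by move=> s y sT; have [] := profile_bounded y sT.
- by move=> s y sT; have [] := profile_bounded y sT.
Qed.

Lemma profile_source_meas t x : measurable_fun setT (fun w => K * profile (t - life w) (x - Y w)
  + profile_t (t - life w) (x - Y w) - profile_xx (t - life w) (x - Y w)).
Proof.
have [m1 m2 _ m4] := profile_meas.
have ms : measurable_fun setT (fun w => t - @life R w) by apply: measurable_funB => //; exact: life_meas.
have my : measurable_fun setT (fun w => x - @Y R w) by apply: measurable_funB => //; exact: Y_meas.
apply: measurable_funB; last exact: joint_meas_comp.
by apply: measurable_funD; [apply: measurable_funM => //|]; exact: joint_meas_comp.
Qed.

Lemma profile_source_bounded t x : t <= start ->
  `|K * profile t x + profile_t t x - profile_xx t x| <= (K + 2) * profile_bound.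
Proof.
move=> tT; have [b1 b2 _ b4] := profile_bounded x tT.
rewrite [X in _ <= X](_ : _ = K * profile_bound + profile_bound + profile_bound); last by ring.
rewrite (le_trans (ler_normB _ _))//; apply: lerD => //; rewrite (le_trans (ler_normD _ _))//; apply: lerD => //.
by rewrite normrM (gtr0_norm K0); apply: ler_wpM2l => //; exact: ltW.
Qed.

End one_side.

Variables (K : R) (K0 : 0 < K) (KL : (1 + M) * L <= K).
Hypothesis mgt : measurable_fun setT (gt : mR -> R).
Let ga x := 1 + gt x.
Let mga : measurable_fun setT (ga : mR -> R). Proof. exact: measurable_funD. Qed.

Let gaM x : `|ga x| <= 1 + M.
Proof.
rewrite ger0_norm; last by have := gt1 x; rewrite /ga; lra.
by rewrite lerD2l (le_trans (ler_norm _)).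
Qed.

Let Hmono x v v' : v <= v' -> K * v + ga x * nl v <= K * v' + ga x * nl v'.
Proof.
move=> vv; rewrite -subr_ge0.
have -> : K * v' + ga x * nl v' - (K * v + ga x * nl v) = K * (v' - v) + ga x * (nl v' - nl v) by ring.
have v0 : 0 <= v' - v by rewrite subr_ge0.
have H : `|ga x * (nl v' - nl v)| <= (1 + M) * L * (v' - v).
  rewrite normrM -mulrA; apply: ler_pM => //; have := nlL v v'.
  by rewrite [`|v' - v|]ger0_norm.
have H2 : (1 + M) * L * (v' - v) <= K * (v' - v) by exact: ler_wpM2r.
by move: H; rewrite ler_norml => /andP[H _]; lra.
Qed.

Let n0 : nl 0 = 0. Proof. by rewrite /nl clamp_lt0. Qed.
Let n1 : nl 1 = 0. Proof. by rewrite /nl clamp_gt1. Qed.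
Let cnl : continuous nl := lipschitz_continuous nlL.
Let mnl : measurable_fun setT (nl : mR -> R). Proof. exact: continuous_measurable_fun. Qed.

Let wave_diff (x y : R) : `|phi x - phi y| <= P * `|x - y|.
Proof. exact: derive_bound_lip (wave_derive Hphi) pP. Qed.

Let wave_decr (x y : R) : x <= y -> phi y <= phi x.
Proof. by move=> xy; apply: (derive_le0 (wave_derive Hphi) xy) => z _; exact: p_le0. Qed.

(** The two barriers are ordered because the profile decreases, and they pinch the
    wave as [t -> -oo]. *)
Lemma entire_fixed_point : exists u, [/\ unit_valued u,
  forall t x, t <= start -> `|u t x - phi (x - c * t)| <= ampl t + P * drift t &
  forall t x, K * u t x = tavg (walk K0) (@life R) (@Y R) (react K nl ga u) t x].
Proof.
have [mu1 _ _ _] := profile_meas 1; have [mu_1 _ _ _] := profile_meas (-1).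
pose s0 := barrier (profile (-1)) start 0; pose s1 := barrier (profile 1) start 1.
have u0 : unit_valued s0 by apply: barrier_unit_valued => //; rewrite lexx ler01.
have u1 : unit_valued s1 by apply: barrier_unit_valued => //; rewrite lexx ler01.
have sgp : (1 : R) = 1 \/ (1 : R) = -1 by left.
have sgn : (-1 : R) = 1 \/ (-1 : R) = -1 by right.
have A0 := ampl_gt0; have S0 := drift_gt0.
have s01 t x : s0 t x <= s1 t x.
  rewrite /s0 /s1 /barrier; case: ifP => _ //.
  apply: clamp_le; rewrite /profile; apply: lerD; last by have := A0 t; lra.
  by apply: wave_decr; rewrite /comoving; have := S0 t; lra.
have hsub t x : K * s0 t x <= tavg (walk K0) (@life R) (@Y R) (react K nl ga s0) t x.
  apply: (@sub_barrier R K K0 nl ga L (1 + M) mnl nlB mga gaM Hmono n0 n1 _ _ _ _ start mu_1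
    (profile_source_meas (-1) K) (profile_source_bounded sgn K0) (profile_representation sgn K0)).
  - move=> s y _; have /andP[_ h] := wave01 Hphi (comoving (-1) s y); rewrite /profile.
    by have := A0 s; lra.
  - by move=> s y sT; have := profile_defect sgn y sT; rewrite mulN1r oppr_ge0 subr_le0.
have hsup t x : tavg (walk K0) (@life R) (@Y R) (react K nl ga s1) t x <= K * s1 t x.
  apply: (@super_barrier R K K0 nl ga L (1 + M) mnl nlB mga gaM Hmono n0 n1 _ _ _ _ start mu1
    (profile_source_meas 1 K) (profile_source_bounded sgp K0) (profile_representation sgp K0)).
  - move=> s y _; have /andP[h _] := wave01 Hphi (comoving 1 s y); rewrite /profile.
    by have := A0 s; lra.
  - by move=> s y sT; have := profile_defect sgp y sT; rewrite mul1r subr_ge0.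
have [u [uu su Ku]] := @monotone_fixed_point R K K0 nl ga L (1 + M) mnl cnl nlB mga gaM Hmono n0 n1
  s0 s1 u0 u1 s01 hsub hsup.
exists u; split => // t x tT.
have /andP[h0 h1] := su t x; move: h0 h1; rewrite /s0 /s1 /barrier tT.
have v1 := wave01 Hphi (comoving 1 t x); have v2 := wave01 Hphi (comoving (-1) t x).
have d1 := wave_diff (comoving 1 t x) (x - c * t); have d2 := wave_diff (comoving (-1) t x) (x - c * t).
have e1 : `|comoving 1 t x - (x - c * t)| = drift t.
  by rewrite /comoving addrAC subrr add0r mul1r normrN gtr0_norm.
have e2 : `|comoving (-1) t x - (x - c * t)| = drift t.
  by rewrite /comoving addrAC subrr add0r mulN1r opprK gtr0_norm.
rewrite e1 in d1; rewrite e2 in d2.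
have c1 : clamp (profile 1 t x) <= profile 1 t x.
  by rewrite /clamp ge_max ge_min lexx /= andbT /profile mul1r addr_ge0 ?(ltW (A0 t))//; case/andP: v1.
have c2 : profile (-1) t x <= clamp (profile (-1) t x).
  rewrite /clamp le_max le_min lexx /= (_ : profile _ _ _ <= 1) ?orbT// /profile.
  by have := A0 t; case/andP: v2 => _; lra.
move=> h0 h1; move: d1 d2 c1 c2; rewrite !ler_norml => /andP[d1 d1'] /andP[d2 d2']; rewrite /profile => c1 c2.
by apply/andP; split; lra.
Qed.

End barriers.

Section existence.
Context {R : realType} (f : R -> R) (theta : R) (Hf : bistable f theta).
Variables (c : R) (phi : R -> R) (Hphi : travelling_wave f theta c phi).
Local Notation mu := (@lebesgue_measure R).
Local Notation mR := (measurableTypeR R).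

Theorem entire_solution (gt : R -> R) (M kappa : R) : 0 <= M -> 0 < kappa ->
  measurable_fun setT (gt : mR -> R) ->
  (forall x, `|gt x| <= M) -> (forall x, `|gt x| <= expR (kappa * x)) -> (forall x, -1 <= gt x) ->
  exists u, strong_solution f gt u /\ exists A r T : R, [/\ 0 <= A, 0 < r &
    forall t x, t <= T -> `|u t x - phi (x - c * t)| <= A * expR (r * t)].
Proof.
move=> M0 kappa0 mgt gtM gtk gt1.
have [L [M2 [[L0 M20] nlLL nlL nl'M nlT]]] := nl_lipschitz Hf.
have nlB v : `|nl f v| <= L by have [] := nlLL v.
have nl'B v : `|nl' f v| <= L by have [] := nlLL v.
have [a0 [b0 [a00 ab0 b01 nla nlb]]] := stable_ends Hf.
have a20 : 0 < a0 / 2 by lra.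
have b20 : (1 + b0) / 2 < 1 by lra.
have [beta beta0 pbeta] := wave_middle_slope Hf Hphi a20 b20.
have [P P0 pP] := wave_slope_bounded Hf Hphi.
have [C0 C00 decay] := wave_decay Hf Hphi.
have M1 : 0 <= 1 + M by rewrite addr_ge0.
(* large enough for the source to be monotone *)
pose K := (1 + M) * L + 1; have K0 : 0 < K by rewrite ltr_wpDl// mulr_ge0// ltW.
have KL : (1 + M) * L <= K by rewrite lerDl.
have [u [[mu_ u01] near_ Ku]] := entire_fixed_point Hf Hphi L0 nlL nlB a00 ab0 b01 nla nlb
  beta0 P0 C00 pbeta pP decay M0 kappa0 gtM gtk gt1 K0 KL mgt.
have mga : measurable_fun setT ((fun x => 1 + gt x) : mR -> R) by exact: measurable_funD.
have gaM x : `|1 + gt x| <= 1 + M by rewrite (le_trans (ler_normD _ _))// normr1 lerD2l.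
have [cu [vt [vx [dvt dvx [cvt cvx] lvx aevx]]]] := @fixed_point_regularity R K K0 (nl f) (nl' f)
  (fun x => 1 + gt x) L M2 L (1 + M) u (ltW L0) (ltW M20) M1 nlB nlL nl'B nl'M nlT mga gaM mu_ u01 Ku.
have {lvx} [Lx lvx] : exists Lx : R, forall t x y, `|vx t x - vx t y| <= Lx * `|x - y|.
  by eexists; exact: lvx.
have Et (t x : R) : ((fun s : R => u s x)^`())%classic t = vt t x.
  by rewrite derive1E (@derive_val _ _ _ _ _ _ _ (dvt t x)).
have Ex t : ((u t)^`())%classic = vx t.
  by apply/funext => x; rewrite derive1E (@derive_val _ _ _ _ _ _ _ (dvx t x)).
exists u; split; first split.
- by split.
- split; first by move=> t x; exact: (@ex_derive _ _ _ _ _ _ _ (dvt t x)).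
  by rewrite (_ : (fun _ => _) = (fun q : R * R => vt q.1 q.2))//; apply/funext => q; exact: Et.
- split; first by move=> t x; exact: (@ex_derive _ _ _ _ _ _ _ (dvx t x)).
  by rewrite (_ : (fun _ => _) = (fun q : R * R => vx q.1 q.2))//; apply/funext => q; rewrite Ex.
- move=> t a b; rewrite Ex; exists Lx; split; first exact: num_real.
  move=> N LN [x y] _ /=; apply: (le_trans (lvx t x y)); apply: ler_wpM2r => //.
  exact: ltW LN.
- move=> t; apply: filterS (aevx t); first exact: (ae_filter_ringOfSetsType mu).
  move=> x [d1 d2]; rewrite Et /derive1n/= Ex; split => //.
  by rewrite d2 mulrC /nl clamp_id.
set T0 := start _ _ _ _ _ _ _ _ in near_.
set B := (1 + M) * L / (beta * rate c kappa).
have r0 := rate_gt0 Hf Hphi kappa0.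
have e0 : 0 < err c L C0 M by apply: err_gt0.
have B0 : 0 <= B by rewrite !mulr_ge0 ?invr_ge0 ?mulr_ge0// ltW.
exists ((1 + P * B) * (err c L C0 M / rate c kappa)), (rate c kappa), T0; split => //.
  apply: mulr_ge0; last by apply: divr_ge0; exact: ltW.
  by apply: addr_ge0 => //; apply: mulr_ge0 => //; exact: ltW.
move=> t x tT; apply: (le_trans (near_ t x tT)).
by rewrite /drift -/B /ampl le_eqVlt; apply/orP; left; apply/eqP; ring.
Qed.

End existence.

(** * The spectral gap is at most the sup norm of the derivative *)

Section lorentz.
Context {R : realType}.
Implicit Types (x y : R).

(** A test function all of whose derivatives are dominated by itself: this makes the
    membership of its dilates in the domain of the operator elementary. *)
Definition lorentz y : R := (1 + y ^+ 2)^-1.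
Definition lorentz1 y : R := - 2 * y * lorentz y ^+ 2.
Definition lorentz2 y : R := - 2 * lorentz y ^+ 2 + 8 * y ^+ 2 * lorentz y ^+ 3.
Definition lorentz3 y : R := 24 * y * lorentz y ^+ 3 - 48 * y ^+ 3 * lorentz y ^+ 4.

Lemma lorentz_den y : 0 < 1 + y ^+ 2. Proof. by rewrite ltr_wpDr// sqr_ge0. Qed.
Lemma lorentz_gt0 y : 0 < lorentz y. Proof. by rewrite invr_gt0 lorentz_den. Qed.

Lemma lorentz_le y : [/\ lorentz y <= 1, `|y| * lorentz y <= 1 & y ^+ 2 * lorentz y <= 1].
Proof.
have d := lorentz_den y; have s : y ^+ 2 = `|y| ^+ 2 by rewrite real_normK ?num_real.
split; rewrite /lorentz ?ler_pdivrMr ?invf_le1// ?mul1r ?lerDl ?sqr_ge0// ?lerDr//.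
by rewrite s; have := sqr_ge0 (`|y| - 1); rewrite !expr2; nra.
Qed.

Lemma is_derive_sqr x : is_derive x (1 : R) (fun y => y ^+ 2) (2 * x).
Proof.
rewrite (_ : (fun y => y ^+ 2) = (fun y => y * y)); last by apply/funext => y; rewrite expr2.
apply: is_derive_eq (is_deriveM (is_derive_id x 1) (is_derive_id x 1)) _.
by rewrite -[LHS]/(x * 1 + x * 1); ring.
Qed.

Lemma lorentz_derive x : is_derive x (1 : R) lorentz (lorentz1 x).
Proof.
have d1 : is_derive x (1 : R) (fun y => 1 + y ^+ 2) (2 * x).
  by apply: is_derive_eq (is_deriveD (is_derive_cst (1 : R) x 1) (is_derive_sqr x)) _; rewrite add0r.
have nz : (1 + x ^+ 2) != 0 by rewrite gt_eqF// lorentz_den.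
have := @is_deriveV R (fun y => 1 + y ^+ 2) x (2 * x) (1 : R) nz d1.
rewrite (_ : _ *: _ = lorentz1 x)//.
by rewrite /lorentz1 /lorentz -[LHS]/(- (1 + x ^+ 2) ^- 2 * (2 * x)) exprVn; ring.
Qed.

Lemma lorentz1_derive x : is_derive x (1 : R) lorentz1 (lorentz2 x).
Proof.
have d1 : is_derive x (1 : R) (fun y => lorentz y * lorentz y) (2 * (lorentz x * lorentz1 x)).
  by apply: is_derive_eq (is_deriveM (lorentz_derive x) (lorentz_derive x)) _; rewrite -[LHS]/(lorentz x * lorentz1 x + lorentz x * lorentz1 x); ring.
have d2 : is_derive x (1 : R) (fun y => - 2 * y) (- 2).
  exact: is_derive_lin.
apply: is_derive_eq (is_deriveM d2 d1) _.
by rewrite /lorentz2 /lorentz1 -[LHS]/(- 2 * x * (2 * (lorentz x * (- 2 * x * lorentz x ^+ 2))) + lorentz x * lorentz x * - 2); ring.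
Qed.

Lemma lorentz2_derive x : is_derive x (1 : R) lorentz2 (lorentz3 x).
Proof.
have d1 : is_derive x (1 : R) (fun y => lorentz y * lorentz y) (2 * (lorentz x * lorentz1 x)).
  by apply: is_derive_eq (is_deriveM (lorentz_derive x) (lorentz_derive x)) _; rewrite -[LHS]/(lorentz x * lorentz1 x + lorentz x * lorentz1 x); ring.
have d3 : is_derive x (1 : R) (fun y => lorentz y * lorentz y * lorentz y) (3 * (lorentz x * lorentz x * lorentz1 x)).
  by apply: is_derive_eq (is_deriveM d1 (lorentz_derive x)) _; rewrite -[LHS]/(lorentz x * lorentz x * lorentz1 x + lorentz x * (2 * (lorentz x * lorentz1 x))); ring.
have d4 : is_derive x (1 : R) (fun y => 8 * y ^+ 2) (8 * (2 * x)).
  exact: is_derive_scale (is_derive_sqr x).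
have d5 : is_derive x (1 : R) (fun y => - 2 * (lorentz y * lorentz y)) (- 2 * (2 * (lorentz x * lorentz1 x))).
  exact: is_derive_scale d1.
have := is_deriveD d5 (is_deriveM d4 d3).
rewrite (_ : (fun y => - 2 * (lorentz y * lorentz y)) + _ = lorentz2); last first.
  by apply/funext => y; rewrite /lorentz2 -[LHS]/(- 2 * (lorentz y * lorentz y) + 8 * y ^+ 2 * (lorentz y * lorentz y * lorentz y)); ring.
rewrite (_ : _ + _ = lorentz3 x)//.
rewrite /lorentz3 /lorentz1 -[LHS]/(- 2 * (2 * (lorentz x * (- 2 * x * lorentz x ^+ 2))) + (8 * x ^+ 2 * (3 * (lorentz x * lorentz x * (- 2 * x * lorentz x ^+ 2))) + (lorentz x * lorentz x * lorentz x) * (8 * (2 * x)))).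
by ring.
Qed.

Lemma lorentz_bounds y : [/\ `|lorentz1 y| <= 2 * lorentz y, `|lorentz2 y| <= 10 * lorentz y & `|lorentz3 y| <= 72].
Proof.
have [b1 b2 b3] := lorentz_le y; have b0 := lorentz_gt0 y; have n0 := normr_ge0 y.
have nb : `|lorentz y| = lorentz y by rewrite gtr0_norm.
have q0 : 0 <= y ^+ 2 * lorentz y by rewrite mulr_ge0 ?sqr_ge0// ltW.
split.
- have -> : lorentz1 y = (- 2 * (y * lorentz y)) * lorentz y by rewrite /lorentz1; ring.
  rewrite normrM nb; apply: ler_wpM2r; first exact: ltW.
  by rewrite normrM normrN [`|2|]ger0_norm// normrM nb; lra.
- have -> : lorentz2 y = (- 2 * lorentz y + 8 * (y ^+ 2 * lorentz y) * lorentz y) * lorentz y by rewrite /lorentz2; ring.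
  rewrite normrM nb; apply: ler_wpM2r; first exact: ltW.
  by rewrite ler_norml; apply/andP; split; nra.
- have -> : lorentz3 y = (24 * lorentz y - 48 * (y ^+ 2 * lorentz y) * lorentz y) * (y * lorentz y) * lorentz y by rewrite /lorentz3; ring.
  rewrite normrM nb normrM [X in _ <= X](_ : 72 = 72 * 1 * 1); last by ring.
  apply: ler_pM; [by rewrite mulr_ge0|exact: ltW| |exact: b1].
  apply: ler_pM => //; last by rewrite normrM nb.
  by rewrite ler_norml; apply/andP; split; nra.
Qed.

Lemma lorentz_small e y : 0 < e -> e^-1 <= `|y| -> lorentz y <= e.
Proof.
move=> e0 ey; have y0 : 0 < `|y| by rewrite (lt_le_trans _ ey)// invr_gt0.
rewrite (@le_trans _ _ `|y|^-1)//.
  by rewrite lef_pV2 ?posrE ?lorentz_den// -(real_normK (num_real y)); have := sqr_ge0 (`|y| - 1); rewrite !expr2; nra.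
by rewrite -[leRHS]invrK lef_pV2 ?posrE// invr_gt0.
Qed.

(** The derivative bound gives uniform continuity, the Lorentzian the decay. *)
Lemma BUC0_lip (h h' : R -> R) C r X : 0 < r -> (forall x : R, is_derive x (1 : R) h (h' x)) ->
  (forall x, `|h' x| <= C) -> (forall x, `|h x| <= C * lorentz (r * (x - X))) -> BUC0 h.
Proof.
move=> r0 dh hC hb.
have C0 : 0 <= C by apply: le_trans (hC 0).
have far e : 0 < e -> exists N : R, forall x, N <= `|x| -> `|h x| <= e.
  move=> e0; have C1 : 0 < C + 1 by rewrite ltr_wpDl.
  exists (`|X| + (e / (C + 1))^-1 / r) => x Nx.
  apply: (le_trans (hb x)); apply: (@le_trans _ _ ((C + 1) * (e / (C + 1)))).
    apply: ler_pM => //; [exact/ltW/lorentz_gt0|by rewrite lerDl|].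
    apply: lorentz_small; first exact: divr_gt0.
    have h1 : (e / (C + 1))^-1 / r <= `|x - X|.
      by have := ler_distD X x 0; rewrite !subr0; lra.
    by rewrite normrM (gtr0_norm r0) [leRHS]mulrC -ler_pdivrMr.
  by rewrite mulrC divfK ?gt_eqF.
split.
- exists C => x; apply: (le_trans (hb x)); rewrite -[leRHS]mulr1; apply: ler_wpM2l => //.
  by have [] := lorentz_le (r * (x - X)).
- move=> A /= [e e0 eA]; have C1 : 0 < C + 1 by rewrite ltr_wpDl.
  exists (e / (C + 1)); first exact: divr_gt0.
  move=> [x y] /=; rewrite /ball/= ltr_pdivlMr// => xy; apply: eA; rewrite /=.
  apply: (@le_lt_trans _ _ (C * `|x - y|)); first exact: derive_bound_lip dh hC.
  by apply: le_lt_trans xy; rewrite mulrC; apply: ler_wpM2l => //; rewrite lerDl.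
- apply/cvgrPdist_le => e e0; have [N HN] := far e e0.
  exists (- N); split; first exact: num_real.
  move=> x xN; rewrite sub0r normrN; apply: HN.
  by have := ler_norm (- x); rewrite normrN; lra.
- apply/cvgrPdist_le => e e0; have [N HN] := far e e0.
  exists N; split; first exact: num_real.
  by move=> x xN; rewrite sub0r normrN; apply: HN; rewrite (le_trans (ltW xN))// ler_norm.
Qed.

Lemma affine_derive (g g' : R -> R) (al r X x : R) : (forall x : R, is_derive x (1 : R) g (g' x)) ->
  is_derive x (1 : R) (fun x => al * g (r * (x - X))) (al * r * g' (r * (x - X))).
Proof.
move=> dg.
have d1 : is_derive x (1 : R) (fun x => r * (x - X)) r.
  apply: is_derive_eq (is_derive_scale r (is_deriveB (is_derive_id x 1) (is_derive_cst X x 1))) _.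
  by rewrite subr0 mulr1.
have d2 : is_derive x (1 : R) (fun x => g (r * (x - X))) (g' (r * (x - X)) * r).
  have h1 := dg (r * (x - X)).
  by have := @is_derive1_comp R g (fun x => r * (x - X)) x; apply.
by apply: is_derive_eq (is_derive_scale al d2) _; ring.
Qed.

Definition wide_lorentz (al r X x : R) := al * lorentz (r * (x - X)).

Lemma wide_lorentz_derive1 al r X : ((wide_lorentz al r X)^`())%classic = fun x => al * r * lorentz1 (r * (x - X)).
Proof.
apply/funext => x; rewrite derive1E.
exact: (@derive_val _ _ _ _ _ _ _ (affine_derive al r X x lorentz_derive)).
Qed.

Lemma wide_lorentz_derive2 al r X : ((wide_lorentz al r X)^`(2))%classic = fun x => al * r * r * lorentz2 (r * (x - X)).
Proof.
apply/funext => x; rewrite /derive1n/= wide_lorentz_derive1 derive1E.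
exact: (@derive_val _ _ _ _ _ _ _ (affine_derive (al * r) r X x lorentz1_derive)).
Qed.

Lemma wide_lorentz_domL al r X : 0 < r <= 1 -> 0 <= al -> domL (wide_lorentz al r X).
Proof.
move=> /andP[r0 r1] al0.
have d0 (x : R) := affine_derive al r X x lorentz_derive.
have d1 (x : R) := affine_derive (al * r) r X x lorentz1_derive.
have d2 (x : R) := affine_derive (al * r * r) r X x lorentz2_derive.
have r01 : 0 <= r <= 1 by rewrite (ltW r0).
have ar0 : 0 <= al * r by rewrite mulr_ge0// ltW.
have ar1 : al * r <= al by rewrite ler_piMr.
have arr0 : 0 <= al * r * r by rewrite mulr_ge0// ltW.
have arr1 : al * r * r <= al by rewrite (le_trans _ ar1)// ler_piMr.
have arrr0 : 0 <= al * r * r * r by rewrite mulr_ge0// ltW.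
have arrr1 : al * r * r * r <= al by rewrite (le_trans _ arr1)// ler_piMr.
have bd (c C : R) (g : R -> R) y : 0 <= c -> c <= al -> `|g y| <= C -> `|c * g y| <= al * C.
  by move=> c0 ca gC; rewrite normrM ger0_norm//; apply: ler_pM.
have b1 y : lorentz y <= 1 by have [] := lorentz_le y.
have B0 y := lorentz_gt0 y.
have K1 y : `|lorentz1 y| <= 72 by have [h _ _] := lorentz_bounds y; have := b1 y; lra.
have K2 y : `|lorentz2 y| <= 72 by have [_ h _] := lorentz_bounds y; have := b1 y; lra.
have K3 y : `|lorentz3 y| <= 72 by have [_ _ h] := lorentz_bounds y.
have bu0 y : `|lorentz y| <= 72 * lorentz y by rewrite gtr0_norm//; have := B0 y; lra.
have bu1 y : `|lorentz1 y| <= 72 * lorentz y by have [h _ _] := lorentz_bounds y; have := B0 y; lra.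
have bu2 y : `|lorentz2 y| <= 72 * lorentz y by have [_ h _] := lorentz_bounds y; have := B0 y; lra.
split.
- apply: (@BUC0_lip _ _ (al * 72) r X r0 d0) => x; first exact: bd.
  by rewrite -[leRHS]mulrA; apply: bd.
- by move=> x; exact: (@ex_derive _ _ _ _ _ _ _ (d0 x)).
- rewrite wide_lorentz_derive1; apply: (@BUC0_lip _ _ (al * 72) r X r0 d1) => x; first exact: bd.
  by rewrite -[leRHS]mulrA; apply: bd.
- by rewrite wide_lorentz_derive1 => x; exact: (@ex_derive _ _ _ _ _ _ _ (d1 x)).
- rewrite wide_lorentz_derive2; apply: (@BUC0_lip _ _ (al * 72) r X r0 d2) => x; first exact: bd.
  by rewrite -[leRHS]mulrA; apply: bd.
Qed.

End lorentz.

Section gap.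
Context {R : realType} (f : R -> R) (theta : R) (Hf : bistable f theta).
Variables (c : R) (phi : R -> R) (Hphi : travelling_wave f theta c phi).

(** Ahead of the front the operator is close to [v'' + c v' + f'(0) v], so slowly
    varying bumps placed there are approximate eigenfunctions for [f'(0)]. *)
Lemma spectrum_f'0 : spectrum f c phi (Complex (f' f 0) 0).
Proof.
move=> [_ [K HK]].
have [L [M2 [L0 M20 fB fL fT]]] := bistable_bounds Hf.
have c0 := wave_speed_gt0 Hf Hphi.
pose eta := (2 * (`|K| + 1))^-1.
have K1 : 0 < `|K| + 1 by rewrite ltr_wpDl.
have eta0 : 0 < eta by rewrite invr_gt0 mulr_gt0.
(* wide enough for the two derivatives to contribute at most [eta / 2] *)
pose r := Num.min 1 (eta / 2 / (10 + 2 * c)).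
have cc : 0 < 10 + 2 * c by rewrite addr_gt0// mulr_gt0.
have r0 : 0 < r by rewrite lt_min ltr01 !divr_gt0.
have r1 : r <= 1 by rewrite ge_min lexx.
have rc : r * (10 + 2 * c) <= eta / 2 by rewrite -ler_pdivlMr// ge_min lexx orbT.
pose e := eta / 2 / M2; have e0 : 0 < e by rewrite !divr_gt0.
have [N HN] := wave_right_eps Hphi e0.
(* so far ahead that the bump is below [e] wherever [phi] may exceed [e] *)
pose X := N + e^-1 / r.
pose v := wide_lorentz 1 r X.
pose vC := fun x : R => Complex (v x) 0.
have dv : domLC vC.
  split; first by apply: wide_lorentz_domL; rewrite ?r0.
  rewrite (_ : (fun x => _) = wide_lorentz 0 r X); first by apply: wide_lorentz_domL; rewrite ?r0.
  by apply/funext => x; rewrite /wide_lorentz mul0r.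
have fdiff x : `|f' f (phi x) - f' f 0| <= M2 * phi x.
  have /andP[p0 p1] := wave01 Hphi x.
  have zero01 : 0 <= (0 : R) <= 1 by rewrite lexx ler01.
  have [_ h] := fL 0 (phi x) zero01 (wave01 Hphi x).
  by rewrite subr0 (ger0_norm p0) in h; exact: h.
have small x : `|f' f 0 * v x - opL f c phi v x| <= eta.
  have [y1 y2 _] := lorentz_bounds (r * (x - X)); have [b1 _ _] := lorentz_le (r * (x - X)).
  have b0 := lorentz_gt0 (r * (x - X)).
  rewrite /opL /v wide_lorentz_derive1 wide_lorentz_derive2 !mul1r /wide_lorentz mul1r.
  set y := r * (x - X) in y1 y2 b1 b0 *.
  have -> : f' f 0 * lorentz y - (r * r * lorentz2 y + c * (r * lorentz1 y) + f' f (phi x) * lorentz y) =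
    - (r * (r * lorentz2 y + c * lorentz1 y)) - (f' f (phi x) - f' f 0) * lorentz y by ring.
  rewrite (splitr eta) (le_trans (ler_normB _ _))// lerD//.
    rewrite normrN normrM (gtr0_norm r0); apply: le_trans rc; apply: ler_wpM2l; first exact: ltW.
    rewrite (le_trans (ler_normD _ _))// lerD// normrM.
      rewrite (gtr0_norm r0) -[10]mul1r; apply: ler_pM => //; first exact: ltW.
      by apply: (le_trans y2); lra.
    by rewrite (gtr0_norm c0) mulrC; apply: ler_wpM2r; [exact: ltW|lra].
  rewrite normrM (gtr0_norm b0).
  have -> : eta / 2 = M2 * e by rewrite /e; field; rewrite gt_eqF.
  have /andP[p0 p1] := wave01 Hphi x.
  apply: (@le_trans _ _ (M2 * phi x * lorentz y)).
    by apply: ler_wpM2r; [exact: ltW|exact: fdiff].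
  rewrite -mulrA; apply: ler_wpM2l; first exact: ltW.
  have [Nx|xN] := leP N x.
    by rewrite -[e]mulr1; apply: ler_pM => //; [exact: ltW|exact: HN].
  rewrite -[e]mul1r; apply: ler_pM => //; first exact: ltW.
  apply: lorentz_small => //; rewrite /y /X normrM (gtr0_norm r0) distrC ger0_norm; last first.
    by have er : 0 < e^-1 / r; [rewrite divr_gt0 ?invr_gt0|lra].
  rewrite [X in X <= _](_ : _ = r * (e^-1 / r)); last by field; rewrite !gt_eqF.
  by apply: ler_wpM2l; [exact: ltW|lra].
have normC0 (a : R) : Normc.normc (Complex a 0) = `|a| by rewrite /Normc.normc/= expr0n/= addr0 sqrtr_sqr.
have im0 x : opL f c phi (fun y => complex.Im (vC y)) x = 0.
  rewrite (_ : (fun y => _) = wide_lorentz 0 r X); last by apply/funext => y; rewrite /wide_lorentz mul0r.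
  by rewrite /opL wide_lorentz_derive1 wide_lorentz_derive2 /wide_lorentz !mul0r !mulr0 !addr0.
have sm x : Normc.normc (Complex (f' f 0) 0 * vC x - opLC f c phi vC x) <= eta.
  rewrite (_ : _ - _ = Complex (f' f 0 * v x - opL f c phi v x) 0); first by rewrite normC0.
  rewrite /opLC im0 /vC; apply/eqP; rewrite eq_complex/=; apply/andP; split; apply/eqP; ring.
have := HK vC eta dv sm X; rewrite normC0 /v /wide_lorentz subrr mulr0 /lorentz expr0n/= addr0 invr1 mul1r normr1.
apply/negP; rewrite -ltNge (le_lt_trans (ler_norm _))// normrM (gtr0_norm eta0) /eta.
by rewrite ltr_pdivrMr ?mulr_gt0// mul1r; have := normr_ge0 K; lra.
Qed.

Lemma spectral_gap_le : spectral_gap f c phi <= f'_supnorm f.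
Proof.
have [_ _ _ [f0 _] _] := Hf.
have zero01 : 0 <= (0 : R) <= 1 by rewrite lexx ler01.
have b := supnorm_bound Hf zero01; rewrite ltr0_norm// in b.
have [S0|S0] := pselect (exists rho, 0 < rho /\ forall lam : R[i], spectrum f c phi lam -> lam != 0 ->
      complex.Re lam <= - rho); last first.
  rewrite /spectral_gap (_ : [set rho | _] = set0) ?sup0.
    by rewrite (le_trans _ b)// oppr_ge0 ltW.
  by rewrite -subset0 => rho H; apply: S0; exists rho.
apply: ge_sup => // rho [rho0 H]; apply: le_trans b.
rewrite lerNr; apply: (H _ spectrum_f'0).
by rewrite eq_complex/= negb_and lt_eqF.
Qed.

End gap.

(** * The entire solution *)

Theorem theorem2 (R : realType) (f : R -> R) (theta : R) (Hf : bistable f theta)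
    (c : R) (phi : R -> R) (Hphi : travelling_wave f theta c phi)
    (Hgap : 0 < spectral_gap f c phi) :
  exists varpi : R,
    [/\ varpi = spectral_gap f c phi / f'_supnorm f,
        0 < varpi &
        forall g : R -> R,
          lebesgue_measurable g ->
          (exists M : R, forall x : R, `|g x| <= M) ->
          (exists kappa : R, 0 < kappa /\
             forall x : R, `|g x| <= expR (kappa * x)) ->
          (forall x : R, - varpi < g x) ->
          exists u : R -> R -> R,
            strong_solution f g u /\
            ('N[@lebesgue_measure R]_+oo[(fun x : R => (u t x - phi (x - c * t))%:E)])%E
              @[t --> -oo%R] --> 0%E].
Proof.
have gapN := spectral_gap_le Hf Hphi.
have N0 : 0 < f'_supnorm f := lt_le_trans Hgap gapN.
exists (spectral_gap f c phi / f'_supnorm f); split => //; first exact: divr_gt0.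
move=> g [h [mh gh]] [M gM] [kappa [kappa0 gk]] glow.
(* the spectral gap bound enters here: [varpi <= 1] *)
have g1 x : -1 <= g x.
  apply: le_trans (ltW (glow x)); rewrite lerN2 ler_pdivrMr// mul1r//.
pose m x : R := Num.min M (expR (kappa * x)).
have M0 : 0 <= M by apply: le_trans (gM 0).
have m0 x : 0 <= m x by rewrite le_min M0 expR_ge0.
have gm x : `|g x| <= m x by rewrite le_min gM gk.
(* a Borel representative of [g] satisfying the same bounds everywhere *)
pose gt x := Num.max (- Num.min (m x) 1) (Num.min (m x) (h x)).
have mm : measurable_fun setT (m : measurableTypeR R -> R).
  apply: measurable_minr => //; apply: continuous_measurable_fun => x.
  apply: (@continuous_comp _ _ _ (fun x : R => kappa * x) (@expR R)); last exact: continuous_expR.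
  by apply: cvgM; [exact: cvg_cst|exact: cvg_id].
have mgt : measurable_fun setT (gt : measurableTypeR R -> R).
  apply: measurable_maxr; last exact: measurable_minr.
  by apply: measurable_funN; exact: measurable_minr.
have gt_le x : `|gt x| <= m x.
  rewrite ler_norml /gt; apply/andP; split.
    by rewrite le_max lerN2 ge_min lexx.
  rewrite ge_max ge_min lexx andbT (le_trans _ (m0 x))// oppr_le0 le_min m0 ler01//.
have gt1 x : -1 <= gt x by rewrite /gt le_max lerN2 ge_min lexx orbT.
have gtE x : g x = h x -> gt x = g x.
  move=> E; have := gm x; rewrite ler_norml => /andP[lo hi].
  by rewrite /gt -E (min_r hi) max_r// lerNl le_min lerNl lo/= lerNl g1.
have gtM x : `|gt x| <= M by rewrite (le_trans (gt_le x))// ge_min lexx.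
have gtk x : `|gt x| <= expR (kappa * x) by rewrite (le_trans (gt_le x))// ge_min lexx orbT.
have [u [[s1 s2 s3 s4 s5] [A [r [T [A0 r0 uA]]]]]] :=
  entire_solution Hf Hphi M0 kappa0 mgt gtM gtk gt1.
exists u; split.
  split => // t; apply: filterS2 (s5 t) gh; first exact: (ae_filter_ringOfSetsType (@lebesgue_measure R)).
  by move=> x [d E] ghx; split => //; rewrite E gtE.
apply: (@squeeze_cvge _ _ _ _ (cst 0%E) _ (fun t => (A * expR (r * t))%:E)); last 2 first.
- exact: cvg_cst.
- apply: cvg_EFin; first exact: nearW.
  rewrite -[X in _ --> X](mulr0 A); apply: cvgM; first exact: cvg_cst.
  apply/cvgrPdist_le => e e0; near=> t.
  rewrite sub0r normrN ger0_norm ?expR_ge0// -[leRHS]lnK ?posrE// ler_expR.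
  rewrite mulrC -ler_pdivlMr//; near: t; exact: nbhs_ninfty_le.
near=> t; rewrite Lnorm_ge0/= unlock /=; case: ifP => _; last first.
  by rewrite lee_fin mulr_ge0// expR_ge0.
apply/ess_sup_inf.ess_supP; apply: nearW => x /=; rewrite lee_fin; apply: uA.
near: t; apply: nbhs_ninfty_le; exact: num_real.
Unshelve. all: by end_near. Qed.
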